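(* Let $\mathcal H^{(1)}$ be an affine pro-$p$ Hecke algebra over a commutative ring $R$ (notation as in the context). For every spherical orientation $\mathfrak o$ of $W^{(1)}$, the center of $\mathcal H^{(1)}$ is \[ Z(\mathcal H^{(1)})=\big(\mathcal A^{(1)}_{\mathfrak o}\big)^{W^{(1)}}. \] It is a free $R$-module with basis $\{z_\gamma\}$ indexed by the finite orbits $\gamma$ of the conjugation action of $W^{(1)}$ on $X^{(1)}$, where $z_\gamma=\sum_{x\in\gamma}\widehat\theta_{\mathfrak o}(x)$ for every spherical orientation $\mathfrak o$.
   Context: Affine extended Coxeter group: group $W$, $\rho:W\to\mathrm{Aut}_{\mathrm{aff}}(V)$ ($V$ finite-dimensional real), locally finite set $\mathfrak H$ of affine hyperplanes, chamber $C_0$ (component of $V\setminus\bigcup\mathfrak H$), $\widetilde s_H\in W$, satisfying (ACI) $W$ preserves $\mathfrak H$; (ACII) $\rho(\widetilde s_H)$ a reflection fixing $H$; (ACIII) linear parts $W_0=\rho_0(W)$ finite; (ACIV) $0$ special; (ACV) translations in $\rho(W)$ span $V/\bigcap_{0\in H}H$; (ACVI) $w\widetilde s_Hw^{-1}=\widetilde s_{\rho(w)(H)}$; (ACVII) $(\widetilde s_{H_1}\widetilde s_{H_2})^m=1$ for walls $H_1,H_2$ of $C_0$ with $\rho(\widetilde s_{H_1}\widetilde s_{H_2})$ of order $m<\infty$; (ACVIII) $W_0$ generated by images of $\widetilde s_H$; (ACIX) $0\in\overline{C_0}$; (ACX) $X=\rho^{-1}(V)$ finitely generated commutative. Extended Coxeter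 group: $W_{\mathrm{aff}}=\langle\widetilde s_H\rangle$, $S=\{\widetilde s_H:H\text{ wall of }C_0\}$, $\Omega=\mathrm{Stab}_W(C_0)$, $W=W_{\mathrm{aff}}\rtimes\Omega$, length $\ell$. $\Phi=\{\alpha\in V^\vee:\forall k\in\mathbb R,\{\alpha+k=0\}\in\mathfrak H\iff k\in\mathbb Z\}$; Weyl chambers: components $D$ of $V\setminus\bigcup_{\alpha\in\Phi}\ker\alpha$. Affine pro-$p$ Hecke algebra: generic pro-$p$ Hecke algebra for a pro-$p$ Coxeter group $1\to T\to W^{(1)}\xrightarrow\pi W\to1$ ($T$ abelian, lifts $n_s\in\pi^{-1}(s)$ with braid relations): $a_s\in R$, $b_s\in R[T]$ with $a_s=a_t$ and $(n_swn_t^{-1}w^{-1})w(b_t)=b_s$ whenever $s\pi(w)=\pi(w)t$; free on $\{T_w\}_{w\in W^{(1)}}$, $T_{ww'}=T_wT_{w'}$ if lengths (via $\pi$) add, $T_{n_s}^2=a_sT_{n_s^2}+T_{n_s}b_s$, $R[T]\ni t\mapsto T_t$. $X^{(1)}=\pi^{-1}(X)$, $\Omega^{(1)}=\pi^{-1}(\Omega)$. Spherical orientation $\mathfrak o_D$: for $w\in W^{(1)},s\in S$, the chambers $\rho(\pi(w))(C_0),\rho(\pi(w)s)(C_0)$ are separated by a unique $H=\{\alpha+k=0\}$ with $\alpha\in\Phi$ positive on $D$; $\mathfrak o_D(w,s)=+1$ if $\alpha$ is larger on $\rho(\pi(w)s)(C_0)$, else $-1$. Integral Bernstein map: $\widehat\theta_{\mathfrak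 o}(w)=T_1\cdots T_rT_u$ for $w=n_{s_1}\cdots n_{s_r}u$, $u\in\Omega^{(1)}$, $r=\ell(\pi(w))$, $T_i=T_{n_{s_i}}$ if $\mathfrak o(n_{s_1}\cdots n_{s_{i-1}},s_i)=+1$, else $T_{n_{s_i}}-b_{s_i}$. $\mathcal A^{(1)}_{\mathfrak o}=\bigoplus_{x\in X^{(1)}}R\widehat\theta_{\mathfrak o}(x)$ (a subalgebra), with $R$-linear $W^{(1)}$-action $w(\widehat\theta_{\mathfrak o}(x))=\widehat\theta_{\mathfrak o}(wxw^{-1})$. *)

(* Defs.v *)
From HB Require Import structures.
From mathcomp Require Import all_boot all_order all_algebra.
From mathcomp Require Import all_classical all_reals all_analysis.

Set Implicit Arguments.
Unset Strict Implicit.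
Unset Printing Implicit Defensive.

Import Order.TTheory GRing.Theory Num.Theory.
Import numFieldTopology.Exports numFieldNormedType.Exports.
Local Open Scope classical_set_scope.
Local Open Scope ring_scope.

Section GroupNotions.
Variable G : groupType.

Definition gprod (l : seq G) : G := foldr (fun x y => x * y)%g 1%g l.

Definition gen_by (P : set G) (x : G) : Prop :=
  exists (l : nat) (g : 'I_l -> G) (e : 'I_l -> bool),
    (forall j, P (g j)) /\
    x = gprod [seq (if e j then g j else (g j)^-1)%g | j <- enum 'I_l].

Definition grp_order (x : G) (m : nat) : Prop :=
  (0 < m)%N /\ (x ^+ m = 1)%g /\ forall k, (0 < k < m)%N -> (x ^+ k <> 1)%g.

Definition alt_prod (a b : G) (m : nat) : G :=
  gprod [seq (if odd i then b else a) | i <- iota 0 m].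

Definition is_ghom (G' : groupType) (f : G -> G') :=
  forall x y, f (x * y)%g = (f x * f y)%g.

Definition conj_orbit (x : G) : set G := [set (w * x * w^-1)%g | w in [set: G]].

End GroupNotions.

Section Affine.
Variables (K : realType) (n : nat).
Local Notation V := 'cV[K]_n.

Definition lform (a : 'rV[K]_n) (v : V) : K := (a *m v) 0 0.

Definition hyp (a : 'rV[K]_n) (k : K) : set V := [set v | lform a v + k = 0].

Definition is_hyperplane (H : set V) : Prop :=
  exists (a : 'rV[K]_n) (k : K), a != 0 /\ H = hyp a k.

Definition aff_app (g : 'M[K]_n * V) (v : V) : V := g.1 *m v + g.2.

Definition locally_finite (hs : set (set V)) : Prop :=
  forall v : V, exists2 U : set V, nbhs v U &
    finite_set [set H | hs H /\ (H `&` U) !=set0].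

Definition is_component_of_complement (U : set V) (C : set V) : Prop :=
  exists v : V, ~ U v /\ C = connected_component (~` U) v.

Definition is_chamber (hs : set (set V)) (C : set V) : Prop :=
  is_component_of_complement (\bigcup_(H in hs) H) C.

Definition is_wall (hs : set (set V)) (C : set V) (H : set V) : Prop :=
  hs H /\ exists2 v, H v & exists2 U : set V, nbhs v U & (H `&` U) `<=` closure C.

Definition is_reflection_fixing (f : V -> V) (H : set V) : Prop :=
  (forall v, f (f v) = v) /\ [set v | f v = v] = H.

Definition parallel (H H' : set V) : Prop := exists t : V, H' = [set v + t | v in H].

Definition special_point (hs : set (set V)) (x : V) : Prop :=
  forall H, hs H -> exists H', [/\ hs H', parallel H H' & H' x].

Definition map_order (f : V -> V) (m : nat) : Prop :=
  (0 < m)%N /\ (forall v, iter m f v = v) /\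
  forall k, (0 < k < m)%N -> exists v, iter k f v <> v.

Section WithW.
Variables (W : groupType) (rho : W -> 'M[K]_n * V).

Definition act (w : W) : V -> V := aff_app (rho w).

Definition is_aff_rep : Prop :=
  rho 1%g = (1%:M, 0) /\
  forall w w', rho (w * w')%g =
     ((rho w).1 *m (rho w').1, (rho w).1 *m (rho w').2 + (rho w).2).

Definition Xtr : set W := [set w | (rho w).1 = 1%:M].

Variables (hs : set (set V)) (C0 : set V) (sH : set V -> W).

Definition affine_ext_coxeter : Prop :=
  is_aff_rep /\ (forall H, hs H -> is_hyperplane H) /\ locally_finite hs /\
  is_chamber hs C0 /\
  (* ACI *) (forall w H, hs H -> hs (act w @` H)) /\
  (* ACII *) (forall H, hs H -> is_reflection_fixing (act (sH H)) H) /\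
  (* ACIII *) finite_set [set (rho w).1 | w in [set: W]] /\
  (* ACIV *) special_point hs 0 /\
  (* ACV *) (forall v : V, exists (m : nat) (c : 'I_m -> K) (t : 'I_m -> W),
       (forall i, Xtr (t i)) /\
       (\bigcap_(H in [set H | hs H /\ H 0]) H) (v - \sum_(i < m) c i *: (rho (t i)).2)) /\
  (* ACVI *) (forall w H, hs H -> sH (act w @` H) = (w * sH H * w^-1)%g) /\
  (* ACVII *) (forall H1 H2 m, is_wall hs C0 H1 -> is_wall hs C0 H2 ->
       map_order (act (sH H1 * sH H2)%g) m -> ((sH H1 * sH H2) ^+ m = 1)%g) /\
  (* ACVIII *) (forall w, exists w', gen_by [set sH H | H in hs] w' /\
                              (rho w).1 = (rho w').1) /\
  (* ACIX *) closure C0 0 /\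
  (* ACX *) ((forall x y, Xtr x -> Xtr y -> (x * y = y * x)%g) /\
       exists (m : nat) (g : 'I_m -> W), (forall i, Xtr (g i)) /\
         forall x, Xtr x -> gen_by [set g i | i in [set: 'I_m]] x).

Definition Sgen : set W := [set sH H | H in is_wall hs C0].
Definition Omega : set W := [set w | act w @` C0 = C0].

Definition word_len (w : W) (r : nat) : Prop :=
  exists (ss : 'I_r -> W) (u : W), (forall i, Sgen (ss i)) /\ Omega u /\
     w = (gprod [seq ss i | i <- enum 'I_r] * u)%g.

Definition ell (w : W) : nat :=
  xget 0%N [set r | word_len w r /\ forall r', word_len w r' -> (r <= r')%N].

Definition Phi : set 'rV[K]_n :=
  [set a | forall k : K, hs (hyp a k) <-> k \is a Num.int].

Definition is_weyl_chamber (D : set V) : Prop :=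
  is_component_of_complement (\bigcup_(a in Phi) [set v | lform a v = 0]) D.

Section ProP.
Variables (W1 : groupType) (pi : W1 -> W) (nl : W -> W1).

Definition Tker : set W1 := [set t | pi t = 1%g].

Definition pro_p_coxeter : Prop :=
  [/\ is_ghom pi, (forall w, exists w1, pi w1 = w),
      (forall t t', Tker t -> Tker t' -> (t * t' = t' * t)%g),
      (forall s, Sgen s -> pi (nl s) = s) &
      (forall s t m, Sgen s -> Sgen t -> s <> t -> grp_order (s * t)%g m ->
          alt_prod (nl s) (nl t) m = alt_prod (nl t) (nl s) m)].

Definition X1 : set W1 := [set x | Xtr (pi x)].
Definition Omega1 : set W1 := [set u | Omega (pi u)].

(* spherical orientation o_D : o_D(w, s) = +1 iff [orient_pos D w s] *)
Definition orient_pos (D : set V) (w : W1) (s : W) : Prop :=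
  exists (a : 'rV[K]_n) (k : K),
    [/\ Phi a, (forall d, D d -> 0 < lform a d), hs (hyp a k),
        (forall x, (act (pi w) @` C0) x -> lform a x + k < 0) &
        (forall y, (act (pi w * s)%g @` C0) y -> 0 < lform a y + k)].

Variables (R : comNzRingType) (HA : algType R) (T : W1 -> HA)
          (a : W -> R) (b : W -> W1 -> R).

(* elements of R[T] are finitely supported functions W1 -> R supported on T;
   the map R[T] -> HA, t |-> T_t *)
Definition in_RT (c : W1 -> R) : Prop :=
  finite_set [set t | c t != 0] /\ [set t | c t != 0] `<=` Tker.
Definition RT_to_H (c : W1 -> R) : HA := \sum_(t \in Tker) c t *: T t.

Definition fin_supp (c : W1 -> R) : Prop := finite_set [set w | c w != 0].

Definition generic_hecke : Prop :=
      (forall s, Sgen s -> in_RT (b s)) /\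
      (forall s t w, Sgen s -> Sgen t -> (s * pi w = pi w * t)%g ->
         a s = a t /\
         let u := (nl s * w * (nl t)^-1 * w^-1)%g in
         forall x, b t (w^-1 * (u^-1 * x) * w)%g = b s x) /\
      (forall h : HA, exists c, fin_supp c /\ h = \sum_(w \in [set: W1]) c w *: T w) /\
      (forall c, fin_supp c -> \sum_(w \in [set: W1]) c w *: T w = 0 ->
                 forall w, c w = 0) /\
      (forall w w', ell (pi (w * w')%g) = (ell (pi w) + ell (pi w'))%N ->
                    T (w * w')%g = T w * T w') /\
      (forall s, Sgen s ->
         T (nl s) ^+ 2 = a s *: T (nl s * nl s)%g + T (nl s) * RT_to_H (b s)).

Definition bernstein_rel (D : set V) (w : W1) (h : HA) : Prop :=
  exists (r : nat) (ss : 'I_r -> W) (u : W1),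
    [/\ r = ell (pi w), (forall i, Sgen (ss i)), Omega1 u,
        w = (gprod [seq nl (ss i) | i <- enum 'I_r] * u)%g &
        h = (\prod_(i < r)
              (let pre := gprod [seq nl (ss j) | j <- [seq j <- enum 'I_r | (val j < val i)%N]] in
               if `[< orient_pos D pre (ss i) >] then T (nl (ss i))
               else T (nl (ss i)) - RT_to_H (b (ss i))))
            * T u].

Definition theta (D : set V) (w : W1) : HA := xget 0 [set h | bernstein_rel D w h].

(* (A^(1)_o)^{W^(1)} : elements sum_x c_x theta(x) (x in X1) fixed by the
   R-linear action w(theta(x)) = theta(w x w^-1) *)
Definition A_invariants (D : set V) : set HA :=
  [set h | exists c : W1 -> R,
     [/\ fin_supp c, [set x | c x != 0] `<=` X1,
         h = \sum_(x \in X1) c x *: theta D x &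
         forall w, \sum_(x \in X1) c x *: theta D (w * x * w^-1)%g = h]].

Definition hecke_center : set HA := [set z | forall h, z * h = h * z].

Definition z_orbit (D : set V) (x : W1) : HA := \sum_(y \in conj_orbit x) theta D y.

Definition finite_orbit_rep (x : W1) : Prop := X1 x /\ finite_set (conj_orbit x).

End ProP.
End WithW.
End Affine.

(* Main.v *)
Require Import Defs.
From HB Require Import structures.
From mathcomp Require Import all_boot all_order all_algebra finmap.
From mathcomp Require Import all_classical all_reals all_analysis.
From mathcomp Require Import zify lra ring.
Import Order.TTheory GRing.Theory Num.Theory.
Import numFieldTopology.Exports numFieldNormedType.Exports.
Set Implicit Arguments.
Unset Strict Implicit.
Unset Printing Implicit Defensive.
Local Open Scope classical_set_scope.
Local Open Scope ring_scope.

(* A hyperplane H is recorded through its reflection t = s_H, and an orientation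
   through the sign e(t) it gives to the crossing of H that leaves the side of
   C_0.  If e and e' are exchanged by every reflection in a set P of reflections
   and differ exactly on P, then

     theta_e'(w) = theta_e(w) + sum_y +-q(w, y) b(y) theta_e(y w),

   where y runs over the lifts of the reflections in P whose hyperplane separates
   C_0 from w C_0, b is conjugation invariant, and q(w, y) is a monomial in the
   a_s.  With P = {t}, iterated along a gallery, this yields theta for the
   orientations towards a chamber, and in the limit for the spherical ones.  When
   P consists of the reflections in a full parallelism class, the map
   (x, y) -> (x', y') with x' = y x y^-1 and y' x' = y x cancels the corrections
   in sum_x c(x) theta_e'(x), c a conjugation invariant function on X^(1), in
   pairs.  So this sum is the same for all spherical orientations, and
   moving T_{n_s} across it merely changes the orientation: it is central.

   Conversely, let z be central and let l be the maximal length in its expansion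
   in the T_w.  Comparing coefficients of length l + 1 in T_{n_s} z = z T_{n_s}
   shows that the coefficients of z at length l are invariant under those
   conjugations by n_s and Omega^(1) that preserve the length, and then that they
   vanish off X^(1), since powers of a suitable translation would carry such a term
   to infinitely many others.  So subtracting sum c(x) theta(x) lowers l. *)

(** * Separating reflections and length *)

(** The parameters a_s may be zero divisors, so theta cannot be built by inverting the T_{n_s}, and
    it is not clear beforehand that the product defining theta(w) is independent of the reduced
    word. Instead, theta is characterized by a relation that also covers crossings back towards C_0:
    multiplying F(w) by the letter of s gives F(w n_s), times a_s if the crossing returns. Such an F
    is unique; its existence is what the flip formula provides, starting from F = T for the
    orientation away from C_0. Limits of orientations make sense because F(w) sees the orientation
    only on the finitely many hyperplanes separating C_0 from wC_0.

    The monomials q(w, y) correspond to square roots of quotients of Hecke parameters. Here their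
    exponents are numbers of hyperplanes, so no root or inverse has to exist in R.

    The algebra meets the geometry only through the records [wall_system], [hecke_datum] and
    [spherical_datum], which are verified for affine extended Coxeter groups at the end. *)

Definition cnj (G : groupType) (g x : G) : G := (g * x * g^-1)%g.

Section Conjugation.
Variable G : groupType.
Implicit Types g h x y : G.

Lemma cnjM g h x : cnj (g * h)%g x = cnj g (cnj h x).
Proof. by rewrite /cnj invgM !mulgA. Qed.

Lemma cnj1 x : cnj 1%g x = x.
Proof. by rewrite /cnj invg1 mul1g mulg1. Qed.

Lemma cnjg1 g : cnj g 1%g = 1%g.
Proof. by rewrite /cnj mulg1 mulgV. Qed.

Lemma cnjK g : cancel (cnj g) (cnj g^-1%g).
Proof. by move=> x; rewrite -cnjM mulVg cnj1. Qed.

Lemma cnjVK g : cancel (cnj g^-1%g) (cnj g).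
Proof. by move=> x; rewrite -cnjM mulgV cnj1. Qed.

Lemma cnj_eq g x y : (cnj g x == y) = (x == cnj g^-1%g y).
Proof. by rewrite (can2_eq (cnjK g) (cnjVK g)). Qed.

Lemma cnj_id x : cnj x x = x.
Proof. by rewrite /cnj mulgK. Qed.

Lemma cnjMM g x y : cnj g (x * y)%g = (cnj g x * cnj g y)%g.
Proof. by rewrite /cnj !mulgA mulgVK. Qed.

Lemma cnjV g x : cnj g x^-1%g = (cnj g x)^-1%g.
Proof. by rewrite /cnj !invgM invgK !mulgA. Qed.

Lemma cnj_mulr g x : (cnj g x * g)%g = (g * x)%g.
Proof. by rewrite /cnj mulgVK. Qed.

End Conjugation.

(* [sep t w] reads: the hyperplane of the reflection [t] separates [C0] and
   [w C0]; it is [false] when [t] is not a reflection. *)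
Record wall_system (W : groupType) (S : set W) (sep : W -> W -> bool) : Prop :=
  WallSystem {
  sepJ : forall g t w,
    sep (cnj g t) (g * w)%g = sep t w (+) sep (cnj g t) g;
  sep_simple : forall s t, S s -> sep t s = (t == s);
  sep_finite : forall w, finite_set [set t | sep t w];
  sep_wall : forall w t, sep t w -> exists2 s, S s & sep s w;
  simple_sq : forall s, S s -> (s * s)%g = 1%g }.

Section WallSystemTheory.
Variables (W : groupType) (S : set W) (sep : W -> W -> bool).
Hypothesis ws : wall_system S sep.
Implicit Types (s t u v w g : W) (Q : set W).

Definition nosep : set W := [set u | forall t, sep t u = false].

(** Counting inside a set [Q] lets the same lemmas serve the length and the exponents of the
    individual parameters, where [Q] collects the reflections of one weight. *)
Definition wlen Q w : nat := #|` fset_set ([set t | sep t w] `&` Q)|.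
Definition len w : nat := wlen setT w.

Lemma simpleV s : S s -> (s^-1)%g = s.
Proof. by move=> Ss; apply: mulg1_eq; exact: simple_sq ws _ Ss. Qed.

Lemma simpleK w s : S s -> (w * s * s)%g = w.
Proof. by move=> Ss; rewrite -mulgA (simple_sq ws Ss) mulg1. Qed.

Lemma cnj_simple s t : S s -> cnj s (cnj s t) = t.
Proof. by move=> Ss; rewrite -cnjM (simple_sq ws Ss) cnj1. Qed.

Lemma sep1 t : sep t 1%g = false.
Proof. by have := sepJ ws 1 t 1; rewrite cnj1 mulg1 addbb. Qed.

Lemma nosep1 : nosep 1%g.
Proof. by move=> t; rewrite sep1. Qed.

Lemma sepM t g w : sep t (g * w)%g = sep (cnj g^-1%g t) w (+) sep t g.
Proof. by rewrite -{1}(cnjVK g t) (sepJ ws) cnjVK. Qed.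

Lemma sepV t w : sep t w^-1%g = sep (cnj w t) w.
Proof.
have := sepM (cnj w t) w w^-1; rewrite mulgV sep1 cnjK.
by case: (sep t _); case: (sep _ w).
Qed.

Lemma sepMs t w s : S s -> sep t (w * s)%g = (t == cnj w s) (+) sep t w.
Proof. by move=> Ss; rewrite sepM (sep_simple ws _ Ss) cnj_eq invgK. Qed.

Lemma sepsM t w s : S s -> sep t (s * w)%g = sep (cnj s t) w (+) (t == s).
Proof. by move=> Ss; rewrite sepM simpleV// (sep_simple ws _ Ss). Qed.

Lemma sepMu t w u : nosep u -> sep t (w * u)%g = sep t w.
Proof. by move=> uO; rewrite sepM uO. Qed.

Lemma sepuM t w u : nosep u -> sep t (u * w)%g = sep (cnj u^-1%g t) w.
Proof. by move=> uO; rewrite sepM uO addbF. Qed.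

Lemma nosepV u : nosep u -> nosep u^-1%g.
Proof. by move=> uO t; rewrite sepV uO. Qed.

Lemma finite_sepQ Q w : finite_set ([set t | sep t w] `&` Q).
Proof. by apply: finite_setIl; exact: (sep_finite ws). Qed.

Lemma eq_wlen Q v w : (forall t, sep t v = sep t w) -> wlen Q v = wlen Q w.
Proof.
move=> E; rewrite /wlen; congr #|` fset_set (_ `&` _)|.
by apply/seteqP; split=> t /=; rewrite E.
Qed.

Lemma nosep_wlen Q u : nosep u -> wlen Q u = 0%N.
Proof.
move=> uO; apply/eqP; rewrite cardfs_eq0; apply/eqP; rewrite -fset_set0; congr fset_set.
by apply/seteqP; split=> t //= []; rewrite uO.
Qed.

Lemma wlenMu Q w u : nosep u -> wlen Q (w * u)%g = wlen Q w.
Proof. by move=> uO; apply: eq_wlen => t; rewrite sepMu. Qed.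

Lemma wlenMs_up Q w s : S s -> sep (cnj w s) w = false ->
  wlen Q (w * s)%g = (wlen Q w + (cnj w s \in Q))%N.
Proof.
move=> Ss N; rewrite /wlen.
case: (boolP (cnj w s \in Q)) => [|/negP] ; rewrite inE => tQ.
  have -> : [set t | sep t (w * s)%g] `&` Q = cnj w s |` ([set t | sep t w] `&` Q).
    apply/seteqP; split=> t /=; rewrite sepMs//.
      by case: eqP => [->|_] /=; [left|right].
    case=> [->|[tw tQ']]; first by rewrite eqxx N.
    by rewrite tw; case: eqP => // E; rewrite E N in tw.
  rewrite fset_setU1; last exact: finite_sepQ.
  rewrite cardfsU1 in_fset_set; last exact: finite_sepQ.
  suff -> : (cnj w s \notin [set t | sep t w] `&` Q) = true by rewrite addnC.
  by apply/negP; rewrite inE /= N => -[].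
rewrite addn0; congr #|` fset_set _|; apply/seteqP; split=> t /=; rewrite sepMs//.
  by case: eqP => // -> [].
by move=> [tw tQ']; rewrite tw; case: eqP => // E; rewrite E in tQ'.
Qed.

Lemma cnjMs w s : cnj (w * s)%g s = cnj w s.
Proof. by rewrite cnjM cnj_id. Qed.

Lemma sepMsN w s : S s -> sep (cnj w s) (w * s)%g = ~~ sep (cnj w s) w.
Proof. by move=> Ss; rewrite sepMs// eqxx addTb. Qed.

Lemma wlenMs_down Q w s : S s -> sep (cnj w s) w ->
  wlen Q w = (wlen Q (w * s)%g + (cnj w s \in Q))%N.
Proof.
move=> Ss N; rewrite -{1}(simpleK w Ss) wlenMs_up//; first by rewrite cnjMs.
by rewrite cnjMs sepMsN// N.
Qed.

Lemma wlenMs Q w s : S s ->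
  (wlen Q (w * s)%g + (sep (cnj w s) w && (cnj w s \in Q)) =
   wlen Q w + (~~ sep (cnj w s) w && (cnj w s \in Q)))%N.
Proof.
move=> Ss; case: (boolP (sep (cnj w s) w)) => [N|/negbTE N] /=.
  by rewrite [in RHS](wlenMs_down Q Ss N); lia.
by rewrite wlenMs_up//; lia.
Qed.

Lemma lenMs_up w s : S s -> sep (cnj w s) w = false -> len (w * s)%g = (len w).+1.
Proof. by move=> Ss N; rewrite /len wlenMs_up// in_setT addn1. Qed.

Lemma lenMs_down w s : S s -> sep (cnj w s) w -> len w = (len (w * s)%g).+1.
Proof. by move=> Ss N; rewrite /len (wlenMs_down _ Ss N) in_setT addn1. Qed.

Lemma len_eq0 w : len w = 0%N -> nosep w.
Proof.
move=> /eqP; rewrite cardfs_eq0 => /eqP E t; apply/negbTE/negP => tw.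
by have /seteqP[/(_ t) H _] := fset_set_set0 (finite_sepQ _ _) E; apply: H.
Qed.

Lemma wlenV Q w : (forall g t, Q t -> Q (cnj g t)) -> wlen Q w^-1%g = wlen Q w.
Proof.
move=> Qc; rewrite /wlen.
have -> : [set t | sep t w] `&` Q = cnj w @` ([set t | sep t w^-1%g] `&` Q).
  apply/seteqP; split=> t /=.
    move=> [tw tQ]; exists (cnj w^-1%g t); last by rewrite cnjVK.
    by split; [rewrite sepV cnjVK|exact: Qc].
  by move=> [t' []]; rewrite sepV => ? ? <-; split=> //; exact: Qc.
rewrite fset_set_image; last exact: finite_sepQ.
by rewrite card_imfset//; exact: can_inj (cnjK w).
Qed.

Lemma wlenuM Q w u : (forall g t, Q t -> Q (cnj g t)) -> nosep u ->
  wlen Q (u * w)%g = wlen Q w.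
Proof.
by move=> Qc uO; rewrite -wlenV// invgM wlenMu ?wlenV//; exact: nosepV.
Qed.

Lemma lenV w : len w^-1%g = len w. Proof. exact: wlenV. Qed.

Lemma lenMu w u : nosep u -> len (w * u)%g = len w.
Proof. exact: wlenMu. Qed.

Lemma lenuM w u : nosep u -> len (u * w)%g = len w.
Proof. exact: wlenuM. Qed.

Lemma wlensM Q w s : (forall g t, Q t -> Q (cnj g t)) -> S s ->
  (wlen Q (s * w)%g + (sep s w && (s \in Q)) =
   wlen Q w + (~~ sep s w && (s \in Q)))%N.
Proof.
move=> Qc Ss; have := wlenMs Q w^-1%g Ss.
have -> : (w^-1 * s)%g = (s * w)^-1%g by rewrite invgM (simpleV Ss).
rewrite sepV cnjVK !wlenV//.
have -> // : (cnj w^-1%g s \in Q) = (s \in Q).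
by apply/idP/idP; rewrite !inE => /(Qc _); [move=> /(_ w); rewrite cnjVK|exact].
Qed.

Lemma len_simple s : S s -> len s = 1%N.
Proof.
move=> Ss; have := lenMs_up (w := 1%g) Ss (sep1 _).
by rewrite mul1g => ->; rewrite /len (nosep_wlen _ nosep1).
Qed.

Lemma lensM_up w s : S s -> sep s w = false -> len (s * w)%g = (len w).+1.
Proof.
move=> Ss N; rewrite -lenV invgM (simpleV Ss) lenMs_up ?lenV// sepV.
by rewrite cnjVK.
Qed.

Lemma lensM_down w s : S s -> sep s w -> len w = (len (s * w)%g).+1.
Proof.
move=> Ss N; rewrite -lenV (lenMs_down (s:=s))//; last by rewrite sepV cnjVK.
by rewrite -[in LHS]lenV invgM invgK simpleV.
Qed.

Lemma lensM_le w s : S s -> (len (s * w)%g <= (len w).+1)%N.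
Proof.
move=> Ss; case N: (sep s w); last by rewrite lensM_up.
by rewrite (lensM_down Ss N); lia.
Qed.

(** A nonempty set of separating reflections contains a simple one by [sep_wall], and cancelling it
    on the left shortens the element. This plays the role of generation by simple reflections and
    elements of length zero. *)
Lemma simple_ind (P : W -> Prop) :
  (forall u, nosep u -> P u) ->
  (forall s w, S s -> sep s w = false -> P w -> P (s * w)%g) -> forall w, P w.
Proof.
move=> Pu Ps w; move: {2}(len w) (erefl (len w)) => l; elim: l w => [|l IH] w lw.
  exact/Pu/len_eq0.
have [t tw] : exists t, sep t w.
  apply: contrapT => N; have : nosep w.
    by move=> t; apply/negbTE/negP => tw; apply: N; exists t.
  by move/(nosep_wlen setT); rewrite -/(len w) lw.
have [s Ss sw] := sep_wall ws tw.
have -> : w = (s * (s * w))%g by rewrite mulgA (simple_sq ws Ss) mul1g.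
apply: Ps => //; first by rewrite sepsM// cnj_id sw eqxx.
by apply: IH; apply: succn_inj; rewrite -(lensM_down Ss sw).
Qed.

Lemma simple_ind_r (P : W -> Prop) :
  (forall u, nosep u -> P u) ->
  (forall s w, S s -> sep (cnj w s) w = false -> P w -> P (w * s)%g) ->
  forall w, P w.
Proof.
move=> Pu Ps w; rewrite -[w]invgK; move: w^-1%g.
apply: (simple_ind (P := fun w => P w^-1%g)) => [u uO|{}s {}w Ss sw Pw].
  exact/Pu/nosepV.
by rewrite invgM (simpleV Ss); apply: Ps => //; rewrite sepV cnjVK.
Qed.

Lemma len_le1M g w : (len (g * w)%g <= len g + len w)%N.
Proof.
move: w; apply: (simple_ind (P := fun g => forall w, len (g * w)%g <= len g + len w)%N _ _ g).
  by move=> u uO w; rewrite lenuM// /len (nosep_wlen _ uO).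
move=> s {}g Ss sg IH w.
rewrite -mulgA (lensM_up Ss sg); apply: (leq_trans (lensM_le _ Ss)).
by rewrite addSn ltnS.
Qed.

(* Disjoint inversion sets make lengths additive. *)
Lemma len_disjoint g w : (forall t, sep t w -> sep t g^-1%g = false) ->
  len (g * w)%g = (len g + len w)%N.
Proof.
move=> dis.
have E : [set t | sep t (g * w)%g] =
   [set t | sep t g] `|` cnj g @` [set t | sep t w].
  apply/seteqP; split=> t /=.
    rewrite sepM; case: (boolP (sep t g)) => [|_]; first by left.
    rewrite addbF => tw; right; exists (cnj g^-1%g t) => //; exact: cnjVK.
  case=> [tg|[t' tw <-]].
    rewrite sepM tg addbT; apply/negP => tw.
    by have := dis _ tw; rewrite sepV cnjVK tg.
  by rewrite sepM cnjK tw -sepV dis.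
rewrite /len /wlen !setIT E fset_setU; [|exact: (sep_finite ws)|exact/finite_image/(sep_finite ws)].
rewrite cardfsU fset_set_image; last exact: (sep_finite ws).
rewrite [X in (_ + X - _)%N]card_imfset/=; last exact: can_inj (cnjK g).
suff -> : (fset_set [set t | sep t g] `&` [fset cnj g x | x in fset_set [set t | sep t w]])%fset = fset0.
  by rewrite cardfs0 subn0.
apply/fsetP => t; rewrite !inE; apply/negP => /andP[].
rewrite in_fset_set; last exact: (sep_finite ws).
rewrite inE /= => tg /imfsetP[t' /=]; rewrite in_fset_set; last exact: (sep_finite ws).
by rewrite inE /= => t'w E'; have := dis _ t'w; rewrite sepV -E' tg.
Qed.

End WallSystemTheory.

(** * Finitely supported sums *)

Section FiniteSums.
Variable I : choiceType.

Definition fsupp (M : nmodType) (f : I -> M) : Prop := finite_set [set i | f i != 0].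

Lemma fsupp_sub (M : nmodType) (f : I -> M) (A : set I) :
  finite_set A -> (forall i, f i != 0 -> A i) -> fsupp f.
Proof. by move=> finA fA; apply: sub_finite_set finA => i /fA. Qed.

Lemma fsuppD (M : nmodType) (f g : I -> M) : fsupp f -> fsupp g ->
  fsupp (fun i => f i + g i).
Proof.
move=> ff fg; apply: (@fsupp_sub _ _ ([set i | f i != 0] `|` [set i | g i != 0])).
  by rewrite finite_setU.
move=> i /=; case: (eqVneq (f i) 0) => [->|]; last by left.
by rewrite add0r; right.
Qed.

Lemma fsuppZ (R : pzRingType) (M : lmodType R) (c : I -> R) (G : I -> M) :
  fsupp c -> fsupp (fun i => c i *: G i).
Proof.
move=> fc; apply: fsupp_sub fc _ => i /=; case: (eqVneq (c i) 0) => // ->.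
by rewrite scale0r eqxx.
Qed.

Lemma fsumD (M : nmodType) (f g : I -> M) : fsupp f -> fsupp g ->
  \sum_(i \in [set: I]) (f i + g i) =
  \sum_(i \in [set: I]) f i + \sum_(i \in [set: I]) g i.
Proof.
move=> ff fg; pose A := fset_set ([set i | f i != 0] `|` [set i | g i != 0]).
have inA i : i \notin A -> f i = 0 /\ g i = 0.
  rewrite in_fset_set ?finite_setU// => /negP; rewrite inE /= => /not_orP[].
  by move=> /negP/negPn/eqP -> /negP/negPn/eqP ->.
rewrite !(fsbigTE A) ?big_split//= => i /inA[fi gi] //.
by rewrite fi gi addr0.
Qed.

Lemma fsum_raddf (M N : nmodType) (phi : {additive M -> N}) (f : I -> M) :
  fsupp f ->
  phi (\sum_(i \in [set: I]) f i) = \sum_(i \in [set: I]) phi (f i).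
Proof.
move=> ff; pose A := fset_set [set i | f i != 0].
have inA i : i \notin A -> f i = 0.
  by rewrite in_fset_set// => /negP; rewrite inE /= => /negP/negPn/eqP.
rewrite !(fsbigTE A) ?raddf_sum//= => i /inA fi //.
by rewrite fi raddf0.
Qed.

Lemma fsumZ (R : pzRingType) (M : lmodType R) (f : I -> M) (k : R) : fsupp f ->
  k *: (\sum_(i \in [set: I]) f i) = \sum_(i \in [set: I]) k *: f i.
Proof. exact: (fsum_raddf (GRing.scale k : {additive M -> M})). Qed.

Lemma fsumMl (A : pzRingType) (f : I -> A) (h : A) : fsupp f ->
  h * (\sum_(i \in [set: I]) f i) = \sum_(i \in [set: I]) h * f i.
Proof. exact: (fsum_raddf (GRing.mull_fun h idfun)). Qed.

Lemma fsumMr (A : pzRingType) (f : I -> A) (h : A) : fsupp f ->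
  (\sum_(i \in [set: I]) f i) * h = \sum_(i \in [set: I]) f i * h.
Proof. exact: (fsum_raddf (GRing.mulr_fun h idfun)). Qed.

Lemma fsum_pick (M : nmodType) (j : I) (x : M) :
  \sum_(i \in [set: I]) (if i == j then x else 0) = x.
Proof.
rewrite (fsbigTE [fset j]%fset) ?big_seq_fset1 ?eqxx// => i.
by rewrite inE => /negbTE ->.
Qed.

Lemma eq_fsum (M : nmodType) (f g : I -> M) : f =1 g ->
  \sum_(i \in [set: I]) f i = \sum_(i \in [set: I]) g i.
Proof. by move=> E; apply: eq_fsbigr => i _. Qed.

Lemma fsum_mkcond (M : nmodType) (P : set I) (f : I -> M) :
  \sum_(i \in P) f i = \sum_(i \in [set: I]) (if i \in P then f i else 0).
Proof. by rewrite fsbig_mkcond; apply: eq_fsum => i; rewrite /patch. Qed.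

End FiniteSums.

(** Both projections of the support are finite, so all the sums can be cut down to a finite
    rectangle, where they may be interchanged. *)
Lemma fsum_pair (I J : choiceType) (M : nmodType) (g : I * J -> M) : fsupp g ->
  \sum_(p \in [set: I * J]) g p =
  \sum_(x \in [set: I]) \sum_(y \in [set: J]) g (x, y).
Proof.
move=> fg; pose A := fst @` [set p | g p != 0]; pose B := snd @` [set p | g p != 0].
have fA : finite_set A by exact: finite_image.
have fB : finite_set B by exact: finite_image.
rewrite -(fsbig_widen (A `*` B) setT) => [|//|[x y] [_ /= N]]; last first.
  apply: contrapT => /eqP gN; apply: N; split; [exists (x, y)|exists (x, y)] => //.
transitivity (\sum_(x \in A) \sum_(y \in B) g (x, y)).
  rewrite [RHS](pair_fsbig _ (fun x y => g (x, y)))//.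
  by apply: eq_fsbigr => -[].
rewrite (fsbig_widen A setT) => [|//|x [_ /= N]]; last first.
  apply: fsbig1 => y _; apply: contrapT => /eqP gN; apply: N.
  by exists (x, y).
apply: eq_fsbigr => x _; apply: fsbig_widen => // y [_ /= N].
by apply: contrapT => /eqP gN; apply: N; exists (x, y).
Qed.

(** * Monomials in the elements of a commutative ring *)

Section Monomials.
Variable R : comNzRingType.

(** The ring elements themselves serve as variables. Conjugacy classes of reflections with equal
    parameter are thereby merged, which leaves the product of the parameters unchanged. *)
Definition mon (f : R -> nat) : R := \big[*%R/1]_(r \in [set: R]) r ^+ f r.

Lemma mon0 (f : R -> nat) : (forall r, f r = 0%N) -> mon f = 1.
Proof. by move=> f0; apply: fsbig1 => r _; rewrite f0. Qed.

Lemma eq_mon f g : f =1 g -> mon f = mon g.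
Proof. by move=> E; apply: eq_fsbigr => r _; rewrite E. Qed.

Lemma monD (f : R -> nat) (r0 : R) (i : nat) :
  finite_set [set r | f r != 0%N] ->
  mon (fun r => f r + i * (r0 == r))%N = mon f * r0 ^+ i.
Proof.
move=> ff; pose A := fset_set (r0 |` [set r | f r != 0%N]).
have inA r : r \notin A -> r0 != r /\ f r = 0%N.
  rewrite in_fset_set ?finite_setU; last by split.
  move=> /negP; rewrite inE /= => /not_orP[] /eqP + /negP/negPn/eqP ->.
  by rewrite eq_sym.
have rA : r0 \in A.
  by rewrite in_fset_set ?finite_setU ?inE; [left|split].
rewrite /mon !(fsbigTE A); last 2 first.
- by move=> r /inA[_ ->].
- by move=> r /inA[/negbTE -> ->]; rewrite muln0.
rewrite (bigD1_seq r0) ?fset_uniq//= [in RHS](bigD1_seq r0) ?fset_uniq//=.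
rewrite eqxx muln1 exprD.
rewrite mulrAC; congr (_ * _); congr (_ * _); apply: eq_bigr => r rN.
by rewrite eq_sym (negbTE rN) muln0 addn0.
Qed.

End Monomials.

(** * Generic Hecke algebras and the flip formula *)

Section Weights.
Variables (W : groupType) (S : set W) (sep : W -> W -> bool).
Hypothesis ws : wall_system S sep.
Variables (R : comNzRingType) (a : W -> R).
Hypothesis a_conj : forall s t w, S s -> S t -> (s * w = w * t)%g -> a s = a t.

Lemma sep_conj_simple t w : sep t w -> exists g s, S s /\ t = cnj g s.
Proof.
move: w; apply: (simple_ind_r ws) => [u uO|s w Ss sw IH]; first by rewrite uO.
rewrite (sepMs ws)//; case: eqP => [->|_]; last by rewrite addFb.
by move=> _; exists w, s.
Qed.

Lemma sep_sq t w : sep t w -> (t * t)%g = 1%g.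
Proof.
move=> /sep_conj_simple[g [s [Ss ->]]].
by rewrite -cnjMM (simple_sq ws Ss) cnjg1.
Qed.

(** The parameter of a simple reflection, extended to its conjugates; [a_conj] makes it independent
    of the conjugate chosen. *)
Definition refl_weight (t : W) : R :=
  xget 0 [set r | exists g s, [/\ S s, t = cnj g s & r = a s]].

Lemma refl_weight_simple s : S s -> refl_weight s = a s.
Proof.
move=> Ss; rewrite /refl_weight; case: xgetP => [r _ /= [g [s' [Ss' E ->]]]|N].
  by apply/esym/(a_conj (w := g)) => //; rewrite E cnj_mulr.
by exfalso; apply: (N (a s)); exists 1%g, s; rewrite cnj1.
Qed.

Lemma refl_weight_conj g t : refl_weight (cnj g t) = refl_weight t.
Proof.
rewrite /refl_weight; congr xget; apply/seteqP; split=> r /= [h [s [Ss E ->]]].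
  by exists (g^-1 * h)%g, s; split=> //; rewrite cnjM -E cnjK.
by exists (g * h)%g, s; split=> //; rewrite cnjM E.
Qed.

Definition weight_class (r : R) : set W := [set t | refl_weight t = r].

Lemma weight_class_conj r g t : weight_class r t -> weight_class r (cnj g t).
Proof. by rewrite /weight_class /= refl_weight_conj. Qed.

Definition rlen (r : R) (w : W) : nat := wlen sep (weight_class r) w.

Lemma in_weight_class r g s : S s -> (cnj g s \in weight_class r) = (a s == r).
Proof.
move=> Ss; apply/idP/eqP; rewrite inE /weight_class /= refl_weight_conj refl_weight_simple//.
Qed.

Lemma rlenMs r w s : S s ->
  (rlen r (w * s)%g + sep (cnj w s) w * (a s == r) =
   rlen r w + ~~ sep (cnj w s) w * (a s == r))%N.
Proof. by move=> Ss; have := wlenMs ws (weight_class r) w Ss; rewrite in_weight_class// !mulnb. Qed.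

(** For separating [t], [rlen_fold] keeps the truncated subtraction exact. A step from [w] to [w s]
    changes both counts by the same amount up to sign, hence their difference by 0 or 2 for the
    affected weight, so that halving follows each step exactly. *)
Definition defect (w t : W) (r : R) : nat :=
  ((rlen r w - (refl_weight t == r) - rlen r (t * w)%g)./2)%N.

(* The monomial in the [a_s] collected by folding a reduced gallery from [C0]
   to [w C0] at the hyperplane of [t] and reducing the folded gallery. *)
Definition fold_weight (w t : W) : R := mon (defect w t).

(** Folding a reduced gallery at the hyperplane of [t] removes this one crossing and preserves the
    weights of the others, and the folded gallery still has to cross everything that separates its
    ends. *)
Lemma rlen_fold r w t : sep t w ->
  (rlen r (t * w)%g + (refl_weight t == r) <= rlen r w)%N.
Proof.
move: w; apply: (simple_ind_r ws) => [u uO|s w Ss sw IH]; first by rewrite uO.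
rewrite (sepMs ws)//; case: eqP => [->|tN] /=.
  move=> _; rewrite mulgA cnj_mulr (simpleK ws _ Ss) refl_weight_conj refl_weight_simple//.
  by have := rlenMs r w Ss; rewrite sw; lia.
move=> tw; have := IH tw; have := rlenMs r w Ss; have := rlenMs r (t * w) Ss.
rewrite sw mulgA.
move: (rlen r (t * w * s)%g) (rlen r (t * w)%g) (rlen r (w * s)%g) (rlen r w).
by move=> A B C D; case: (sep _ (t * w)%g); case: (_ == r); case: (_ == r) => /=; lia.
Qed.

Lemma defect_finite w t : finite_set [set r | defect w t r != 0%N].
Proof.
apply: (@sub_finite_set _ _ (refl_weight @` [set t | sep t w])); last first.
  exact/finite_image/(sep_finite ws).
move=> r /= d0; have : (0 < rlen r w)%N.
  by move: d0; rewrite /defect; case: (rlen r w).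
rewrite cardfs_gt0 => /fset0Pn[t']; rewrite in_fset_set; last exact: finite_sepQ ws _ _.
by rewrite inE /= => -[? ?]; exists t'.
Qed.

Lemma fold_weight_simple w s : S s -> sep (cnj w s) w = false ->
  fold_weight (w * s)%g (cnj w s) = 1.
Proof.
move=> Ss sw; apply: mon0 => r; rewrite /defect mulgA cnj_mulr (simpleK ws _ Ss).
have := rlenMs r w Ss; rewrite sw refl_weight_conj refl_weight_simple//=.
by case: (_ == r) => /=; lia.
Qed.

(** The powers of [a s] record whether the new step is a return in the folded gallery (left) or in
    the original one (right). This balance makes the coefficients of the flip formula compatible
    with [berns]. *)
Lemma fold_weightMs w s t : S s -> sep t w -> t != cnj w s ->
  fold_weight w t * a s ^+ sep (cnj t (cnj w s)) (t * w)%g =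
  a s ^+ sep (cnj w s) w * fold_weight (w * s)%g t.
Proof.
move=> Ss tw tN; rewrite mulrC [RHS]mulrC [LHS]mulrC /fold_weight.
rewrite -!monD; try exact: defect_finite; apply: eq_mon => r.
have tws : sep t (w * s)%g by rewrite (sepMs ws)// (negbTE tN).
have := rlen_fold r tw; have := rlen_fold r tws.
have := rlenMs r w Ss; have := rlenMs r (t * w)%g Ss; rewrite /defect mulgA cnjM.
move: (rlen r (t * w * s)%g) (rlen r (t * w)%g) (rlen r (w * s)%g) (rlen r w).
move=> A B C D; case: (sep _ _); case: (sep _ _); case: (a s == r); case: (refl_weight t == r) => /=; lia.
Qed.

Lemma fold_weightMu w u t : nosep sep u -> fold_weight (w * u)%g t = fold_weight w t.
Proof.
by move=> uO; apply: eq_mon => r; rewrite /defect mulgA /rlen !(wlenMu ws _ _ uO).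
Qed.

End Weights.

Record hecke_datum (W : groupType) (S : set W) (sep : W -> W -> bool)
    (W1 : groupType) (pi : W1 -> W) (nl : W -> W1) (R : comNzRingType)
    (HA : algType R) (T : W1 -> HA) (a : W -> R) (b : W -> W1 -> R) : Prop :=
  HeckeDatum {
  hd_ws : wall_system S sep;
  piM : forall x y, pi (x * y)%g = (pi x * pi y)%g;
  pi_surj : forall w, exists w1, pi w1 = w;
  pi_nl : forall s, S s -> pi (nl s) = s;
  b_finite : forall s, S s -> finite_set [set t | b s t != 0];
  b_ker : forall s t, S s -> b s t != 0 -> pi t = 1%g;
  a_conj : forall s t w, S s -> S t -> (s * w = w * t)%g -> a s = a t;
  b_conj : forall s t w, S s -> S t -> (s * pi w = pi w * t)%g -> forall x,
    b t (w^-1 * ((nl s * w * (nl t)^-1 * w^-1)^-1 * x) * w)%g = b s x;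
  T_span : forall h, exists c, fsupp c /\ h = \sum_(w \in [set: W1]) c w *: T w;
  T_free : forall c, fsupp c -> \sum_(w \in [set: W1]) c w *: T w = 0 ->
    forall w, c w = 0;
  TM : forall w w', len sep (pi (w * w')%g) = (len sep (pi w) + len sep (pi w'))%N ->
    T (w * w')%g = T w * T w';
  T_sq : forall s, S s -> T (nl s) ^+ 2 = a s *: T (nl s * nl s)%g +
    T (nl s) * \sum_(t \in [set t | pi t = 1%g]) b s t *: T t }.

Section HeckeTheory.
Variables (W : groupType) (S : set W) (sep : W -> W -> bool).
Variables (W1 : groupType) (pi : W1 -> W) (nl : W -> W1) (R : comNzRingType).
Variables (HA : algType R) (T : W1 -> HA) (a : W -> R) (b : W -> W1 -> R).
Hypothesis hd : hecke_datum S sep pi nl T a b.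
Let ws := hd_ws hd.
Local Notation nosep := (nosep sep).
Local Notation len := (len sep).
Local Notation fold_weight := (fold_weight S sep a).
Implicit Types (e : W -> bool) (F : W1 -> HA).

Lemma pi1 : pi 1%g = 1%g.
Proof. by apply: (@mulgI _ (pi 1%g)); rewrite -(piM hd) !mulg1. Qed.

Lemma piV x : pi x^-1%g = (pi x)^-1%g.
Proof. by apply: (@mulgI _ (pi x)); rewrite -(piM hd) !mulgV pi1. Qed.

Lemma piJ g x : pi (cnj g x) = cnj (pi g) (pi x).
Proof. by rewrite /cnj !(piM hd) piV. Qed.

Lemma pi_Mnl w s : S s -> pi (w * nl s)%g = (pi w * s)%g.
Proof. by move=> Ss; rewrite (piM hd) (pi_nl hd). Qed.

(** Having length zero, [T 1] is a left identity on the spanning family, hence on the unit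
    itself. *)
Lemma T1 : T 1%g = 1.
Proof.
have H w : T 1%g * T w = T w.
  by rewrite -(TM hd) ?mul1g// pi1 /len (nosep_wlen _ (nosep1 ws)).
have [c [fc E]] := T_span hd 1.
rewrite -[LHS]mulr1 {1}E fsumMl; last exact: fsuppZ.
by rewrite [RHS]E; apply: eq_fsum => w; rewrite -scalerAr H.
Qed.

Lemma TMu w u : nosep (pi u) -> T (w * u)%g = T w * T u.
Proof. by move=> uO; apply: (TM hd); rewrite (piM hd) (lenMu ws)// /len (nosep_wlen _ uO) addn0. Qed.

Lemma TuM w u : nosep (pi u) -> T (u * w)%g = T u * T w.
Proof. by move=> uO; apply: (TM hd); rewrite (piM hd) (lenuM ws)// /len (nosep_wlen _ uO). Qed.

Lemma nosep_ker t : pi t = 1%g -> nosep (pi t).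
Proof. by move=> ->; exact: nosep1 ws. Qed.

Lemma TMs w s : S s -> sep (cnj (pi w) s) (pi w) = false ->
  T (w * nl s)%g = T w * T (nl s).
Proof.
move=> Ss sw; apply: (TM hd).
by rewrite pi_Mnl// (pi_nl hd Ss) (lenMs_up ws Ss sw) (len_simple ws Ss) addn1.
Qed.

Lemma TsM w s : S s -> sep s (pi w) = false ->
  T (nl s * w)%g = T (nl s) * T w.
Proof.
move=> Ss sw; apply: (TM hd).
by rewrite (piM hd) (pi_nl hd Ss) (lensM_up ws Ss sw) (len_simple ws Ss).
Qed.

(* [beta] collects the coefficients [b_s], transported by conjugation, into a
   single conjugation invariant function on the lifts of all reflections. *)
Definition beta (y : W1) : R :=
  xget 0 [set r | exists g s, [/\ S s, pi (cnj g y) = s & r = b s (nl s * cnj g y)%g]].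

Lemma beta_conj g y : beta (cnj g y) = beta y.
Proof.
rewrite /beta; congr xget; apply/seteqP; split=> r /= [h [s [Ss E ->]]].
  by exists (h * g)%g, s; rewrite cnjM.
by exists (h * g^-1)%g, s; rewrite cnjM cnjK.
Qed.

(** [beta] is well defined: two conjugates of [y] that lie over simple reflections give the same
    value, by [b_conj] applied to the conjugating element. *)
Lemma b_beta y s : S s -> pi y = s -> b s (nl s * y)%g = beta y.
Proof.
move=> Ss ys; rewrite /beta; case: xgetP => [r _ /= [g [s' [Ss' E ->]]]|N]; last first.
  by exfalso; apply: (N (b s (nl s * y)%g)); exists 1%g, s; rewrite cnj1.
rewrite -(b_conj hd (s := s') (t := s) (w := g))//.
  by congr (b _ _); rewrite /cnj !invgM !invgK -!mulgA !mulKg mulVg mulg1.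
by rewrite -E piJ ys cnj_mulr.
Qed.

Lemma b_beta_r y s : S s -> pi y = s -> b s (y * nl s)%g = beta y.
Proof.
move=> Ss ys; rewrite -(beta_conj (nl s)^-1%g) -(b_beta (s := s))//; last first.
  by rewrite piJ piV (pi_nl hd)// ys /cnj invgK mulVg mul1g.
by rewrite /cnj invgK !mulgA mulgV mul1g.
Qed.

Definition betaf (t : W) (y : W1) : R := if pi y == t then beta y else 0.

Lemma betaf_fsupp t : fsupp (betaf t).
Proof.
have [[g [s [Ss st]]]|N] := pselect (exists g s, S s /\ t = cnj (pi g) s).
  apply: (@fsupp_sub _ _ _ ((fun x => cnj g ((nl s)^-1 * x)%g) @` [set x | b s x != 0])).
    exact/finite_image/(b_finite hd).
  move=> y /=; rewrite /betaf; case: (pi y =P t); last by rewrite eqxx.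
  move=> E yN; exists (nl s * cnj g^-1%g y)%g; last by rewrite mulKg cnjVK.
  rewrite b_beta//; first by rewrite beta_conj.
  by rewrite piJ E st piV cnjK.
(* Over an element that is not conjugate to a simple reflection, [beta] takes its default value
   0. *)
apply: (@fsupp_sub _ _ _ set0) => // y; rewrite /betaf.
case: (pi y =P t) => [E|]; last by rewrite eqxx.
rewrite /beta; case: xgetP => [r _ /= [g [s [Ss E' ->]]]|]; last by rewrite eqxx.
by move=> _; apply: N; exists g^-1%g, s; split=> //; rewrite -E' -E piJ piV cnjK.
Qed.

Definition Bel (s : W) : HA := \sum_(t \in [set t | pi t = 1%g]) b s t *: T t.

Lemma Bel_sum s : S s ->
  Bel s = \sum_(y \in [set: W1]) betaf s y *: T (y * nl s)%g.
Proof.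
move=> Ss; rewrite /Bel fsum_mkcond.
rewrite (reindex_fsbigT (fun y => (y * nl s)%g)); last first.
  by exists (fun y => (y * (nl s)^-1)%g) => y; rewrite ?mulgK ?mulgVK.
apply: eq_fsum => y; rewrite /betaf.
have -> : (y * nl s)%g \in [set t | pi t = 1%g] = (pi y == s).
  apply/idP/eqP; rewrite inE /= pi_Mnl//.
    by move=> E; rewrite -[LHS](simpleK ws _ Ss) E mul1g.
  by move=> ->; rewrite (simple_sq ws).
by case: eqP => [E|]; rewrite ?scale0r// b_beta_r.
Qed.

Lemma Bel_ker s : S s -> Bel s = \sum_(t \in [set: W1]) b s t *: T t.
Proof.
move=> Ss; rewrite /Bel fsum_mkcond; apply: eq_fsum => t.
case: ifPn => // /negP; rewrite inE /= => tN.
have [->|/(b_ker hd Ss)//] := eqVneq (b s t) 0.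
by rewrite scale0r.
Qed.

(** If the hyperplane already separates C_0 from wC_0, the crossing from wC_0 to wsC_0 returns to
    the side of C_0, and its sign is opposite to the one recorded by [e]. *)
Definition osign e (w s : W) : bool := e (cnj w s) (+) sep (cnj w s) w.

Definition bern_letter e (w s : W) : HA :=
  if osign e w s then T (nl s) else T (nl s) - Bel s.

(* [F] is an integral Bernstein map for the orientation which gives the sign
   [e t] to the crossing of the hyperplane of [t] leaving the side of [C0]. *)
Record bernstein e F : Prop := Bernstein {
  bern1 : F 1%g = 1;
  bernu : forall w u, nosep (pi u) -> F (w * u)%g = F w * T u;
  berns : forall w s, S s -> F w * bern_letter e (pi w) s =
    a s ^+ sep (cnj (pi w) s) (pi w) *: F (w * nl s)%g }.

Lemma bernstein_base : bernstein (fun=> true) T.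
Proof.
split=> [|w u uO|w s Ss]; first exact: T1.
  exact: TMu.
rewrite /bern_letter /osign addTb; case: (boolP (sep _ _)) => [sw|/negbTE sw] /=; last first.
  by rewrite -TMs// expr0 scale1r.
have ss : nosep (pi (nl s * nl s)%g).
  by rewrite pi_Mnl// (pi_nl hd)// (simple_sq ws)//; exact: nosep1 ws.
(* For a returning crossing, split the last letter off [w]; the quadratic relation then reads T_s
   (T_s - B_s) = a_s T_{s^2}. *)
rewrite -{1}[w](mulgVK (nl s)) TMs//; last first.
  rewrite (piM hd) piV (pi_nl hd)// (simpleV ws Ss) cnjMs.
  by rewrite (sepMsN ws) ?sw.
rewrite -mulrA mulrBr -expr2 (T_sq hd)// addrK -scalerAr -TMu//.
by rewrite !mulgA mulgVK expr1.
Qed.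

(** The orientation pulled back along [g]: a crossing gets the sign of its image under [g]. The
    second term corrects for the image being seen from gC_0 rather than C_0. *)
Definition sep_twist e (g t : W) : bool := e (cnj g t) (+) sep (cnj g t) g.

Lemma osign_twist e g w s : osign (sep_twist e g) w s = osign e (g * w)%g s.
Proof. by rewrite /osign /sep_twist cnjM (sepJ ws) -addbA [X in _ (+) X]addbC. Qed.

Lemma letter_twist e g w s : bern_letter (sep_twist e g) w s = bern_letter e (g * w)%g s.
Proof. by rewrite /bern_letter osign_twist. Qed.

Lemma eq_letter e e' w s : e =1 e' -> bern_letter e w s = bern_letter e' w s.
Proof. by move=> E; rewrite /bern_letter /osign E. Qed.

Definition sg (c : bool) : R := if c then 1 else -1.

Lemma sgN c : sg (~~ c) = - sg c.
Proof. by case: c; rewrite /= ?opprK. Qed.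

(** * Passage between two orientations exchanged by reflections *)

Section Flip.
Variables (e e' : W -> bool) (P : pred W) (F : W1 -> HA).
Hypotheses (eP : forall t, P t -> e t = ~~ e' t)
  (eNP : forall t, ~~ P t -> e t = e' t)
  (eT : forall t, P t -> sep_twist e t =1 e')
  (bF : bernstein e' F).

Definition flip_coef (w y : W1) : R :=
  if P (pi y) && sep (pi y) (pi w)
  then sg (e (pi y)) * fold_weight (pi w) (pi y) * beta y else 0.

Definition flip (w : W1) : HA :=
  F w + \sum_(y \in [set: W1]) flip_coef w y *: F (y * w)%g.

Lemma flip_coef_fsupp w : fsupp (flip_coef w).
Proof.
apply: (@fsupp_sub _ _ _ (\bigcup_(t in [set t | sep t (pi w)]) [set y | betaf t y != 0])).
  by apply: bigcup_finite; [exact: (sep_finite ws)|move=> t _; exact: betaf_fsupp].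
move=> y; rewrite /flip_coef; case: ifP => [/andP[_ yw]|_]; last by rewrite eqxx.
move=> yN; exists (pi y) => //=; rewrite /betaf eqxx.
by move: yN; apply: contra => /eqP ->; rewrite mulr0.
Qed.

Lemma letter_flip w s : S s -> bern_letter e w s =
  bern_letter e' w s + (if P (cnj w s) then sg (osign e w s) else 0) *: Bel s.
Proof.
move=> Ss; rewrite /bern_letter /osign; case: (boolP (P (cnj w s))) => [Pt|nPt]; last first.
  rewrite (eNP nPt).
  by rewrite scale0r addr0.
rewrite (eP Pt) addNb; case: (_ (+) _) => /=; rewrite ?scaleN1r ?scale1r//.
by rewrite subrK.
Qed.

Lemma mulF_Bel w s : S s -> F w * Bel s =
  \sum_(y \in [set: W1]) betaf (cnj (pi w) s) y *: F (y * w * nl s)%g.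
Proof.
move=> Ss; rewrite Bel_sum// fsumMl; last exact/fsuppZ/betaf_fsupp.
rewrite [RHS](reindex_fsbigT (cnj w)); last first.
  by exists (cnj w^-1%g); [exact: cnjK|exact: cnjVK].
apply: eq_fsum => y; rewrite -scalerAr /betaf piJ (can_eq (cnjK _)) beta_conj.
case: eqP => [E|_]; last by rewrite !scale0r.
rewrite -(bernu bF) ?cnj_mulr ?mulgA//.
by apply: nosep_ker; rewrite pi_Mnl// E (simple_sq ws).
Qed.

(** The content lies in the crossing relation, checked coefficient by coefficient on the terms F(y w
    n_s). If [y] does not lie over t = w s w^-1, the letters agree by [eT] and the weights by
    [fold_weightMs]. If it does, the term interacts with the B_s by which the two letters at [w]
    differ. *)
Lemma flip_bernstein : bernstein e flip.
Proof.
split=> [|w u uO|w s Ss].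
- rewrite /flip (bern1 bF) fsbig1 ?addr0// => y _.
  by rewrite /flip_coef pi1 (sep1 ws) andbF scale0r.
- rewrite /flip (bernu bF)// mulrDl fsumMr; last exact/fsuppZ/flip_coef_fsupp.
  congr (_ + _); apply: eq_fsum => y; rewrite mulgA (bernu bF)// scalerAl.
  by rewrite /flip_coef (piM hd) (sepMu ws)// (fold_weightMu ws).
set t := cnj (pi w) s; set L := bern_letter _ _ _.
have fin1 : fsupp (fun y => (flip_coef w y *: F (y * w)%g) * L).
  apply: (@fsupp_sub _ _ _ [set y | flip_coef w y != 0]); first exact: flip_coef_fsupp.
  by move=> y; apply: contra => /eqP ->; rewrite scale0r mul0r.
pose sb : R := if P t then sg (osign e (pi w) s) else 0.
have fin2 : fsupp (fun y => sb *: (betaf t y *: F (y * w * nl s)%g)).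
  apply: (@fsupp_sub _ _ _ [set y | betaf t y != 0]); first exact: betaf_fsupp.
  by move=> y; apply: contra => /eqP ->; rewrite scale0r scaler0.
rewrite /flip mulrDl {1}/L letter_flip// mulrDr (berns bF)// -scalerAr mulF_Bel//.
rewrite -/t fsumZ; last exact/fsuppZ/betaf_fsupp.
rewrite scalerDr -!addrA; congr (_ + _); rewrite fsumMr; last exact/fsuppZ/flip_coef_fsupp.
rewrite -fsumD//; rewrite fsumZ; last exact/fsuppZ/flip_coef_fsupp.
apply: eq_fsum => y; rewrite !mulgA addrC -/sb.
rewrite /flip_coef pi_Mnl// (sepMs ws)// -/t /betaf.
(* The letter of [e] at [w] is the letter of [e'] at [y w], because [e'] is [e] twisted by the
   involution [pi y]. *)
have Ly : P (pi y) -> sep (pi y) (pi w) ->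
  F (y * w)%g * L = a s ^+ sep (cnj (pi y) t) (pi y * pi w)%g *: F (y * w * nl s)%g.
  move=> Py yw; rewrite /t -cnjM -(piM hd) -(berns bF)//; congr (_ * _).
  rewrite -(eq_letter _ _ (eT Py)) letter_twist (piM hd) mulgA.
  by rewrite (sep_sq ws yw) mul1g.
have [yt|yt] := eqVneq (pi y) t.
  rewrite yt in Ly *; rewrite addTb /sb /osign -/t cnj_id in Ly *.
  case: (boolP (P t)) Ly => [Pt|nPt] Ly /=; last first.
    by rewrite !scale0r mul0r scaler0 addr0.
  have fw := fold_weight_simple ws (a_conj hd) Ss.
  case: (boolP (sep t (pi w))) Ly => [tw|/negbTE tw] Ly /=.
    (* The wall of [t] is crossed back, so [y] has coefficient 0 at [w n_s]. The old correction term
       and the new one from B_s cancel, since a return has the opposite sign. *)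
    have tw' : sep t (pi w * s)%g = false by rewrite (sepMsN ws)// tw.
    have := fw (pi w * s)%g; rewrite cnjMs (simpleK ws _ Ss) -/t => -> //.
    rewrite -scalerAl Ly// {2}/t cnj_mulr tw' expr0 scale1r.
    by rewrite mulr1 scale0r scaler0 addbT sgN scaleNr scalerA subrr.
  (* The wall of [t] is crossed for the first time: B_s creates the correction term, with fold
     weight 1. *)
  rewrite scale0r mul0r add0r expr0 scale1r addbF.
  by rewrite fw// mulr1 scalerA.
rewrite scale0r scaler0 addr0 addFb.
case: (boolP (P (pi y) && _)) => [/andP[Py yw]|_]; last by rewrite !scale0r mul0r scaler0.
rewrite -scalerAl Ly// !scalerA; congr (_ *: _).
have := fold_weightMs ws (a_conj hd) Ss yw yt; rewrite -/t => E.
by rewrite mulrAC -(mulrA _ (fold_weight (pi w) (pi y))) E mulrCA !mulrA.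
Qed.

End Flip.

End HeckeTheory.

(** * Class sums are central *)

Inductive chain (D : Type) (adj : D -> D -> Prop) (d : D) : D -> Prop :=
| chain_refl : chain adj d d
| chain_step d' d'' : adj d d' -> chain adj d' d'' -> chain adj d d''.

(* Two orientations that differ exactly on the reflections in [P], each of
   which exchanges them. *)
Definition adjacent (W : groupType) (sep : W -> W -> bool) (e e' : W -> bool) : Prop :=
  exists P : pred W, [/\ forall t, P t -> e t = ~~ e' t,
    forall t, ~~ P t -> e t = e' t & forall t, P t -> sep_twist sep e t =1 e'].

(** On finitely many hyperplanes, [e] looks like the orientation whose positive crossings lead away
    from some chamber vC_0. *)
Definition approximable (W : groupType) (sep : W -> W -> bool) (e : W -> bool) :=
  forall A : set W, finite_set A -> (forall t, A t -> exists w, sep t w) ->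
  exists v, forall t, A t -> e t = ~~ sep t v.

(* [X] is the group of translations, [D] the set of spherical orientations. *)
Record spherical_datum (W : groupType) (S : set W) (sep : W -> W -> bool)
    (X : set W) (D : Type) (eD : D -> W -> bool) : Prop := SphericalDatum {
  X_conj : forall g x, X x -> X (cnj g x);
  X_refl : forall t x, X x -> sep t (cnj t x^-1%g) = sep t x;
  X_simple : forall s x, S s -> X x -> cnj x s != s ->
    sep s x (+) sep s x^-1%g;
  X_deep : forall w, ~ X w -> exists x, [/\ X x,
    forall m t, sep t w -> sep t (x^-1 ^+ m)%g = false &
    forall m m', cnj (x ^+ m)%g w = cnj (x ^+ m')%g w -> m = m'];
  eD_X : forall d x, X x -> sep_twist sep (eD d) x =1 eD d;
  eD_twist : forall d w, exists d', eD d' =1 sep_twist sep (eD d) w;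
  eD_approx : forall d, approximable sep (eD d);
  eD_chain : forall d d', chain (fun d d' => adjacent sep (eD d) (eD d')) d d' }.

Section HeckeCenter.
Variables (W : groupType) (S : set W) (sep : W -> W -> bool).
Variables (W1 : groupType) (pi : W1 -> W) (nl : W -> W1) (R : comNzRingType).
Variables (HA : algType R) (T : W1 -> HA) (a : W -> R) (b : W -> W1 -> R).
Hypothesis hd : hecke_datum S sep pi nl T a b.
Let ws := hd_ws hd.
Local Notation nosep := (nosep sep).
Local Notation len := (len sep).
Local Notation fold_weight := (fold_weight S sep a).
Local Notation bernstein := (bernstein S sep pi nl T a b).
Local Notation letter := (bern_letter sep pi nl T b).
Local Notation twist := (sep_twist sep).
Local Notation Bel := (Bel pi T b).
Local Notation piM := (piM hd).
Local Notation pi_nl := (pi_nl hd).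
Local Notation piV := (piV hd).
Local Notation piJ := (piJ hd).
Local Notation pi1 := (pi1 hd).
Local Notation pi_Mnl := (pi_Mnl hd).
Implicit Types (e : W -> bool) (F : W1 -> HA).

Lemma lift_ind_r (P : W1 -> Prop) :
  (forall u, nosep (pi u) -> P u) ->
  (forall s w, S s -> sep (cnj (pi w) s) (pi w) = false -> P w -> P (w * nl s)%g) ->
  forall w, P w.
Proof.
move=> Pu Ps w; move: {2}(pi w) (erefl (pi w)) => v; move: v w.
apply: (simple_ind_r ws) => [u uO w E|s v Ss sv IH w E]; first by apply: Pu; rewrite E.
have E' : pi (w * (nl s)^-1)%g = v.
  by rewrite piM piV pi_nl// E mulgK.
rewrite -[w](mulgVK (nl s)); apply: Ps => //; last exact: IH.
by rewrite E'.
Qed.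

Lemma lift_ind (P : W1 -> Prop) :
  (forall u, nosep (pi u) -> P u) ->
  (forall s w, S s -> sep s (pi w) = false -> P w -> P (nl s * w)%g) ->
  forall w, P w.
Proof.
move=> Pu Ps w; move: {2}(pi w) (erefl (pi w)) => v; move: v w.
apply: (simple_ind ws) => [u uO w E|s v Ss sv IH w E]; first by apply: Pu; rewrite E.
have E' : pi ((nl s)^-1 * w)%g = v.
  by rewrite piM piV pi_nl// E mulKg.
rewrite -[w](mulVKg (nl s)); apply: Ps => //; last exact: IH.
by rewrite E'.
Qed.

Lemma eq_bernstein e e' F : e =1 e' -> bernstein e F -> bernstein e' F.
Proof.
move=> E [B1 B2 B3]; split=> // w s Ss; rewrite -B3//; congr (_ * _).
exact/eq_letter/fsym.
Qed.

(** A reduced gallery crosses exactly the separating hyperplanes, so the other signs never enter.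
    Uniqueness and the passage to limits both rest on this. *)
Lemma bernstein_agree e e' F F' w : bernstein e F -> bernstein e' F' ->
  (forall t, sep t (pi w) -> e t = e' t) -> F w = F' w.
Proof.
move=> bF bF'; move: w; apply: lift_ind_r => [u uO _|s w Ss sw IH E].
  by rewrite -[u]mul1g (bernu bF)// (bernu bF')// (bern1 bF) (bern1 bF').
have -> : F (w * nl s)%g = F w * letter e (pi w) s.
  by rewrite (berns bF)// sw expr0 scale1r.
have -> : F' (w * nl s)%g = F' w * letter e' (pi w) s.
  by rewrite (berns bF')// sw expr0 scale1r.
rewrite IH => [|t tw]; last first.
  by apply: E; rewrite pi_Mnl// (sepMs ws)// tw addbT; case: eqP tw => // ->; rewrite sw.
congr (_ * _); rewrite /bern_letter /osign E//.
by rewrite pi_Mnl// (sepMsN ws)// sw.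
Qed.

Lemma bernstein_uniq e F F' : bernstein e F -> bernstein e F' -> F =1 F'.
Proof. by move=> bF bF' w; apply: (bernstein_agree bF bF'). Qed.

Lemma flip_eq e e' (P : pred W) F F' :
  (forall t, P t -> e t = ~~ e' t) -> (forall t, ~~ P t -> e t = e' t) ->
  (forall t, P t -> twist e t =1 e') -> bernstein e F -> bernstein e' F' ->
  forall w, F w = flip S sep pi nl a b e P F' w.
Proof.
move=> eP eNP eT bF bF'; apply: (bernstein_uniq bF).
exact: (flip_bernstein hd eP eNP eT bF').
Qed.

(** Going from vC_0 to the adjacent chamber vsC_0 changes the sign at v s v^-1 only, and this
    reflection exchanges the two chambers, so the flip formula applies with a single reflection. *)
Lemma chamber_bernstein v : exists F, bernstein (fun t => ~~ sep t v) F.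
Proof.
move: v; apply: (simple_ind_r ws) => [u uO|s v Ss sv [F bF]].
  by exists T; apply: eq_bernstein (bernstein_base hd) => t; rewrite uO.
exists (flip S sep pi nl a b (fun t => ~~ sep t (v * s)%g) (pred1 (cnj v s)) F).
apply: (flip_bernstein hd _ _ _ bF) => t /=.
- by move=> /eqP ->; rewrite (sepMsN ws).
- by move=> /negbTE tN; rewrite (sepMs ws)// tN.
move=> /eqP -> t'; rewrite /sep_twist -(cnj_mulr v s) (sepJ ws).
by rewrite -addNb -addbA addbb addbF.
Qed.

Lemma approx_bernstein e : approximable sep e -> exists F, bernstein e F.
Proof.
move=> ea.
have /choice[vw vwP] (w : W1) : exists v, forall t, sep t (pi w) -> e t = ~~ sep t v.
  have [|t tw|v vP] := ea [set t | sep t (pi w)]; first exact: (sep_finite ws).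
    by exists (pi w).
  by exists v.
have /choice[Fv FvP] := chamber_bernstein.
exists (fun w => Fv (vw w) w).
(* Each axiom of [bernstein] involves at most two arguments, and for two arguments one chamber
   approximates [e] on all the hyperplanes concerned. *)
have key w w' : exists v, [/\ Fv (vw w) w = Fv v w, Fv (vw w') w' = Fv v w' &
    forall t, sep t (pi w) \/ sep t (pi w') -> e t = ~~ sep t v].
  have [||v vP] := ea ([set t | sep t (pi w)] `|` [set t | sep t (pi w')]).
  - by rewrite finite_setU; split; exact: (sep_finite ws).
  - by move=> t [] tw; eexists; exact: tw.
  by exists v; split=> //; apply: (bernstein_agree (FvP _) (FvP _)) => t tw;
    rewrite -vwP// vP//; [left|right].
split=> [|w u uO|w s Ss].
- exact: bern1 (FvP _).
- by have [v [-> -> _]] := key w (w * u)%g; rewrite (bernu (FvP _)).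
have [v [-> -> vP]] := key w (w * nl s)%g.
rewrite -(berns (FvP _))//; congr (_ * _); rewrite /bern_letter /osign vP//.
by rewrite pi_Mnl// (sepMsN ws)//; case: (sep _ _); [left|right].
Qed.

Lemma bern_ker_l e F F' u w : bernstein e F -> bernstein (twist e (pi u)) F' ->
  nosep (pi u) -> T u * F' w = F (u * w)%g.
Proof.
move=> bF bF' uO; move: w; apply: lift_ind_r => [v vO|s w Ss sw IH].
  rewrite -[v]mul1g mulgA mulg1 (bernu bF)// (bernu bF')// (bern1 bF') mul1r.
  by rewrite -[in RHS](mul1g u) (bernu bF)// (bern1 bF) mul1r.
have := berns bF' w Ss; rewrite sw expr0 scale1r => <-.
rewrite mulrA IH mulgA (letter_twist hd)// -piM (berns bF)// piM cnjM.
by rewrite (sepuM ws)// cnjK sw expr0 scale1r.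
Qed.

(** Moving a gallery by [s] and prefixing the crossing of the wall of [s] gives a gallery from C_0
    again; the twist of the orientation makes the letters of the moved gallery agree. *)
Lemma bern_simple_l e F F' s w : bernstein e F -> bernstein (twist e s) F' ->
  S s -> letter e 1%g s * F' w = a s ^+ sep s (pi w) *: F (nl s * w)%g.
Proof.
move=> bF bF' Ss; have Fs : letter e 1%g s = F (nl s).
  have := berns bF 1%g Ss; rewrite pi1 (sep1 ws) expr0 scale1r (bern1 bF) mul1r.
  by rewrite mul1g.
move: w; apply: lift_ind_r => [v vO|s' w Ss' sw IH].
  rewrite vO expr0 scale1r (bernu bF)// -Fs; congr (_ * _).
  by rewrite -{1}[v]mul1g (bernu bF')// (bern1 bF') mul1r.
have := berns bF' w Ss'; rewrite sw expr0 scale1r => <-.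
rewrite mulrA IH -scalerAl (letter_twist hd)// mulgA.
have -> : (s * pi w)%g = pi (nl s * w)%g by rewrite piM pi_nl.
rewrite (berns bF)// scalerA; congr (_ *: _).
rewrite piM pi_nl// cnjM (sepsM ws)// (cnj_simple ws)// sw addFb pi_Mnl// (sepMs ws)//.
have -> : (cnj s (cnj (pi w) s') == s) = (s == cnj (pi w) s').
  by rewrite cnj_eq (simpleV ws)// cnj_id eq_sym.
(* In the first case the moved gallery crosses the wall of [s] back. This return costs a_{s'}, which
   equals a_s as [s] and [s'] are conjugate. *)
case: eqP => [E|_]; last by rewrite addFb expr0 mulr1.
rewrite {2}E sw expr0 mul1r addTb.
have -> : sep s (pi w) = false by rewrite E.
by rewrite (a_conj hd (s := s') (t := s) (w := (pi w)^-1%g))// E /cnj !mulgA mulVg mul1g.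
Qed.

Definition class_function (X : set W) (c : W1 -> R) : Prop :=
  [/\ fsupp c, forall x, c x != 0 -> X (pi x) & forall g x, c (cnj g x) = c x].

Definition Zsum (F : W1 -> HA) (c : W1 -> R) : HA := \sum_(x \in [set: W1]) c x *: F x.

Lemma ZsumD F c c' : fsupp c -> fsupp c' ->
  Zsum F (fun w => c w + c' w) = Zsum F c + Zsum F c'.
Proof.
move=> fc fc'; rewrite /Zsum -fsumD; try exact: fsuppZ.
by apply: eq_fsum => w; rewrite scalerDl.
Qed.

Lemma ZsumZ F r c : fsupp c -> Zsum F (fun w => r * c w) = r *: Zsum F c.
Proof.
move=> fc; rewrite /Zsum fsumZ; last exact: fsuppZ.
by apply: eq_fsum => w; rewrite scalerA.
Qed.

Lemma ZsumN F c : fsupp c -> Zsum F (fun w => - c w) = - Zsum F c.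
Proof.
move=> fc; rewrite -[RHS]scaleN1r -ZsumZ//.
by apply: eq_fsum => w; rewrite mulN1r.
Qed.

Lemma ZsumB F c c' : fsupp c -> fsupp c' ->
  Zsum F (fun w => c w - c' w) = Zsum F c - Zsum F c'.
Proof.
move=> fc fc'; rewrite -ZsumN// -ZsumD//.
by apply: fsupp_sub fc' _ => w; rewrite oppr_eq0.
Qed.

Section Spherical.
Variables (X : set W) (D : Type) (eD : D -> W -> bool).
Hypothesis sd : spherical_datum S sep X eD.

(** When a simple [s] does not commute with the translation, [X_simple] says that of the two
    multiplications by [s], on the left and on the right, one gains and the other loses the same
    count. *)
Lemma wlen_conj (Q : set W) g x : (forall h t, Q t -> Q (cnj h t)) -> X x ->
  wlen sep Q (cnj g x) = wlen sep Q x.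
Proof.
move=> Qc Xx; move: g; apply: (simple_ind ws) => [u uO|s g Ss _ IH].
  rewrite /cnj (wlenMu ws); last exact: (nosepV ws).
  by rewrite (wlenuM ws).
rewrite cnjM -IH; have := X_conj sd g Xx; move: (cnj g x) => {IH} {Xx}x Xx.
have [E|N] := eqVneq (cnj x s) s.
  have sx : (s * x = x * s)%g by rewrite -{1}E cnj_mulr.
  by rewrite {1}/cnj sx mulgK.
have := X_simple sd Ss Xx N.
rewrite {1}/cnj (simpleV ws Ss).
have := wlensM ws x Qc Ss; have := wlenMs ws Q (s * x)%g Ss.
have -> : sep (cnj (s * x)%g s) (s * x)%g = sep s x^-1%g.
  rewrite -(sepV ws) invgM (simpleV ws Ss) (sepMs ws)//.
  by rewrite eq_sym cnj_eq invgK eq_sym (negbTE N).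
have -> : (cnj (s * x)%g s \in Q) = (s \in Q).
  apply/idP/idP; rewrite !inE => /(Qc _); last exact.
  by move=> /(_ (s * x)^-1%g); rewrite cnjK.
move: (wlen sep Q (s * x * s)%g) (wlen sep Q (s * x)%g) (wlen sep Q x).
by move=> A B C; case: (sep s x); case: (sep s x^-1%g); case: (s \in Q) => //=; lia.
Qed.

Lemma rlen_conj r g x : X x -> rlen S sep a r (cnj g x) = rlen S sep a r x.
Proof. by apply: wlen_conj => h t; exact: weight_class_conj. Qed.

Lemma len_conj g x : X x -> len (cnj g x) = len x.
Proof. exact: wlen_conj. Qed.

Lemma fold_weight_conj x t : X x ->
  fold_weight (cnj t x) (cnj (cnj t x) t) = fold_weight x t.
Proof.
move=> Xx; apply: eq_mon => r; rewrite /defect rlen_conj// refl_weight_conj.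
by congr (_ - _)./2; congr rlen; rewrite cnj_mulr /cnj mulgVK.
Qed.

Lemma Zsum_adjacent e e' F F' c : adjacent sep e e' ->
  (forall x, X x -> twist e x =1 e) -> (forall x, X x -> twist e' x =1 e') ->
  bernstein e F -> bernstein e' F' -> class_function X c -> Zsum F c = Zsum F' c.
Proof.
move=> [P [eP eNP eT]] eX e'X bF bF' [fc cX cJ].
(* Expressing [P] through the signs lets the translation invariance of [e] and [e'] control [P] as
   well. *)
have PE t : P t = (e t != e' t).
  case: (boolP (P t)) => [/eP ->|/eNP ->]; last by rewrite eqxx.
  by case: (e' t).
pose k x y := flip_coef S sep pi nl a b e P x y.
have kE x y : k x y = flip_coef S sep pi nl a b e P x y by [].
have ff x : fsupp (k x) by exact: (flip_coef_fsupp hd).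
have E1 x : c x *: F x = c x *: F' x +
    c x *: \sum_(y \in [set: W1]) k x y *: F' (y * x)%g.
  by rewrite (flip_eq eP eNP eT bF bF') scalerDr.
have fcF G : fsupp (fun x => c x *: G x : HA) by exact: fsuppZ.
rewrite /Zsum (eq_fsum E1) fsumD//; rewrite -[RHS]addr0; congr (_ + _).
pose g (p : W1 * W1) : HA := (c p.1 * k p.1 p.2) *: F' (p.2 * p.1)%g.
have fg : fsupp g.
  apply: (@fsupp_sub _ _ _ ((\bigcup_(x in [set x | c x != 0])
      (pair x @` [set y | k x y != 0])))).
    by apply: bigcup_finite => // x _; apply: finite_image; exact: ff.
  move=> [x y]; rewrite /g /= => gN; exists x => /=.
    by apply: contra gN => /eqP ->; rewrite mul0r scale0r.
  by exists y => //; apply: contra gN => /eqP ->; rewrite mulr0 scale0r.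
transitivity (\sum_(p \in [set: W1 * W1]) g p).
  rewrite fsum_pair//; apply: eq_fsum => x.
  rewrite fsumZ; last exact/fsuppZ.
  by apply: eq_fsum => y; rewrite scalerA.
(* Splitting by the sign of [e] yields two halves that the pairing exchanges, so no division by 2
   occurs. *)
pose h (o : bool) p : HA := if e (pi p.2) == o then g p else 0.
have fh o : fsupp (h o).
  by apply: fsupp_sub fg _ => p; rewrite /h; case: ifP; rewrite ?eqxx.
rewrite (eq_fsum (g := fun p => h true p + h false p)) => [|p]; last first.
  by rewrite /h; case: (e _); rewrite ?addr0 ?add0r.
rewrite fsumD// [X in _ + X](reindex_fsbigT
    (fun p => (cnj p.2 p.1, cnj (cnj p.2 p.1) p.2))); last first.
  exists (fun p => (cnj (cnj p.1^-1%g p.2)^-1%g p.1, cnj p.1^-1%g p.2)) => -[x y] /=.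
    by rewrite !cnjK.
  by rewrite !cnjVK.
rewrite [X in _ + X](eq_fsum (g := fun p => - h true p)) => [|[x y]]; last first.
  rewrite /h /g /=; have [c0|cx] := eqVneq (c x) 0.
    by rewrite cJ c0 !mul0r !scale0r !if_same oppr0.
  have Xx := cX _ cx; have Xx' := X_conj sd (pi y) Xx.
  have sx : sep (cnj (cnj (pi y) (pi x)) (pi y)) (cnj (pi y) (pi x)) = sep (pi y) (pi x).
    by rewrite -(sepV ws) -cnjV (X_refl sd).
  (* The hyperplane of y' is the image of that of y under the translation x'. For a translation
     invariant orientation, its sign therefore changes precisely when that hyperplane separates. *)
  have tw o : (forall x, X x -> twist o x =1 o) ->
      o (cnj (cnj (pi y) (pi x)) (pi y)) = o (pi y) (+) sep (pi y) (pi x).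
    by move=> oX; rewrite -(oX _ Xx' (pi y)) /sep_twist sx -addbA addbb addbF.
  rewrite cJ /k /flip_coef !piJ sx !PE (tw e)// (tw e')//.
  case: (boolP (sep _ _)) => [yx|_]; last by rewrite !andbF mulr0 !scale0r !if_same oppr0.
  have -> : (cnj (cnj y x) y * cnj y x)%g = (y * x)%g.
    by rewrite cnj_mulr /cnj mulgVK.
  rewrite fold_weight_conj// (beta_conj) !addbT sgN !andbT.
  by case: (e (pi y)); case: (e' (pi y)) => //=; rewrite ?mulr0 ?scale0r ?oppr0//;
    rewrite !mulNr mulrN scaleNr ?opprK.
by rewrite -(fsum_raddf (-%R)) ?subrr.
Qed.

Variable th : D -> W1 -> HA.
Hypothesis thP : forall d, bernstein (eD d) (th d).
Implicit Types (d : D) (c : W1 -> R).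

Lemma Zsum_indep d d' c : class_function X c -> Zsum (th d) c = Zsum (th d') c.
Proof.
move=> cc; elim: (eD_chain sd d d') => // {}d d1 d2 adj _ <-.
by apply: Zsum_adjacent adj _ _ (thP _) (thP _) cc; exact: (eD_X sd).
Qed.

Lemma Zsum_exchange F F' g L c : class_function X c ->
  (forall x, X (pi x) -> L * F' x = F (cnj g x) * L) ->
  L * Zsum F' c = Zsum F c * L.
Proof.
move=> [fc cX cJ] E; rewrite /Zsum fsumMl ?fsumMr; try exact: fsuppZ.
rewrite [RHS](reindex_fsbigT (cnj g)); last first.
  by exists (cnj g^-1%g); [exact: cnjK|exact: cnjVK].
apply: eq_fsum => x; rewrite cJ; have [->|cx] := eqVneq (c x) 0.
  by rewrite !scale0r mul0r mulr0.
by rewrite -scalerAr -scalerAl E//; exact: cX.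
Qed.

Lemma Zsum_comm_u d c u : class_function X c -> nosep (pi u) ->
  T u * Zsum (th d) c = Zsum (th d) c * T u.
Proof.
move=> cc uO; have [d' E] := eD_twist sd d (pi u).
rewrite {1}(Zsum_indep d d' cc); apply: (Zsum_exchange (g := u)) => // x Xx.
rewrite (bern_ker_l _ (thP d) (eq_bernstein E (thP d')))//.
by rewrite -(bernu (thP d))// cnj_mulr.
Qed.

Lemma Bel_comm s Z : S s -> (forall t, pi t = 1%g -> T t * Z = Z * T t) ->
  Bel s * Z = Z * Bel s.
Proof.
move=> Ss TZ; rewrite (Bel_ker hd)// fsumMl ?fsumMr; try exact/fsuppZ/(b_finite hd).
apply/eq_fsum => t.
rewrite -scalerAl -scalerAr; have [->|bt] := eqVneq (b s t) 0; first by rewrite !scale0r.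
by rewrite TZ// (b_ker hd Ss bt).
Qed.

Lemma Zsum_comm_s d c s : class_function X c -> S s ->
  T (nl s) * Zsum (th d) c = Zsum (th d) c * T (nl s).
Proof.
move=> cc Ss; have [d' E] := eD_twist sd d s.
have : letter (eD d) 1%g s * Zsum (th d') c = Zsum (th d) c * letter (eD d) 1%g s.
  apply: (Zsum_exchange (g := nl s)) => // x Xx.
  rewrite (bern_simple_l _ (thP d) (eq_bernstein E (thP d')))//.
  have Xx' := X_conj sd s Xx.
  (* The orientation is translation invariant, so the letter is the same after any translation. *)
  have -> : letter (eD d) 1%g s = letter (eD d) (pi (cnj (nl s) x)) s.
    rewrite -(mulg1 (pi _)) -(letter_twist hd); apply: eq_letter => t.
    by rewrite (eD_X sd)// piJ pi_nl.
  rewrite (berns (thP d))// cnj_mulr piJ pi_nl//.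
  by rewrite -(sepV ws) -cnjV (X_refl sd).
(* It remains to pass from the letter to T_{n_s}; they differ at most by B_s, a combination of
   elements that already commute with the sum. *)
rewrite -(Zsum_indep d d' cc) /bern_letter; case: ifP => // _.
rewrite mulrBl mulrBr Bel_comm => [/addIr//|//|t t1].
by rewrite Zsum_comm_u// t1; exact: (nosep1 ws).
Qed.

Lemma Zsum_central d c h : class_function X c -> Zsum (th d) c * h = h * Zsum (th d) c.
Proof.
move=> cc; have TZ w : T w * Zsum (th d) c = Zsum (th d) c * T w.
  move: w; apply: lift_ind => [u uO|s w Ss sw IH]; first exact: Zsum_comm_u.
  by rewrite (TsM hd)// -mulrA IH mulrA Zsum_comm_s// mulrA.
have [k [fk ->]] := T_span hd h.
move: (Zsum _ _) TZ => Z TZ; rewrite fsumMl ?fsumMr; try exact: fsuppZ.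
by apply: eq_fsum => w; rewrite -scalerAl -scalerAr TZ.
Qed.

End Spherical.
End HeckeCenter.

(** * Central elements are class sums *)

Section CenterConverse.
Variables (W : groupType) (S : set W) (sep : W -> W -> bool).
Variables (W1 : groupType) (pi : W1 -> W) (nl : W -> W1) (R : comNzRingType).
Variables (HA : algType R) (T : W1 -> HA) (a : W -> R) (b : W -> W1 -> R).
Hypothesis hd : hecke_datum S sep pi nl T a b.
Let ws := hd_ws hd.
Local Notation nosep := (nosep sep).
Local Notation len := (len sep).
Local Notation bernstein := (bernstein S sep pi nl T a b).
Local Notation letter := (bern_letter sep pi nl T b).
Local Notation Bel := (Bel pi T b).
Local Notation piM := (piM hd).
Local Notation pi_nl := (pi_nl hd).
Local Notation piV := (piV hd).
Local Notation piJ := (piJ hd).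
Local Notation pi1 := (pi1 hd).
Local Notation pi_Mnl := (pi_Mnl hd).

Definition low (l : nat) (h : HA) : Prop :=
  exists c, [/\ fsupp c, forall w, c w != 0 -> (len (pi w) < l)%N & h = Zsum T c].

Lemma low0 l : low l 0.
Proof.
exists (fun=> 0); split=> [||]; first by apply: (@fsupp_sub _ _ _ set0) => // i; rewrite eqxx.
  by move=> w; rewrite eqxx.
by rewrite /Zsum fsbig1// => w _; rewrite scale0r.
Qed.

Lemma low_add l h k : low l h -> low l k -> low l (h + k).
Proof.
move=> [c [fc cl ->]] [d [fd dl ->]]; exists (fun w => c w + d w); split.
- exact: fsuppD.
- by move=> w; have [->|/cl//] := eqVneq (c w) 0; rewrite add0r; exact: dl.
by rewrite ZsumD.
Qed.

Lemma low_scale l r h : low l h -> low l (r *: h).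
Proof.
move=> [c [fc cl ->]]; exists (fun w => r * c w); split.
- by apply: fsupp_sub fc _ => w; apply: contra => /eqP ->; rewrite mulr0.
- by move=> w rc; apply: cl; apply: contra rc => /eqP ->; rewrite mulr0.
by rewrite ZsumZ.
Qed.

Lemma low_opp l h : low l h -> low l (- h).
Proof. by rewrite -scaleN1r; exact: low_scale. Qed.

Lemma low_fsum l (I : choiceType) (f : I -> HA) : fsupp f ->
  (forall i, f i != 0 -> low l (f i)) -> low l (\sum_(i \in [set: I]) f i).
Proof.
move=> ff fl; rewrite (fsbigTE (fset_set [set i | f i != 0])) => [|i]; last first.
  by rewrite in_fset_set// => /negP; rewrite inE /= => /negP/negPn/eqP.
apply: big_ind => [||i _]; [exact: low0|exact: low_add|].
by have [->|/fl//] := eqVneq (f i) 0; exact: low0.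
Qed.

Lemma low_T l w : (len (pi w) < l)%N -> low l (T w).
Proof.
move=> wl; exists (fun v => (v == w)%:R); split.
- by apply: (@fsupp_sub _ _ _ [set w]) => // v /=; have [//|_] := eqVneq v w; rewrite eqxx.
- by move=> v; have [->//|_] := eqVneq v w; rewrite eqxx.
rewrite /Zsum -[LHS](fsum_pick w); apply: eq_fsum => v.
by case: eqP => [->|]; rewrite ?scale1r ?scale0r.
Qed.

Lemma low_le l l' h : (l <= l')%N -> low l h -> low l' h.
Proof.
by move=> ll [c [fc cl ->]]; exists c; split=> // w /cl wl; exact: leq_trans wl ll.
Qed.

Lemma low_ind l (P : HA -> Prop) :
  P 0 -> (forall h k, P h -> P k -> P (h + k)) -> (forall r h, P h -> P (r *: h)) ->
  (forall w, (len (pi w) < l)%N -> P (T w)) -> forall h, low l h -> P h.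
Proof.
move=> P0 PD PZ PT h [c [fc cl ->]].
rewrite /Zsum (fsbigTE (fset_set [set w | c w != 0])) => [|w]; last first.
  rewrite in_fset_set// => /negP; rewrite inE /= => /negP/negPn/eqP ->.
  by rewrite scale0r.
rewrite big_seq; apply: big_ind => // w; rewrite in_fset_set// inE /= => cw.
exact/PZ/PT/cl.
Qed.

Lemma Tw_Bel w s : S s -> T w * Bel s = \sum_(t \in [set: W1]) b s t *: T (w * t)%g.
Proof.
move=> Ss; rewrite (Bel_ker hd)// fsumMl; last exact/fsuppZ/(b_finite hd).
apply: eq_fsum => t; rewrite -scalerAr; have [->|bt] := eqVneq (b s t) 0.
  by rewrite !scale0r.
by rewrite -(TMu hd)//; apply: (nosep_ker hd); exact: (b_ker hd Ss).
Qed.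

Lemma low_Tw_Bel l w s : S s -> (len (pi w) < l)%N -> low l (T w * Bel s).
Proof.
move=> Ss wl; rewrite Tw_Bel//; apply: low_fsum => [|t]; first exact/fsuppZ/(b_finite hd).
have [->|bt _] := eqVneq (b s t) 0; first by rewrite scale0r eqxx.
by apply/low_scale/low_T; rewrite piM (b_ker hd Ss bt) mulg1.
Qed.

Lemma nl_sq s : S s -> nosep (pi (nl s * nl s)%g).
Proof.
by move=> Ss; rewrite pi_Mnl// pi_nl// (simple_sq ws)//; exact: (nosep1 ws).
Qed.

Lemma Tw_Ts_down w s : S s -> sep (cnj (pi w) s) (pi w) ->
  T w * T (nl s) = a s *: T (w * nl s)%g + T w * Bel s.
Proof.
move=> Ss sw; have Tw : T w = T (w * (nl s)^-1)%g * T (nl s).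
  rewrite -(TMs hd)// ?mulgVK//.
  rewrite piM piV pi_nl// (simpleV ws Ss) cnjMs.
  by rewrite (sepMsN ws)// sw.
rewrite Tw -mulrA -expr2 (T_sq hd)// mulrDr -scalerAr -(TMu hd _ (nl_sq Ss)).
by rewrite !mulgA mulgVK mulrA.
Qed.

Lemma Ts_Tw_down w s : S s -> sep s (pi w) ->
  T (nl s) * T w = a s *: T (nl s * w)%g +
    \sum_(t \in [set: W1]) b s t *: T (nl s * t * (nl s)^-1 * w)%g.
Proof.
move=> Ss sw.
have sw' t : pi t = 1%g -> sep s (pi (t * ((nl s)^-1 * w))%g) = false.
  move=> t1; rewrite !piM t1 mul1g piV pi_nl// (simpleV ws Ss) (sepsM ws)//.
  by rewrite cnj_id eqxx sw.
have Tw : T w = T (nl s) * T ((nl s)^-1 * w)%g.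
  by rewrite -(TsM hd)// ?mulVKg// -[X in pi X]mul1g sw'// pi1.
rewrite {1}Tw mulrA -expr2 (T_sq hd)// mulrDl -scalerAl -(TuM hd _ (nl_sq Ss)).
rewrite -!mulgA mulVKg; congr (_ + _).
rewrite -/(Bel s) Tw_Bel// fsumMr; last exact/fsuppZ/(b_finite hd).
apply: eq_fsum => t; rewrite -scalerAl; have [->|bt] := eqVneq (b s t) 0.
  by rewrite !scale0r.
have t1 := b_ker hd Ss bt.
rewrite (TMu hd _ (nosep_ker hd t1)) -mulrA -(TuM hd _ (nosep_ker hd t1)).
by rewrite -(TsM hd Ss (sw' t t1)) !mulgA.
Qed.

(* Up to shorter terms, [T (nl s)] shifts the terms of maximal length. *)
Lemma Ts_top l w s : S s -> (len (pi w) <= l)%N -> low l.+1 (T (nl s) * T w -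
  (if len (pi (nl s * w)%g) == l.+1 then T (nl s * w)%g else 0)).
Proof.
move=> Ss wl; rewrite piM pi_nl//; case: (boolP (sep s (pi w))) => [sw|/negbTE sw].
  have lt : (len (s * pi w)%g < l.+1)%N.
    by rewrite ltnS (leq_trans _ wl)// (lensM_down ws Ss sw).
  rewrite ltn_eqF//.
  rewrite subr0 Ts_Tw_down//; apply: low_add.
    by apply/low_scale/low_T; rewrite piM pi_nl.
  apply: low_fsum => [|t]; first exact/fsuppZ/(b_finite hd).
  have [->|bt _] := eqVneq (b s t) 0; first by rewrite scale0r eqxx.
  apply/low_scale/low_T.
  by rewrite !piM (b_ker hd Ss bt) mulg1 piV mulgV mul1g.
rewrite -(TsM hd)//; case: eqP => [_|N]; first by rewrite subrr; exact: low0.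
rewrite subr0; apply: low_T; move/eqP: N; rewrite piM pi_nl// (lensM_up ws Ss sw).
by move=> N; rewrite ltnS ltn_neqAle N.
Qed.

Lemma Tw_top l w s : S s -> (len (pi w) <= l)%N -> low l.+1 (T w * T (nl s) -
  (if len (pi (w * nl s)%g) == l.+1 then T (w * nl s)%g else 0)).
Proof.
move=> Ss wl; rewrite pi_Mnl//.
case: (boolP (sep (cnj (pi w) s) (pi w))) => [sw|/negbTE sw].
  have lt : (len (pi w * s)%g < l.+1)%N.
    by rewrite ltnS (leq_trans _ wl)// (lenMs_down ws Ss sw).
  rewrite ltn_eqF//.
  rewrite subr0 Tw_Ts_down//; apply: low_add.
    by apply/low_scale/low_T; rewrite pi_Mnl.
  exact: low_Tw_Bel.
rewrite -(TMs hd)//; case: eqP => [_|N]; first by rewrite subrr; exact: low0.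
rewrite subr0; apply: low_T; move/eqP: N; rewrite pi_Mnl// (lenMs_up ws Ss sw).
by move=> N; rewrite ltnS ltn_neqAle N.
Qed.

Lemma ZsumT_eq_low l c d h : fsupp c -> fsupp d -> low l h -> Zsum T c = Zsum T d + h ->
  forall w, (l <= len (pi w))%N -> c w = d w.
Proof.
move=> fc fd [k [fk kl ->]] E w wl.
have fdk := fsuppD fd fk.
have fN : fsupp (fun w => c w - (d w + k w)).
  by apply: fsuppD => //; apply: fsupp_sub fdk _ => i; rewrite oppr_eq0.
have := T_free hd fN; rewrite -/(Zsum T _) ZsumB// ZsumD// E subrr => /(_ erefl w).
have -> : k w = 0 by apply/eqP/contraT => /kl; rewrite ltnNge wl.
by rewrite addr0 => /eqP; rewrite subr_eq0 => /eqP.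
Qed.

Section Central.
Variables (c : W1 -> R) (l : nat).
Hypotheses (fc : fsupp c) (cl : forall w, c w != 0 -> (len (pi w) <= l)%N).
Hypothesis cz : forall h, Zsum T c * h = h * Zsum T c.

Lemma shift_fsupp (P : pred W1) (f g : W1 -> W1) : cancel f g -> cancel g f ->
  fsupp (fun v => if P v then c (f v) else 0).
Proof.
move=> fg gf; apply: (@fsupp_sub _ _ _ (g @` [set w | c w != 0])).
  exact: finite_image.
by move=> v; case: ifP => [_ cv|_]; [exists (f v)|rewrite eqxx].
Qed.

Lemma shift_sum (P : pred W1) (f g : W1 -> W1) : cancel f g -> cancel g f ->
  \sum_(w \in [set: W1]) c w *: (if P (g w) then T (g w) else 0) =
  Zsum T (fun v => if P v then c (f v) else 0).
Proof.
move=> fg gf; rewrite [RHS](reindex_fsbigT g); last by exists f.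
by apply: eq_fsum => w; rewrite gf; case: ifP; rewrite ?scaler0 ?scale0r.
Qed.

(** Treats both multiplications by T_{n_s} at once: [g] is the shift of the index, and [P] selects
    the shifted terms that reach length l + 1. *)
Lemma Zsum_top f (P : pred W1) (g g' : W1 -> W1) : cancel g g' -> cancel g' g ->
  (forall w, (len (pi w) <= l)%N -> low l.+1 (f w - if P (g w) then T (g w) else 0)) ->
  exists2 h, low l.+1 h & \sum_(w \in [set: W1]) c w *: f w =
    Zsum T (fun v => if P v then c (g' v) else 0) + h.
Proof.
move=> gK g'K fP.
exists (\sum_(w \in [set: W1]) c w *: (f w - if P (g w) then T (g w) else 0)).
  apply: low_fsum => [|w]; first exact: fsuppZ.
  have [->|cw _] := eqVneq (c w) 0; first by rewrite scale0r eqxx.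
  exact/low_scale/fP/cl.
rewrite -(shift_sum _ g'K gK) -fsumD; try exact: fsuppZ.
by apply: eq_fsum => w; rewrite -scalerDr addrC subrK.
Qed.

Lemma central_shift v s : S s -> len (pi v) = l.+1 ->
  c ((nl s)^-1 * v)%g = c (v * (nl s)^-1)%g.
Proof.
move=> Ss vl; pose P w := len (pi w) == l.+1.
have [h lh E] := @Zsum_top (fun w => T (nl s) * T w) P (fun w => nl s * w)%g
  (fun v => (nl s)^-1 * v)%g (mulKg _) (mulVKg _) (fun w => Ts_top Ss).
have [h' lh' E'] := @Zsum_top (fun w => T w * T (nl s)) P (fun w => w * nl s)%g
  (fun v => v * (nl s)^-1)%g (mulgK _) (mulgVK _) (fun w => Tw_top Ss).
have := cz (T (nl s)).
have -> : Zsum T c * T (nl s) = \sum_(w \in [set: W1]) c w *: (T w * T (nl s)).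
  rewrite /Zsum fsumMr; last exact: fsuppZ.
  by apply: eq_fsum => w; rewrite scalerAl.
have -> : T (nl s) * Zsum T c = \sum_(w \in [set: W1]) c w *: (T (nl s) * T w).
  rewrite /Zsum fsumMl; last exact: fsuppZ.
  by apply: eq_fsum => w; rewrite scalerAr.
rewrite E E' => EE0.
have EE : Zsum T (fun v => if P v then c ((nl s)^-1 * v)%g else 0) =
    Zsum T (fun v => if P v then c (v * (nl s)^-1)%g else 0) + (h' - h).
  by rewrite addrA EE0 addrK.
have lhh : low l.+1 (h' - h) by apply: low_add => //; exact: low_opp.
have := ZsumT_eq_low _ _ lhh EE (w := v); rewrite /P vl eqxx; apply => //.
  exact: (shift_fsupp P (mulVKg _) (mulKg _)).
exact: (shift_fsupp P (mulgVK _) (mulgK _)).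
Qed.

Lemma central_conj_u w u : nosep (pi u) -> c (cnj u w) = c w.
Proof.
move=> uO; have := cz (T u).
have -> : Zsum T c * T u = Zsum T (fun v => c (v * u^-1)%g).
  rewrite /Zsum fsumMr; last exact: fsuppZ.
  rewrite [RHS](reindex_fsbigT (fun v => v * u)%g); last first.
    by exists (fun v => v * u^-1)%g => v; rewrite ?mulgK ?mulgVK.
  by apply: eq_fsum => v; rewrite mulgK (TMu hd)// scalerAl.
have -> : T u * Zsum T c = Zsum T (fun v => c (u^-1 * v)%g).
  rewrite /Zsum fsumMl; last exact: fsuppZ.
  rewrite [RHS](reindex_fsbigT (fun v => u * v)%g); last first.
    by exists (fun v => u^-1 * v)%g => v; rewrite ?mulKg ?mulVKg.
  by apply: eq_fsum => v; rewrite mulKg (TuM hd)// scalerAr.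
rewrite -[RHS]addr0 => E.
have := ZsumT_eq_low _ _ (low0 0) E (w := (u * w)%g).
rewrite mulKg -/(cnj u w) => -> //.
  have := (@shift_fsupp predT (fun v => v * u^-1)%g (fun v => v * u)%g); apply.
    exact: mulgVK.
  exact: mulgK.
have := (@shift_fsupp predT (fun v => u^-1 * v)%g (fun v => u * v)%g); apply.
  exact: mulVKg.
exact: mulKg.
Qed.

(** Induct along a reduced expression of [g], as additivity passes to the shorter factor. Since the
    coefficient at the conjugate is nonzero, [cl] bounds its length, and additivity then forces the
    next left product by [s] to have length l + 1. *)
Lemma central_conj g w : len (pi w) = l -> c w != 0 ->
  len (pi (g * w)%g) = (len (pi g) + len (pi w))%N -> c (cnj g w) = c w.
Proof.
move=> wl cw; move: g; apply: (lift_ind hd) => [u uO _|s g Ss sg IH E].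
  exact: central_conj_u.
have gw : len (pi (g * w)%g) = (len (pi g) + len (pi w))%N.
  apply/eqP; rewrite eqn_leq; apply/andP; split; first by rewrite piM; exact: (len_le1M ws).
  have := lensM_le ws (pi (g * w)%g) Ss; rewrite -{1}(pi_nl Ss) -piM mulgA E.
  by rewrite [pi (nl s * g)%g]piM pi_nl// (lensM_up ws Ss sg).
have Eg := IH gw; have w1l : (len (pi (cnj g w)) <= l)%N by apply: cl; rewrite Eg.
rewrite -Eg cnjM; have := central_shift (v := (nl s * cnj g w)%g) Ss.
rewrite mulKg => -> //; apply/eqP; rewrite eqn_leq piM pi_nl//; apply/andP; split.
  by apply: leq_trans (lensM_le ws _ Ss) _.
(* The product s g w equals (s g w g^-1) g and has length 1 + len g + l, which bounds the length of
   the first factor from below by l + 1. *)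
have := len_le1M ws (s * pi (cnj g w))%g (pi g).
have -> : (s * pi (cnj g w) * pi g)%g = pi (nl s * g * w)%g.
  by rewrite -mulgA -piM cnj_mulr -{1}(pi_nl Ss) -piM mulgA.
rewrite E wl [pi (nl s * g)%g]piM pi_nl// (lensM_up ws Ss sg).
by rewrite addSnnS addnC leq_add2r.
Qed.

Section TopTerms.
Variables (X : set W) (D : Type) (eD : D -> W -> bool) (d0 : D).
Hypothesis sd : spherical_datum S sep X eD.

Lemma top_in_X w : len (pi w) = l -> c w != 0 -> X (pi w).
Proof.
move=> wl cw; apply: contrapT => /(X_deep sd)[x [Xx disj inj]].
have [x1 Ex] := pi_surj hd x.
have piX m : pi (x1 ^+ m)%g = (x ^+ m)%g.
  by elim: m => [|m IH]; rewrite ?expg0 ?pi1// !expgS piM IH Ex.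
have cm m : c (cnj (x1 ^+ m)%g w) != 0.
  rewrite central_conj// !piM piX; apply: (len_disjoint ws) => t tw.
  by rewrite -expVgn; exact: disj.
have : finite_set [set: nat].
  apply: (@sub_finite_set _ _ ((fun m => cnj (x1 ^+ m)%g w) @^-1` [set w | c w != 0])).
    by move=> m _; exact: cm.
  apply: finite_preimage => // m m' _ _ /(congr1 pi); rewrite !piJ !piX.
  exact: inj.
exact: infinite_nat.
Qed.

(** For a translation the length survives every conjugation, and at least one of [n_s x] and [x n_s]
    has length l + 1, so [central_shift] applies at each step. *)
Lemma top_conj x g : len (pi x) = l -> X (pi x) -> c (cnj g x) = c x.
Proof.
move=> xl Xx; move: g x xl Xx; apply: (lift_ind hd) => [u uO x _ _|s g Ss _ IH x xl Xx].
  exact: central_conj_u.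
rewrite cnjM -[RHS](IH x xl Xx).
have Xg : X (pi (cnj g x)) by rewrite piJ; exact: (X_conj sd).
have gl : len (pi (cnj g x)) = l by rewrite piJ (len_conj hd sd).
move: (cnj g x) Xg gl => {xl Xx IH} {}x Xx xl.
case sx : (sep s (pi x)); last first.
  have := central_shift (v := (nl s * x)%g) Ss; rewrite mulKg => -> //.
  by rewrite piM pi_nl// (lensM_up ws Ss sx) xl.
have sx' : sep (cnj (pi x) s) (pi x) = false.
  have [E|N] := eqVneq (cnj (pi x) s) s.
    (* If the translation commutes with [s], its wall cannot separate: invariance of the orientation
       would reverse its own sign at [s]. *)
    by have := eD_X sd d0 Xx s; rewrite /sep_twist E sx addbT; case: (eD d0 s).
  by have := X_simple sd Ss Xx N; rewrite sx -(sepV ws); case: (sep _ _).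
have := central_shift (v := (x * nl s)%g) Ss.
rewrite mulgK pi_Mnl// (lenMs_up ws Ss sx') xl => <- //.
(* So far the conjugation is by the inverse of n_s; the square of n_s lies over 1 and corrects
   this. *)
have n2 : nosep (pi (nl s * nl s)%g) by exact: nl_sq.
rewrite -[RHS](central_conj_u _ n2) /cnj invgM; congr c.
by rewrite !mulgA !mulgK.
Qed.

End TopTerms.

End Central.

Lemma low_mul_Ts l h s : S s -> low l h -> low l.+1 (h * T (nl s)).
Proof.
move=> Ss; move: h; apply: low_ind => [|h k hl kl|r h hl|w wl].
- by rewrite mul0r; exact: low0.
- by rewrite mulrDl; exact: low_add.
- by rewrite -scalerAl; exact: low_scale.
case: (boolP (sep (cnj (pi w) s) (pi w))) => [sw|/negbTE sw].
  rewrite Tw_Ts_down//; apply: low_add; last exact/low_Tw_Bel/ltnW.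
  apply/low_scale/low_T; rewrite pi_Mnl// ltnS (leq_trans _ (ltnW wl))//.
  by rewrite (lenMs_down ws Ss sw).
by rewrite -(TMs hd)//; apply: low_T; rewrite pi_Mnl// (lenMs_up ws Ss sw).
Qed.

Lemma low_mul_Bel l h s : S s -> low l h -> low l (h * Bel s).
Proof.
move=> Ss; move: h; apply: low_ind => [|h k hl kl|r h hl|w wl].
- by rewrite mul0r; exact: low0.
- by rewrite mulrDl; exact: low_add.
- by rewrite -scalerAl; exact: low_scale.
exact: low_Tw_Bel.
Qed.

Lemma bern_triangular e F w : bernstein e F -> low (len (pi w)) (F w - T w).
Proof.
move=> bF; move: w; apply: (lift_ind_r hd) => [u uO|s w Ss sw IH].
  by rewrite -[u]mul1g (bernu bF)// (bern1 bF) mul1g mul1r subrr; exact: low0.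
have := berns bF w Ss; rewrite sw expr0 scale1r => <-.
rewrite pi_Mnl// (lenMs_up ws Ss sw) (TMs hd)//.
have -> : F w * letter e (pi w) s - T w * T (nl s) = (F w - T w) * T (nl s) +
    (if osign sep e (pi w) s then 0 else - (F w * Bel s)).
  by rewrite /bern_letter; case: ifP; rewrite ?addr0 ?mulrBr mulrBl// addrAC.
apply: low_add; first exact: low_mul_Ts.
case: ifP => _; first exact: low0.
apply/low_opp/low_mul_Bel => //; rewrite -[F w](subrK (T w)).
by apply: low_add; [exact: low_le IH|exact: low_T].
Qed.

Lemma Zsum_triangular e F c l : bernstein e F -> fsupp c ->
  (forall w, c w != 0 -> (len (pi w) <= l)%N) -> low l (Zsum F c - Zsum T c).
Proof.
move=> bF fc cl.
have -> : Zsum F c - Zsum T c = Zsum (fun w => F w - T w) c.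
  apply/eqP; rewrite subr_eq; apply/eqP; rewrite /Zsum -fsumD; try exact: fsuppZ.
  by apply: eq_fsum => w; rewrite -scalerDr subrK.
apply: low_fsum => [|w]; first exact: fsuppZ.
have [->|cw _] := eqVneq (c w) 0; first by rewrite scale0r eqxx.
exact/low_scale/(low_le (cl _ cw))/(bern_triangular _ bF).
Qed.

Lemma fsupp_bound (c : W1 -> R) : fsupp c -> exists l, forall w, c w != 0 -> (len (pi w) < l)%N.
Proof.
move=> fc; exists (\max_(w <- fset_set [set w | c w != 0%R]) (len (pi w)).+1)%N.
move=> w cw; apply: (leq_bigmax_seq (F := fun w => (len (pi w)).+1)) => //.
by rewrite in_fset_set// inE.
Qed.

Lemma fsupp0 : fsupp (fun _ : W1 => 0 : R).
Proof. by apply: (@fsupp_sub _ _ _ set0) => // i; rewrite eqxx. Qed.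

Lemma Zsum0 (F : W1 -> HA) : Zsum F (fun _ => 0 : R) = 0.
Proof. by rewrite /Zsum fsbig1// => w _; rewrite scale0r. Qed.

Lemma bern_free e F (c : W1 -> R) : bernstein e F -> fsupp c -> Zsum F c = 0 -> forall w, c w = 0.
Proof.
move=> bF fc E; have [l cl] := fsupp_bound fc.
elim: l cl => [|l IH] cl; first by move=> w; apply/eqP/contraT => /cl.
apply: IH => w cw; rewrite ltnNge; apply: contra cw => wl; apply/eqP.
have H := Zsum_triangular bF fc cl.
have E' : Zsum T c = Zsum T (fun=> 0) + - (Zsum F c - Zsum T c).
  by rewrite Zsum0 E !sub0r opprK.
exact: (ZsumT_eq_low fc fsupp0 (low_opp H) E').
Qed.

Section Converse.
Variables (X : set W) (D : Type) (eD : D -> W -> bool).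
Hypothesis sd : spherical_datum S sep X eD.
Variable th : D -> W1 -> HA.
Hypothesis thP : forall d, bernstein (eD d) (th d).

Lemma class_functionD (c c' : W1 -> R) : class_function pi X c -> class_function pi X c' ->
  class_function pi X (fun w => c w + c' w).
Proof.
move=> [fc cX cJ] [fc' c'X c'J]; split; first exact: fsuppD.
  by move=> x; have [->|/cX//] := eqVneq (c x) 0; rewrite add0r; exact: c'X.
by move=> g x; rewrite cJ c'J.
Qed.

Lemma class_function0 : class_function pi X (fun=> 0 : R).
Proof. by split=> [|x|//]; [exact: fsupp0|rewrite eqxx]. Qed.

Theorem center_Zsum d z : (forall h, z * h = h * z) ->
  exists2 c, class_function pi X c & z = Zsum (th d) c.
Proof.
have [k [fk]] := T_span hd z; have [l kl] := fsupp_bound fk => zE.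
have : low l z by exists k; split.
move: z {k fk kl zE}; elim: l => [|l IH] z [c [fc cl zE]] zc.
  exists (fun=> 0); first exact: class_function0.
  rewrite Zsum0 zE /Zsum fsbig1// => w _.
  by have [->|/cl//] := eqVneq (c w) 0; rewrite scale0r.
pose top w := (len (pi w) == l) && (pi w \in X).
pose c' w := if top w then c w else 0.
have cz h : Zsum T c * h = h * Zsum T c by rewrite -zE.
have topJ g x : top (cnj g x) = top x.
  have J h y : top y -> top (cnj h y).
    rewrite /top => /andP[yl]; rewrite inE => Xy.
    rewrite piJ (len_conj hd sd)// yl inE; exact: (X_conj sd).
  by apply/idP/idP => [/(J g^-1%g)|]; [rewrite cnjK|exact: J].
have cc' : class_function pi X c'.
  split.
  - by apply: fsupp_sub fc _ => x; rewrite /c'; case: ifP; rewrite ?eqxx.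
  - move=> x; rewrite /c' /top; case: ifP; last by rewrite eqxx.
    by move=> /andP[_]; rewrite inE.
  - move=> g x; rewrite /c' topJ; case: ifP => // /andP[/eqP xl]; rewrite inE => Xx.
    exact: (top_conj fc cl cz d sd).
have [fc' _ _] := cc'.
have c'l w : c' w != 0 -> (len (pi w) <= l)%N.
  by rewrite /c' /top; case: ifP => [/andP[/eqP ->]//|]; rewrite eqxx.
have [||c2 cc2 E2] := IH (z - Zsum (th d) c').
- rewrite -[z](subrK (Zsum T c')) -addrA; apply: low_add; last first.
    by rewrite -opprB; apply/low_opp/(Zsum_triangular (thP d)).
  rewrite zE -ZsumB//; exists (fun w => c w - c' w); split=> //.
    by apply: fsuppD => //; apply: fsupp_sub fc' _ => w; rewrite oppr_eq0.
  move=> w; have [cw|cw] := eqVneq (c w) 0.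
    by rewrite cw /c' cw if_same subrr eqxx.
  have := cl _ cw; rewrite ltnS leq_eqVlt => /orP[/eqP wl|//].
  rewrite /c' /top wl eqxx; have := top_in_X fc cl cz sd wl cw.
  by rewrite -in_setE => -> /=; rewrite subrr eqxx.
- by move=> h; rewrite mulrBl mulrBr zc (Zsum_central hd sd thP).
exists (fun w => c' w + c2 w); first exact: class_functionD.
have [fc2 _ _] := cc2.
by rewrite ZsumD// -E2 addrC subrK.
Qed.

End Converse.
End CenterConverse.

(** * Orbit sums and invariants *)

Section OrbitSums.
Variables (W : groupType) (S : set W) (sep : W -> W -> bool).
Variables (W1 : groupType) (pi : W1 -> W) (nl : W -> W1) (R : comNzRingType).
Variables (HA : algType R) (T : W1 -> HA) (a : W -> R) (b : W -> W1 -> R).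
Hypothesis hd : hecke_datum S sep pi nl T a b.
Variables (X : set W) (D : Type) (eD : D -> W -> bool).
Hypothesis sd : spherical_datum S sep X eD.
Local Notation bernstein := (bernstein S sep pi nl T a b).
Implicit Types (x y : W1) (F : W1 -> HA) (c : W1 -> R).

Lemma conj_orbitP x y : conj_orbit x y <-> exists g, y = cnj g x.
Proof. by split=> [[g _ <-]|[g ->]]; exists g. Qed.

Lemma conj_orbit_cnj g x y : conj_orbit x (cnj g y) <-> conj_orbit x y.
Proof.
have J h z : conj_orbit x z -> conj_orbit x (cnj h z).
  by move=> /conj_orbitP[k ->]; apply/conj_orbitP; exists (h * k)%g; rewrite cnjM.
by split=> [/(J g^-1%g)|]; [rewrite cnjK|exact: J].
Qed.

Lemma conj_orbit_refl x : conj_orbit x x.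
Proof. by apply/conj_orbitP; exists 1%g; rewrite cnj1. Qed.

Lemma conj_orbit_eq x y z : conj_orbit x z -> conj_orbit y z -> conj_orbit x = conj_orbit y.
Proof.
move=> /conj_orbitP[g ->] /conj_orbit_cnj /conj_orbitP[h ->].
apply/seteqP; split=> u /conj_orbitP[k ->]; apply/conj_orbit_cnj.
  exact/conj_orbit_cnj/conj_orbit_refl.
by rewrite -[X in conj_orbit _ X](cnjK h); apply/conj_orbit_cnj/conj_orbit_refl.
Qed.

Definition orbit_indic x : W1 -> R := fun y => if y \in conj_orbit x then 1 else 0.

Lemma orbit_indicE x y : conj_orbit x y -> orbit_indic x y = 1.
Proof. by rewrite /orbit_indic -in_setE => ->. Qed.

Lemma orbit_indic0 x y : ~ conj_orbit x y -> orbit_indic x y = 0.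
Proof. by rewrite /orbit_indic; case: ifP => //; rewrite in_setE. Qed.

Lemma orbit_indic_fsupp x : finite_set (conj_orbit x) -> fsupp (orbit_indic x).
Proof.
move=> fx; apply: fsupp_sub fx _ => y; rewrite /orbit_indic.
by case: ifP; rewrite ?in_setE// eqxx.
Qed.

Lemma orbit_indic_class x : X (pi x) -> finite_set (conj_orbit x) ->
  class_function pi X (orbit_indic x).
Proof.
move=> Xx fx; split; first exact: orbit_indic_fsupp.
  move=> y; rewrite /orbit_indic; case: ifP; last by rewrite eqxx.
  by rewrite in_setE => /conj_orbitP[g ->] _; rewrite (piJ hd); exact: (X_conj sd).
move=> g y; have [xy|nxy] := pselect (conj_orbit x y).
  by rewrite !orbit_indicE//; apply/conj_orbit_cnj.
by rewrite !orbit_indic0// => /conj_orbit_cnj.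
Qed.

Lemma Zsum_orbit F x : \sum_(y \in conj_orbit x) F y = Zsum F (orbit_indic x).
Proof.
rewrite fsum_mkcond /Zsum; apply: eq_fsum => y.
by rewrite /orbit_indic; case: ifP; rewrite ?scale1r ?scale0r.
Qed.

Lemma eq_Zsum F c c' : c =1 c' -> Zsum F c = Zsum F c'.
Proof. by move=> E; apply: eq_fsum => w; rewrite E. Qed.

Lemma class_function_orbit c x : class_function pi X c -> c x != 0 ->
  X (pi x) /\ finite_set (conj_orbit x).
Proof.
move=> [fc cX cJ] cx; split; first exact: cX.
by apply: sub_finite_set fc => y /conj_orbitP[g ->] /=; rewrite cJ.
Qed.

(** Induction on a list covering the support: subtracting the orbit of its head clears that head.
    Later entries of the same orbit then have coefficient 0 and are skipped. *)
Lemma class_function_span F c : class_function pi X c ->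
  exists L : seq (W1 * R),
    (forall p, p \in L -> X (pi p.1) /\ finite_set (conj_orbit p.1)) /\
    Zsum F c = \sum_(p <- L) p.2 *: \sum_(y \in conj_orbit p.1) F y.
Proof.
move=> cc; have [fc _ _] := cc.
have /finite_seqP[l lE] := fc.
have {lE} : forall w, c w != 0 -> w \in l.
  by move=> w; rewrite -/([set w | c w != 0] w) lE.
elim: l c cc {fc} => [|x l IH] c cc cl.
  exists [::]; split=> //; rewrite big_nil -[RHS](Zsum0 (R:=R) F).
  by apply: eq_Zsum => w; apply/eqP/negPn/negP => /cl.
have [cx0|cx] := eqVneq (c x) 0.
  by apply: IH => // w cw; have := cl w cw; rewrite inE => /orP[/eqP E|//]; rewrite E cx0 eqxx in cw.
have [Xx fx] := class_function_orbit cc cx.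
have [fi iX iJ] := orbit_indic_class Xx fx.
have [fc cX cJ] := cc.
pose c' w := c w - c x * orbit_indic x w.
have c'0 w : conj_orbit x w -> c' w = 0.
  by move=> xw; rewrite /c' orbit_indicE// mulr1; case/conj_orbitP: xw => g ->; rewrite cJ subrr.
have c'E w : ~ conj_orbit x w -> c' w = c w.
  by move=> xw; rewrite /c' orbit_indic0// mulr0 subr0.
have c's w : c' w != 0 -> c w != 0.
  by have [/c'0 ->|/c'E ->//] := pselect (conj_orbit x w); rewrite eqxx.
have [||L [LP LE]] := IH c'.
- split; first by apply: fsupp_sub fc _ => w /c's.
    by move=> w /c's; exact: cX.
  by move=> g w; rewrite /c' cJ iJ.
- move=> w c'w; have := cl w (c's w c'w); rewrite inE => /orP[/eqP E|//].
  by move: c'w; rewrite E (c'0 _ (conj_orbit_refl x)) eqxx.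
exists ((x, c x) :: L); split=> [p|]; first by rewrite inE => /orP[/eqP ->|/LP].
have fci : fsupp (fun w => c x * orbit_indic x w).
  by apply: fsupp_sub fi _ => w; apply: contraNneq => ->; rewrite mulr0.
rewrite big_cons -LE /= Zsum_orbit -ZsumZ// -ZsumD//; last by apply: fsupp_sub fc _ => w /c's.
by apply: eq_Zsum => w; rewrite /c' addrC subrK.
Qed.

Lemma orbit_sums_free e F (m : nat) (xs : 'I_m -> W1) (c : 'I_m -> R) : bernstein e F ->
  (forall i, finite_set (conj_orbit (xs i))) ->
  (forall i j, i != j -> conj_orbit (xs i) <> conj_orbit (xs j)) ->
  \sum_(i < m) c i *: (\sum_(y \in conj_orbit (xs i)) F y) = 0 ->
  forall i, c i = 0.
Proof.
move=> bF fx dx E0 i.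
pose f r w := \sum_(i <- r) c i * orbit_indic (xs i) w.
have ff r : fsupp (f r) /\ Zsum F (f r) = \sum_(i <- r) c i *: (\sum_(y \in conj_orbit (xs i)) F y).
  elim: r => [|j r [IHf IHE]].
    split; first by apply: fsupp_sub (finite_set0 _) _ => w; rewrite /f big_nil eqxx.
    by rewrite big_nil -[RHS](Zsum0 (R:=R) F); apply: eq_Zsum => w; rewrite /f big_nil.
  have fj : fsupp (fun w => c j * orbit_indic (xs j) w).
    apply: fsupp_sub (orbit_indic_fsupp (fx j)) _ => w.
    by apply: contraNneq => ->; rewrite mulr0.
  have E w : c j * orbit_indic (xs j) w + f r w = f (j :: r) w by rewrite /f big_cons.
  split; first by rewrite -(funext E); exact: fsuppD.
  rewrite big_cons -IHE Zsum_orbit -ZsumZ; last exact: orbit_indic_fsupp.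
  by rewrite -ZsumD//; apply: eq_Zsum => w.
have [ffm fE] := ff (index_enum 'I_m).
have := bern_free hd bF ffm; rewrite fE => /(_ E0 (xs i)).
rewrite /f (bigD1 i)//= big1 => [|j ji].
  by rewrite addr0 orbit_indicE ?mulr1//; exact: conj_orbit_refl.
rewrite orbit_indic0 ?mulr0// => xji; apply: (dx j i ji).
exact: conj_orbit_eq xji (conj_orbit_refl _).
Qed.

(** The left side is the unfolded form of [A_invariants]. Linear independence of the values of [F]
    turns invariance of the sum into conjugation invariance of its coefficients. *)
Lemma invariantsP e F (h : HA) : bernstein e F ->
  (exists c, [/\ finite_set [set x | c x != 0], [set x | c x != 0] `<=` [set x | X (pi x)],
     h = \sum_(x \in [set x | X (pi x)]) c x *: F x &
     forall g, \sum_(x \in [set x | X (pi x)]) c x *: F (g * x * g^-1)%g = h]) <->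
  exists2 c, class_function pi X c & h = Zsum F c.
Proof.
move=> bF.
have sumE c (G : W1 -> HA) : [set x | c x != 0] `<=` [set x | X (pi x)] ->
    \sum_(x \in [set x | X (pi x)]) c x *: G x = Zsum G c.
  move=> cX; rewrite fsum_mkcond; apply: eq_fsum => x; case: ifP => // /negbT.
  rewrite notin_setE => Nx; have [->|/cX//] := eqVneq (c x) 0; by rewrite scale0r.
have shift g c : Zsum (fun x => F (g * x * g^-1)%g) c = Zsum F (fun x => c (cnj g^-1%g x)).
  rewrite /Zsum [RHS](reindex_fsbigT (cnj g)) /=; last first.
    exact: (Bijective (cnjK g) (cnjVK g)).
  by apply: eq_fsum => x; rewrite cnjK.
have fcJ g c : fsupp c -> fsupp (fun x => c (cnj g x)).
  move=> fc; apply: (@fsupp_sub _ _ _ (cnj g^-1%g @` [set x | c x != 0])).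
    exact: finite_image.
  by move=> x cx; exists (cnj g x); rewrite ?cnjK.
split=> [[c [fc cX hE hJ]]|[c [fc cX cJ] ->]].
  exists c; last by rewrite hE sumE.
  split=> // g x; apply/eqP; rewrite -subr_eq0; apply/eqP.
  have := hJ g^-1%g; rewrite hE !sumE// shift invgK => E.
  have := bern_free hd bF (c := fun x => c (cnj g x) - c x).
  apply; last by rewrite ZsumB//; [rewrite E subrr|exact: fcJ].
  apply: fsuppD; first exact: fcJ.
  by apply: fsupp_sub fc _ => w; rewrite oppr_eq0.
exists c; split=> //; first by rewrite sumE.
by move=> g; rewrite sumE// shift; apply: eq_Zsum => x; rewrite cJ.
Qed.

End OrbitSums.

(** * Hyperplane arrangements *)

Section AffineForms.
Variables (K : realType) (n : nat).
Local Notation V := 'cV[K]_n.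
Implicit Types (a : 'rV[K]_n) (k : K) (p q u v : V).

Definition aff a k v : K := lform a v + k.

Lemma lformD a u v : lform a (u + v) = lform a u + lform a v.
Proof. by rewrite /lform mulmxDr mxE. Qed.

Lemma lformZ a t v : lform a (t *: v) = t * lform a v.
Proof. by rewrite /lform -scalemxAr mxE. Qed.

Lemma lformN a v : lform a (- v) = - lform a v.
Proof. by rewrite -scaleN1r lformZ mulN1r. Qed.

Lemma lformB a u v : lform a (u - v) = lform a u - lform a v.
Proof. by rewrite lformD lformN. Qed.

Lemma lform0 a : lform a 0 = 0.
Proof. by rewrite /lform mulmx0 mxE. Qed.

Lemma lformDl a a' v : lform (a + a') v = lform a v + lform a' v.
Proof. by rewrite /lform mulmxDl mxE. Qed.

Lemma lformZl t a v : lform (t *: a) v = t * lform a v.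
Proof. by rewrite /lform -scalemxAl mxE. Qed.

Lemma lformM a (M : 'M[K]_n) v : lform a (M *m v) = lform (a *m M) v.
Proof. by rewrite /lform mulmxA. Qed.

Lemma lform_sum a (m : nat) (v : 'I_m -> V) :
  lform a (\sum_(i < m) v i) = \sum_(i < m) lform a (v i).
Proof. by rewrite /lform mulmx_sumr summxE. Qed.

Lemma lform_neq0 a : a != 0 -> exists v, lform a v != 0.
Proof.
move=> a0; have [j aj] : exists j, a 0 j != 0.
  apply: contrapT => N; move/eqP: a0; apply; apply/rowP => j; rewrite mxE.
  by apply: contrapT => /eqP ?; apply: N; exists j.
exists (delta_mx j 0); rewrite /lform mxE (bigD1 j)//= big1 => [|i ij].
  by rewrite mxE !eqxx mulr1 addr0.
by rewrite mxE (negbTE ij) mulr0.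
Qed.

Lemma lform_inj a a' : (forall v, lform a v = lform a' v) -> a = a'.
Proof.
move=> E; apply/eqP; rewrite -subr_eq0; apply: contraT => /lform_neq0[v].
by rewrite lformDl -scaleN1r lformZl mulN1r E subrr eqxx.
Qed.

Lemma aff_line a k p q t :
  aff a k (p + t *: (q - p)) = aff a k p + t * (aff a k q - aff a k p).
Proof. by rewrite /aff lformD lformZ lformB; ring. Qed.

Lemma affDr a k p v : aff a k (p + v) = aff a k p + lform a v.
Proof. by rewrite /aff lformD addrAC. Qed.

Lemma affZ c a k v : aff (c *: a) (c * k) v = c * aff a k v.
Proof. by rewrite /aff lformZl mulrDr. Qed.

Lemma lform_continuous a : continuous (@lform K n a).
Proof.
have -> : @lform K n a = \sum_j (fun v => a 0 j * v j 0).
  by apply/funext => v; rewrite /lform mxE fct_sumE.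
apply: (big_ind (fun f : V -> K => continuous f)) => [v|f g cf cg v|j _ v].
- exact: (@cst_continuous V K 0).
- exact: (continuousD (cf v) (cg v)).
- by apply: continuousM; [exact: cst_continuous|exact: coord_continuous].
Qed.

Lemma aff_continuous a k : continuous (aff a k).
Proof.
by move=> v; apply: continuousD; [exact: lform_continuous|exact: cst_continuous].
Qed.

Lemma line_continuous p q : continuous (fun t : K => p + t *: (q - p)).
Proof.
move=> t; apply: (@cvgD _ _ _ _ _ (fun=> p) (fun t => t *: (q - p))).
  exact: cvg_cst.
by apply: cvgZ; [exact: cvg_id|exact: cvg_cst].
Qed.

Lemma nbhs_norm_intro p (e : K) (B : set V) : 0 < e ->
  (forall q, `|q - p| < e -> B q) -> nbhs p B.
Proof.
move=> e0 eB; have [_] := nbhs_normP p B; apply; exists e => // q qe; apply: eB.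
by rewrite distrC.
Qed.

Lemma nbhs_norm_elim p (B : set V) : nbhs p B ->
  exists2 e : K, 0 < e & forall q, `|q - p| < e -> B q.
Proof.
move=> pB; have [+ _] := nbhs_normP p B => /(_ pB)[e e0 eB].
by exists e => // q qe; apply: eB; rewrite /= distrC.
Qed.

Lemma hyp_exists a k : a != 0 -> exists v, hyp a k v.
Proof.
move=> /lform_neq0[v v0]; exists ((- k / lform a v) *: v).
by rewrite /hyp /= lformZ mulfVK// addNr.
Qed.

(** The kernel of [a] is contained in that of [a'], so the forms are proportional. This makes later
    sign conditions independent of the equation chosen for a hyperplane. *)
Lemma hyp_sub a k a' k' : a != 0 -> a' != 0 -> hyp a k `<=` hyp a' k' ->
  exists2 c, c != 0 & a' = c *: a /\ k' = c * k.
Proof.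
move=> a0 a'0 sub; have [y y0] := lform_neq0 a0; have [v hv] := hyp_exists k a0.
have ker u : lform a u = 0 -> lform a' u = 0.
  move=> u0; have hvu : hyp a k (v + u) by rewrite /hyp /= lformD u0 addr0.
  have := sub _ hvu; have := sub _ hv; rewrite /hyp /= lformD => E1 E2.
  by move: E2; rewrite addrAC E1 add0r.
pose c := lform a' y / lform a y.
have E : a' = c *: a.
  apply: lform_inj => u; rewrite lformZl.
  have : lform a (u - (lform a u / lform a y) *: y) = 0.
    by rewrite lformB lformZ mulfVK// subrr.
  move=> /ker; rewrite lformB lformZ => /eqP; rewrite subr_eq0 => /eqP ->.
  by rewrite /c; ring.
exists c; first by apply: contra a'0 => /eqP c0; rewrite E c0 scale0r.
split=> //; have := sub _ hv; move: hv; rewrite /hyp /= E lformZl => hv.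
move=> /eqP; rewrite addr_eq0 => /eqP/(congr1 -%R); rewrite opprK => <-.
by move/eqP: hv; rewrite addr_eq0 => /eqP ->; ring.
Qed.

Lemma avoid_finite (s : seq K) (d : K) : 0 < d -> exists e, [/\ 0 < e, e < d & e \notin s].
Proof.
elim: s d => [|x s IH] d d0.
  by exists (d / 2); split=> //; [rewrite divr_gt0|rewrite ltr_pdivrMr// mulr_natr mulr2n ltrDl].
have [x0|x0] := ltP 0 x.
  have [|e [e0 ed es]] := IH (Num.min d x); first by rewrite lt_min d0.
  move: ed; rewrite lt_min => /andP[ed ex]; exists e; split=> //.
  by rewrite inE negb_or es andbT lt_eqF.
have [e [e0 ed es]] := IH d d0; exists e; split=> //.
by rewrite inE negb_or es andbT gt_eqF// (le_lt_trans x0).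
Qed.

(** Perturb a vector that suits the tail in a direction on which the head is nonzero; each form
    excludes at most one size of the perturbation. *)
Lemma generic_vector (s : seq 'rV[K]_n) : (forall a, a \in s -> a != 0) ->
  exists v, forall a, a \in s -> lform a v != 0.
Proof.
elim: s => [|a s IH] s0; first by exists 0.
have [|v vs] := IH; first by move=> a' a's; apply: s0; rewrite inE a's orbT.
have [w w0] : exists w, lform a w != 0 by apply/lform_neq0/s0; rewrite inE eqxx.
have [e [e0 _ es]] :=
  avoid_finite [seq - lform a' v / lform a' w | a' <- a :: s] (@ltr01 K).
exists (v + e *: w) => a' a's; rewrite lformD lformZ.
have [a'w|a'w] := eqVneq (lform a' w) 0.
  rewrite a'w mulr0 addr0; move: a's; rewrite inE => /orP[/eqP E|]; last exact: vs.
  by move: w0; rewrite -E a'w eqxx.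
apply: contra es => /eqP E; apply/mapP; exists a' => //.
by apply: (mulIf a'w); rewrite mulfVK//; apply/eqP; rewrite -addr_eq0 addrC E.
Qed.

End AffineForms.

Lemma opp_signs (K : realDomainType) (x y z : K) : x != 0 -> y != 0 -> z != 0 ->
  (x * z < 0) = (x * y < 0) (+) (y * z < 0).
Proof.
move=> x0 y0 z0.
have S (u v : K) : u != 0 -> v != 0 -> (u * v < 0) = (u < 0) (+) (v < 0).
  move=> u0 v0; case: (ltgtP u 0) u0 => // u0 _; case: (ltgtP v 0) v0 => // v0 _ /=.
  - by apply: le_gtF; apply: mulr_le0; exact: ltW.
  - by rewrite nmulr_rlt0.
  - by rewrite pmulr_rlt0.
  - by apply: le_gtF; apply: mulr_ge0; exact: ltW.
by rewrite !S//; case: (x < 0); case: (y < 0); case: (z < 0).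
Qed.

Lemma seq_argmin (T : eqType) (K : realDomainType) (f : T -> K) (s : seq T) x :
  x \in s -> exists2 y, y \in s & forall z, z \in s -> f y <= f z.
Proof.
elim: s x => // x s IH _ _; case: s IH => [_|y s IH].
  by exists x; [rewrite inE|move=> z; rewrite inE => /eqP ->].
have [|w ws wmin] := IH y; first by rewrite inE eqxx.
have [xw|wx] := leP (f x) (f w).
  exists x => [|z]; first by rewrite inE eqxx.
  by rewrite inE => /orP[/eqP ->//|/wmin]; exact: le_trans.
exists w => [|z]; first by rewrite inE ws orbT.
by rewrite inE => /orP[/eqP ->|/wmin//]; exact: ltW.
Qed.

(** * Locally finite arrangements: sides, chambers and walls *)

Section Arrangement.
Variables (K : realType) (n : nat) (hs : set (set 'cV[K]_n)).
Local Notation V := 'cV[K]_n.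
Implicit Types (a : 'rV[K]_n) (k : K) (p q u v : V).
Hypothesis hsH : forall H, hs H -> is_hyperplane H.
Hypothesis hsF : locally_finite hs.

Definition regular p := forall a k, hs (hyp a k) -> aff a k p != 0.

Definition same_side p q := forall a k, hs (hyp a k) -> 0 < aff a k p * aff a k q.

Lemma hs_neq0 a k : hs (hyp a k) -> a != 0.
Proof.
move=> /hsH[a' [k' [a'0 E]]]; apply/eqP => a0; rewrite a0 in E => {a0}.
have [v v'] := lform_neq0 a'0; have [u hu] := hyp_exists k' a'0.
have : hyp 0 k u by rewrite E.
rewrite /hyp /= /lform mul0mx mxE add0r => k0.
have : hyp a' k' (u + v) by rewrite -E /hyp /= /lform mul0mx mxE add0r.
by move: hu; rewrite /hyp /= lformD addrAC => -> /eqP; rewrite add0r (negbTE v').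
Qed.

Lemma hs_form H : hs H -> exists a k, H = hyp a k.
Proof. by move=> /hsH[a [k [_ ->]]]; exists a, k. Qed.

Lemma hyp_rep a k a' k' : hs (hyp a k) -> hyp a k = hyp a' k' ->
  exists2 c, c != 0 & forall v, aff a' k' v = c * aff a k v.
Proof.
move=> h E; have h' : hs (hyp a' k') by rewrite -E.
have [|c c0 [-> ->]] := hyp_sub (hs_neq0 h) (hs_neq0 h') (k:=k) (k':=k').
  by rewrite E.
by exists c => // v; rewrite affZ.
Qed.

Lemma segment_zero (x y : K) : x * y < 0 -> 0 < x / (x - y) < 1 /\
  x + (x / (x - y)) * (y - x) = 0.
Proof.
move=> xy.
have N : x - y != 0.
  by apply: contraTneq xy => /eqP; rewrite subr_eq0 => /eqP ->; rewrite -leNgt sqr_ge0.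
split; last by field.
have [x0|x0|x0] := ltgtP x 0; last by rewrite x0 mul0r ltxx in xy.
  have y0 : 0 < y by move: xy; rewrite nmulr_rlt0.
  have xy0 : x - y < 0 by lra.
  by rewrite -mulrNN -invrN divr_gt0 ?oppr_gt0//= ltr_pdivrMr ?oppr_gt0// mul1r; lra.
have y0 : y < 0 by move: xy; rewrite pmulr_rlt0.
have xy0 : 0 < x - y by lra.
by rewrite divr_gt0//= ltr_pdivrMr// mul1r; lra.
Qed.

Lemma convex_zero (x y t : K) : 0 <= t -> t <= 1 -> x + t * (y - x) = 0 -> x * y <= 0.
Proof.
move=> t0 t1 E; have [t_0|tN] := eqVneq t 0.
  by move: E; rewrite t_0 mul0r addr0 => ->; rewrite mul0r.
have {}t0 : 0 < t by rewrite lt_def tN.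
rewrite -(pmulr_rle0 _ t0) (_ : t * _ = - (1 - t) * x ^+ 2).
  by rewrite mulNr oppr_le0 mulr_ge0 ?subr_ge0 ?sqr_ge0.
have -> : t * (x * y) = x * (x + t * (y - x)) - (1 - t) * x ^+ 2 by ring.
by rewrite E; ring.
Qed.

Lemma near_aff a k p : aff a k p != 0 -> \forall q \near p, aff a k q != 0.
Proof.
move=> p0; apply: (@aff_continuous K n a k p [set x | x != 0]).
by apply: open_nbhs_nbhs; split=> //; exact: open_neq.
Qed.

Lemma locally_through p : exists2 e : K, 0 < e & forall q, `|q - p| < e ->
  forall a k, hs (hyp a k) -> aff a k q = 0 -> aff a k p = 0.
Proof.
have [U Up finU] := hsF p.
pose A := [set H | hs H /\ H `&` U !=set0].
have AP : nbhs p (\bigcap_(H in [set` fset_set A]) [set q | H q -> H p]).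
  apply: (filter_bigI (nbhs_filter p)) => H; rewrite in_fset_set// inE => -[hH _].
  have [a [k E]] := hs_form hH; rewrite E.
  have [p0|p0] := eqVneq (aff a k p) 0; first by apply: (filterS _ filterT) => q _.
  by apply: filterS (near_aff p0) => q /negP q0 /eqP.
have : \forall q \near p, U q /\ forall H, A H -> H q -> H p.
  apply: filterS (filterI Up AP) => q [Uq {}AP]; split=> // H AH; apply: AP => /=.
  by rewrite in_fset_set// inE.
move=> /nbhs_norm_elim[e e0 eP]; exists e => // q /eP[Uq HA] a k h q0.
by apply: (HA (hyp a k)) => //; split=> //; exists q.
Qed.

(** A change of sign would put a zero on the segment from [p] to [q], hence near [p], against
    [locally_through]. *)
Lemma locally_same p : exists2 e : K, 0 < e & forall q, `|q - p| < e ->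
  forall a k, hs (hyp a k) -> aff a k p != 0 -> 0 < aff a k p * aff a k q.
Proof.
have [e e0 eP] := locally_through p; exists e => // q qe a k h p0.
rewrite ltNge le_eqVlt; apply/negP => /orP[/eqP pq0|pq0].
  move: pq0 => /eqP; rewrite mulf_eq0 (negbTE p0) /= => /eqP q0.
  by rewrite (eP q qe a k h q0) eqxx in p0.
have [/andP[t0 t1] tE] := segment_zero pq0.
set t := _ / _ in t0 t1 tE; move: tE; rewrite -aff_line => E.
have := eP (p + t *: (q - p)) _ a k h E.
rewrite addrAC subrr add0r normrZ gtr0_norm// => H.
by move/eqP: p0; apply; apply: H; rewrite (le_lt_trans _ qe)// ler_piMl// ltW.
Qed.

(** Local finiteness at each point of the segment, then compactness of the parameter interval. *)
Lemma finite_segment p q : finite_set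
  [set H | hs H /\ exists2 t : K, 0 <= t <= 1 & H (p + t *: (q - p))].
Proof.
pose g (t : K) := p + t *: (q - p).
have /choice[U UP] (t : K) : exists U : set K, [/\ open U, U t &
    finite_set [set H | hs H /\ exists2 t, U t & H (g t)]].
  have [U Ug finU] := hsF (g t).
  have : nbhs t (g @^-1` U) by exact: line_continuous.
  rewrite nbhsE => -[B [Bo Bt] BU]; exists B; split=> //.
  apply: sub_finite_set finU => H [hH [t' Bt' Ht']]; split=> //.
  by exists (g t'); split=> //; exact: BU.
have := @segment_compact K 0 1; rewrite compact_cover => /(_ _ setT U).
case=> [t _|t _|D _ DP]; first by have [] := UP t.
  by exists t => //; have [] := UP t.
apply: (@sub_finite_set _ _ (\bigcup_(t in [set` D]) [set H | hs H /\ exists2 t', U t t' & H (g t')])).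
  move=> H [hH [t t01 Ht]]; have [|t' Dt' Ut'] := DP t; first by rewrite /= in_itv.
  by exists t' => //; split=> //; exists t.
by apply: bigcup_finite => // t _; have [] := UP t.
Qed.

Lemma finite_separating p q : finite_set
  [set H | hs H /\ exists a k, H = hyp a k /\ aff a k p * aff a k q < 0].
Proof.
apply: sub_finite_set (finite_segment p q) => H [hH [a [k [E pq]]]]; split=> //.
have [/andP[t0 t1] tE] := segment_zero pq.
exists (aff a k p / (aff a k p - aff a k q)); first by rewrite !ltW.
by rewrite E /hyp /= -/(aff _ _ _) aff_line.
Qed.

Lemma same_sideC p q : same_side p q -> same_side q p.
Proof. by move=> pq a k h; rewrite mulrC pq. Qed.

Lemma same_side_trans p q r : same_side p q -> same_side q r -> same_side p r.
Proof.
move=> pq qr a k h; have x := pq a k h; have y := qr a k h.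
have q2 : 0 < aff a k q ^+ 2.
  by rewrite exprn_even_gt0//=; apply: contraTneq x => ->; rewrite mulr0 ltxx.
rewrite -(pmulr_rgt0 _ q2); have := mulr_gt0 x y.
by congr (0 < _); ring.
Qed.

Lemma same_side_regular p q : same_side p q -> regular p.
Proof. by move=> pq a k /pq; apply: contraTneq => ->; rewrite mul0r ltxx. Qed.

Lemma regularP p : ~ (\bigcup_(H in hs) H) p <-> regular p.
Proof.
split=> [N a k h|rp [H hH Hp]].
  by apply/eqP => p0; apply: N; exists (hyp a k).
have [a [k E]] := hs_form hH; rewrite E in hH Hp.
by have := rp _ _ hH; rewrite /aff Hp eqxx.
Qed.

Lemma chamberP C c : is_chamber hs C -> C c ->
  regular c /\ forall q, C q <-> same_side c q.
Proof.
move=> [v [_ EC]] Cc.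
have rc : regular c by apply/regularP; move: Cc; rewrite EC => /connected_component_sub.
have CE : C = connected_component (~` \bigcup_(H in hs) H) c.
  by rewrite EC; apply: same_connected_component; rewrite -EC.
split=> // q; split=> [Cq a k h|cq].
  have cC : connected C by rewrite EC; exact: component_connected.
  have cI : connected (aff a k @` C).
    apply: connected_continuous_connected => //.
    by apply: continuous_subspaceT; exact: aff_continuous.
  move/connected_intervalP : cI => cI.
  have N r : C r -> aff a k r != 0.
    rewrite CE => /connected_component_sub/regularP; exact.
  rewrite ltNge; apply/negP => cq.
  suff : (aff a k @` C) 0 by move=> [r Cr r0]; have := N _ Cr; rewrite r0 eqxx.
  have [c0|c0] := ltP 0 (aff a k c).
    apply: (cI (aff a k q) (aff a k c)); [by exists q|by exists c|].
    by rewrite (ltW c0) andbT -(pmulr_rle0 _ c0).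
  have {}c0 : aff a k c < 0 by rewrite lt_neqAle c0 N.
  apply: (cI (aff a k c) (aff a k q)); [by exists c|by exists q|].
  by rewrite (ltW c0) /= -(nmulr_rle0 _ c0).
rewrite CE; pose g (t : K) := c + t *: (q - c).
exists (g @` `[0, 1]); last first.
  by exists 1; rewrite /= ?in_itv /= ?ler01 ?lexx// /g scale1r addrC subrK.
split.
- by exists 0; rewrite /= ?in_itv /= ?ler01 ?lexx// /g scale0r addr0.
- move=> z [t /=]; rewrite in_itv /= => /andP[t0 t1] <-; apply/regularP => a k h.
  rewrite aff_line; apply/eqP => E; have := cq a k h.
  by apply/negP; rewrite -leNgt; exact: convex_zero E.
- apply: connected_continuous_connected; first exact: segment_connected.
  by apply: continuous_subspaceT; exact: line_continuous.
Qed.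

Lemma chamber_nonempty C : is_chamber hs C -> exists c, C c.
Proof. by move=> [v [Nv ->]]; exists v; apply: connected_component_refl. Qed.

(* A generic path from [p] towards the chamber of [q] crosses the separating
   hyperplanes one at a time, which singles out a first one. *)
Lemma first_crossing p q : regular p -> regular q -> ~ same_side p q ->
  exists q' a k (t : K), [/\ same_side q q', hs (hyp a k), 0 < t < 1,
    aff a k (p + t *: (q' - p)) = 0 &
    forall a' k', hs (hyp a' k') -> hyp a' k' <> hyp a k ->
      0 < aff a' k' p * aff a' k' (p + t *: (q' - p))].
Proof.
move=> rp rq Npq.
pose Sep := [set H | hs H /\ exists a k, H = hyp a k /\ aff a k p * aff a k q < 0].
pose A := fset_set Sep.
have AE H : (H \in A) <-> Sep H by rewrite in_fset_set ?inE//; exact: finite_separating.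
have /choice[rep repP] (H : set V) : exists f : 'rV[K]_n * K, hs H -> H = hyp f.1 f.2.
  have [hH|NH] := pselect (hs H); last by exists (0, 0).
  by have [a [k E]] := hs_form hH; exists (a, k).
pose f H v := aff (rep H).1 (rep H).2 v.
have fS H : H \in A -> [/\ hs H, hs (hyp (rep H).1 (rep H).2) & f H p * f H q < 0].
  move=> /AE[hH [a [k [E pq]]]]; split=> //; first by rewrite -repP.
  have hE : hs (hyp a k) by rewrite -E.
  have [|c c0 cE] := hyp_rep hE (a' := (rep H).1) (k' := (rep H).2).
    by rewrite -E; exact: repP.
  by rewrite /f !cE mulrACA -expr2 pmulr_rlt0// exprn_even_gt0.
have [H0 H0A] : exists H, H \in A.
  apply: contrapT => NA; apply: Npq => a k h.
  rewrite lt_def mulf_neq0 ?rp ?rq//= leNgt; apply/negP => pq.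
  by apply: NA; exists (hyp a k); apply/AE; split=> //; exists a, k.
(* [H] and [H'] are crossed simultaneously on the way to q' iff f H p * f H' q' = f H' p * f H q'.
   The form [g H H'] is the variation of this condition as q' moves. *)
pose g H H' := f H p *: (rep H').1 - f H' p *: (rep H).1.
have gE H H' v : lform (g H H') v = f H p * lform (rep H').1 v - f H' p * lform (rep H).1 v.
  by rewrite /g lformDl -scaleNr !lformZl mulNr.
have fp0 H : H \in A -> f H p != 0.
  by move=> /fS[_ _]; apply: contraTneq => ->; rewrite mul0r ltxx.
have g0 H H' : H \in A -> H' \in A -> H != H' -> g H H' != 0.
  move=> HA HA'; apply: contraNneq => gz.
  have [hH hH2 _] := fS _ HA; have [hH' hH'2 _] := fS _ HA'.
  rewrite (repP _ hH) (repP _ hH').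
  have E v : f H p * f H' v = f H' p * f H v.
    have := gE H H' (v - p); rewrite gz /lform mul0mx mxE -!/(lform _ _) !lformB => E.
    by move: E; rewrite /f /aff => E; lra.
  apply/eqP/seteqP; split=> v; rewrite /hyp /= -!/(aff _ _ v) -/(f _ v) => v0.
    have := E v; rewrite -/(f H v) in v0; rewrite v0 mulr0 => /eqP.
    by rewrite mulf_eq0 (negbTE (fp0 _ HA)) => /eqP.
  have := E v; rewrite -/(f H' v) in v0; rewrite v0 mulr0 => /esym/eqP.
  by rewrite mulf_eq0 (negbTE (fp0 _ HA')) => /eqP.
have [u uP] : exists u, forall H H', H \in A -> H' \in A -> H != H' -> lform (g H H') u != 0.
  have [|u uP] := @generic_vector K n
    [seq g HH.1 HH.2 | HH <- [seq (H, H') | H <- A, H' <- A] & HH.1 != HH.2].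
    move=> x /mapP[[H H']]; rewrite mem_filter => /andP[/= HN] /allpairsP[[G G'] /= [GA G'A [EH EH']]] ->.
    by rewrite EH EH' in HN *; exact: g0.
  exists u => H H' HA HA' HN; apply: uP; apply/mapP; exists (H, H') => //.
  by rewrite mem_filter /= HN; apply/allpairsP; exists (H, H').
have [e e0 eP] := locally_same q.
have d0 : 0 < e / (`|u| + 1) by rewrite divr_gt0// ltr_wpDl.
pose D0 H H' := f H p * f H' q - f H' p * f H q.
have [x [x0 xd xs]] := avoid_finite
  [seq - D0 HH.1 HH.2 / lform (g HH.1 HH.2) u | HH <- [seq (H, H') | H <- A, H' <- A]] d0.
pose q' := q + x *: u.
have qq' : same_side q q'.
  move=> a k h; apply: eP => //; last exact: rq.
  rewrite /q' addrAC subrr add0r normrZ gtr0_norm//.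
  move: xd; rewrite ltr_pdivlMr ?ltr_wpDl//; apply: le_lt_trans.
  by rewrite ler_pM2l// lerDl.
have fpq' H : H \in A -> f H p * f H q' < 0.
  move=> /fS[hH hH2 pq]; have := qq' _ _ hH2; rewrite -!/(aff _ _ _) -!/(f _ _).
  move: pq; rewrite -/(f H p) -/(f H q) => pq qq.
  have q2 : 0 < f H q ^+ 2.
    by rewrite exprn_even_gt0//=; apply: contraTneq qq => ->; rewrite mul0r ltxx.
  rewrite -(pmulr_rlt0 _ q2)
    (_ : f H q ^+ 2 * _ = f H p * f H q * (f H q * f H q')); last by ring.
  by rewrite pmulr_llt0.
have GN H H' : H \in A -> H' \in A -> H != H' -> f H p * f H' q' != f H' p * f H q'.
  move=> HA HA' HN; apply: contra xs => /eqP E; apply/mapP; exists (H, H').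
    by apply/allpairsP; exists (H, H').
  apply: (mulIf (uP _ _ HA HA' HN)); rewrite mulfVK ?uP//= gE.
  by move: E; rewrite /f /q' !affDr !lformZ -!/(f _ _) /D0 => E; lra.
pose tm H := f H p / (f H p - f H q').
have [H1 H1A H1min] : exists2 H1, H1 \in A & forall H, H \in A -> tm H1 <= tm H.
  by have [H1 H1A H1min] := seq_argmin tm H0A; exists H1.
have [hH1' hH1 _] := fS _ H1A.
have [t01 tE] := segment_zero (fpq' _ H1A).
exists q', (rep H1).1, (rep H1).2, (tm H1); split=> //.
  by rewrite aff_line.
move=> a k h hN; rewrite aff_line.
have pq0 : aff a k p * aff a k q' != 0.
  by rewrite mulf_neq0 ?rp//; exact: same_side_regular (same_sideC qq') _ _ h.
(* A hyperplane that does not separate the endpoints misses the whole segment; a separating one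
   other than [H1] is crossed strictly later, because ties were excluded. *)
have [pq|pq] := ltP 0 (aff a k p * aff a k q').
  have /andP[t0 t1] := t01; rewrite ltNge le_eqVlt; apply/negP => /orP[/eqP E|N].
    have p0 := rp _ _ h; move/eqP: E; rewrite mulf_eq0 (negbTE p0) /= => /eqP E.
    by have := convex_zero (ltW t0) (ltW t1) E; rewrite leNgt pq.
  have [/andP[s0 s1]] := segment_zero N; set s := _ / _ in s0 s1 * => E.
  have E' : aff a k p + s * tm H1 * (aff a k q' - aff a k p) = 0.
    by rewrite -[RHS]E; ring.
  have st0 : 0 <= s * tm H1 by rewrite mulr_ge0// ltW.
  have st1 : s * tm H1 <= 1 by rewrite mulr_ile1// ltW.
  by have := convex_zero st0 st1 E'; rewrite leNgt pq.
have {}pq : aff a k p * aff a k q' < 0 by rewrite lt_neqAle pq0.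
pose H := hyp a k; have HA : H \in A.
  apply/AE; split=> //; exists a, k; split=> //.
  have := qq' _ _ h; move: pq; move: (aff a k p) (aff a k q) (aff a k q') => y z w yw zw.
  have w2 : 0 < w ^+ 2.
    by rewrite exprn_even_gt0//=; apply: contraTneq zw => ->; rewrite mulr0 ltxx.
  by rewrite -(pmulr_rlt0 _ w2) (_ : w ^+ 2 * _ = y * w * (z * w)); [rewrite pmulr_llt0|ring].
have [_ hH2 _] := fS _ HA; have HN : H1 != H.
  by apply/eqP => E; apply: hN; rewrite -(repP _ hH1') E.
have lt_t : tm H1 < tm H.
  rewrite lt_neqAle H1min// andbT; apply: contra (GN _ _ H1A HA HN) => /eqP.
  rewrite /tm; have N G : G \in A -> f G p - f G q' != 0.
    move=> /fpq'; apply: contraTneq => /eqP; rewrite subr_eq0 => /eqP ->.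
    by rewrite -leNgt sqr_ge0.
  move=> /(congr1 (fun z => z * (f H1 p - f H1 q') * (f H p - f H q'))).
  rewrite mulfVK ?N// [in RHS]mulrAC mulfVK ?N// => E.
  by apply/eqP; move: E; lra.
have [|c c0 cE] := hyp_rep h (a' := (rep H).1) (k' := (rep H).2); first by rewrite -repP.
have [c2 tH] : 0 < c ^+ 2 /\ f H p + tm H * (f H q' - f H p) = 0.
  by split; [rewrite exprn_even_gt0|have [] := segment_zero (fpq' _ HA)].
have tHE : aff a k p + tm H * (aff a k q' - aff a k p) = 0.
  by apply: (mulfI c0); rewrite mulr0 -[RHS]tH /f !cE; ring.
have /andP[t0 _] := t01; have t0' := lt_trans t0 lt_t.
rewrite -(pmulr_rgt0 _ t0').
rewrite (_ : tm H * _ = (tm H - tm H1) * aff a k p ^+ 2); last first.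
  have -> : tm H * (aff a k p * (aff a k p + tm H1 * (aff a k q' - aff a k p))) =
    tm H1 * aff a k p * (aff a k p + tm H * (aff a k q' - aff a k p)) +
    (tm H - tm H1) * aff a k p ^+ 2 by ring.
  by rewrite tHE mulr0 add0r.
by rewrite mulr_gt0 ?subr_gt0// exprn_even_gt0//= rp.
Qed.

Lemma first_wall C p r a k : is_chamber hs C -> C p -> hs (hyp a k) -> aff a k r = 0 ->
  (forall a' k', hs (hyp a' k') -> hyp a' k' <> hyp a k -> 0 < aff a' k' p * aff a' k' r) ->
  is_wall hs C (hyp a k).
Proof.
move=> hC Cp h r0 other; have [rp CE] := chamberP hC Cp.
have [e e0 eP] := locally_same r.
split=> //; exists r => //; exists [set q | `|q - r| < e].
  by apply: (nbhs_norm_intro e0).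
move=> s [s0 /= se] B /nbhs_norm_elim[d d0 dB].
pose m := Num.min (e - `|s - r|) d.
have m0 : 0 < m by rewrite lt_min subr_gt0 se d0.
have N0 : 0 < `|p - r| + 1 by rewrite ltr_wpDl.
pose x := m / (`|p - r| + 1) / 2.
have x0 : 0 < x by rewrite !divr_gt0.
have xm : x * `|p - r| < m.
  apply: (@le_lt_trans _ _ (m / 2)); last by rewrite ltr_pdivrMr// mulr_natr mulr2n ltrDl.
  rewrite /x mulrAC ler_pM2r ?invr_gt0// mulrAC ler_pdivrMr// ler_pM2l//.
  by rewrite lerDl.
exists (s + x *: (p - r)); split; last first.
  apply: dB; rewrite addrAC subrr add0r normrZ gtr0_norm//.
  by apply: (lt_le_trans xm); rewrite ge_min lexx orbT.
apply/CE => a' k' h'.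
have [E|N] := pselect (hyp a' k' = hyp a k).
  have [c c0 cE] := hyp_rep h (esym E).
  rewrite !cE affDr lformZ lformB (_ : aff a k s = 0)// add0r.
  have -> : lform a p - lform a r = aff a k p - aff a k r by rewrite /aff; ring.
  rewrite r0 subr0 (_ : _ * _ = x * (c * aff a k p) ^+ 2); last by ring.
  by rewrite mulr_gt0// exprn_even_gt0//= mulf_neq0// rp.
have pr := other _ _ h' N.
have rr : aff a' k' r != 0 by apply: contraTneq pr => ->; rewrite mulr0 ltxx.
have rs : 0 < aff a' k' r * aff a' k' (s + x *: (p - r)).
  apply: eP => //; rewrite addrAC (le_lt_trans (ler_normD _ _))// normrZ gtr0_norm//.
  by rewrite -ltrBrDl (lt_le_trans xm)// ge_min lexx.
have r2 : 0 < aff a' k' r ^+ 2 by rewrite exprn_even_gt0.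
by rewrite -(pmulr_rgt0 _ r2); have := mulr_gt0 pr rs; congr (0 < _); ring.
Qed.

(** A point of [C] close to [r] has the sign of [r], by [locally_same], and that of [p], since both
    lie in [C]. *)
Lemma closure_side C p r a k : is_chamber hs C -> C p -> closure C r -> hs (hyp a k) ->
  aff a k r != 0 -> 0 < aff a k p * aff a k r.
Proof.
move=> hC Cp Cr h r0; have [rp CE] := chamberP hC Cp.
have [e e0 eP] := locally_same r.
have [q [/CE pq /= qe]] : C `&` [set q | `|q - r| < e] !=set0.
  by apply: Cr; apply: (nbhs_norm_intro e0).
have rq := eP q qe _ _ h r0; have {}pq := pq _ _ h.
have q2 : 0 < aff a k q ^+ 2.
  by rewrite exprn_even_gt0//=; apply: contraTneq rq => ->; rewrite mulr0 ltxx.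
by rewrite -(pmulr_rgt0 _ q2); have := mulr_gt0 pq rq; congr (0 < _); ring.
Qed.

Lemma wall_point C a k : is_wall hs C (hyp a k) -> exists2 r, aff a k r = 0 & closure C r.
Proof.
move=> [_ [v vH [U Uv UC]]]; exists v => //; apply: UC; split=> //.
exact: nbhs_singleton Uv.
Qed.

Lemma wall_generic_point C a k a' k' : is_wall hs C (hyp a k) ->
  hs (hyp a' k') -> hyp a' k' <> hyp a k ->
  exists r, [/\ aff a k r = 0, closure C r & aff a' k' r != 0].
Proof.
move=> [h [v vH [U Uv UC]]] h' N.
suff [r [r0 Ur r'0]] : exists r, [/\ aff a k r = 0, U r & aff a' k' r != 0].
  by exists r; split=> //; apply: UC.
have [v0|v'0] := eqVneq (aff a' k' v) 0; last first.
  by exists v; split=> //; exact: nbhs_singleton Uv.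
have [u [u0 u'0]] : exists u, lform a u = 0 /\ lform a' u != 0.
  apply: contrapT => NN; apply: N.
  have sub : hyp a k `<=` hyp a' k'.
    move=> w wH; have E : lform a' (w - v) = 0.
      apply/eqP/contraT => E; exfalso; apply: NN; exists (w - v); split=> //.
      by move: wH vH; rewrite /hyp /= lformB => ? ?; lra.
    by move: v0 E; rewrite /hyp /aff /= lformB => ? ?; lra.
  have [c c0 [-> ->]] := hyp_sub (hs_neq0 h) (hs_neq0 h') sub.
  apply/seteqP; split=> w; rewrite /hyp /= -!/(aff _ _ w) affZ; last by move=> ->; rewrite mulr0.
  by move=> /eqP; rewrite mulf_eq0 (negbTE c0) => /eqP.
have [e e0 eU] := nbhs_norm_elim Uv.
pose x := e / (`|u| + 1) / 2.
have N0 : 0 < `|u| + 1 by rewrite ltr_wpDl.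
have x0 : 0 < x by rewrite !divr_gt0.
exists (v + x *: u); split.
- by rewrite affDr lformZ u0 mulr0 addr0.
- apply: eU; rewrite addrAC subrr add0r normrZ gtr0_norm//.
  apply: (@le_lt_trans _ _ (e / 2)); last by rewrite ltr_pdivrMr// mulr_natr mulr2n ltrDl.
  rewrite /x mulrAC ler_pM2r ?invr_gt0// mulrAC ler_pdivrMr// ler_pM2l//.
  by rewrite lerDl.
- by rewrite affDr v0 add0r lformZ mulf_neq0// gt_eqF.
Qed.

End Arrangement.

(** * Affine extended Coxeter groups *)

Section CoxeterGeometry.
Variables (K : realType) (n : nat) (W : groupType) (rho : W -> 'M[K]_n * 'cV[K]_n).
Variables (hs : set (set 'cV[K]_n)) (C0 : set 'cV[K]_n) (sH : set 'cV[K]_n -> W).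
Local Notation V := 'cV[K]_n.
Hypothesis acx : affine_ext_coxeter rho hs C0 sH.
Variable c0 : V.
Hypothesis C0c0 : C0 c0.
Implicit Types (a : 'rV[K]_n) (k : K) (p q u v d : V) (w g t s x : W).
Local Notation act := (act rho).
Local Notation S := (Sgen hs C0 sH).
Local Notation X := (Xtr rho).

Let hsH : forall H, hs H -> is_hyperplane H.
Proof. by case: acx => _ []. Qed.

Let hsF : locally_finite hs.
Proof. by case: acx => _ [_ []]. Qed.

Let hC0 : is_chamber hs C0.
Proof. by case: acx => _ [_ [_ []]]. Qed.

Lemma rho1 : rho 1%g = (1%:M, 0).
Proof. by case: acx => -[]. Qed.

Lemma rhoM w w' : rho (w * w')%g =
  ((rho w).1 *m (rho w').1, (rho w).1 *m (rho w').2 + (rho w).2).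
Proof. by case: acx => -[]. Qed.

Lemma act_hs w H : hs H -> hs (act w @` H).
Proof. by case: acx => _ [_ [_ [_ [+ _]]]]; apply. Qed.

Lemma sH_refl H : hs H -> is_reflection_fixing (act (sH H)) H.
Proof. by case: acx => _ [_ [_ [_ [_ [+ _]]]]]; apply. Qed.

Lemma sH_conj w H : hs H -> sH (act w @` H) = cnj w (sH H).
Proof. by case: acx => _ [_ [_ [_ [_ [_ [_ [_ [_ [+ _]]]]]]]]]; apply. Qed.

Lemma actM w w' v : act (w * w')%g v = act w (act w' v).
Proof. by rewrite /Defs.act /aff_app rhoM /= mulmxDr mulmxA addrA. Qed.

Lemma act1 v : act 1%g v = v.
Proof. by rewrite /Defs.act /aff_app rho1 /= mul1mx addr0. Qed.

Lemma actK w : cancel (act w) (act w^-1%g).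
Proof. by move=> v; rewrite -actM mulVg act1. Qed.

Lemma actVK w : cancel (act w^-1%g) (act w).
Proof. by move=> v; rewrite -actM mulgV act1. Qed.

Lemma linM w w' : (rho (w * w')%g).1 = (rho w).1 *m (rho w').1.
Proof. by rewrite rhoM. Qed.

Lemma linV w : (rho w).1 *m (rho w^-1%g).1 = 1%:M.
Proof. by rewrite -linM mulgV rho1. Qed.

Lemma actD w u v : act w (u + v) = act w u + (rho w).1 *m v.
Proof. by rewrite /Defs.act /aff_app mulmxDr addrAC. Qed.

Definition pushl w a : 'rV[K]_n := a *m (rho w^-1%g).1.
Definition pushk w a k : K := lform a (rho w^-1%g).2 + k.

Lemma aff_push w a k v : aff (pushl w a) (pushk w a k) v = aff a k (act w^-1%g v).
Proof.
by rewrite /aff /pushl /pushk /Defs.act /aff_app lformD lformM addrA.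
Qed.

Lemma aff_pushK w a k v : aff (pushl w a) (pushk w a k) (act w v) = aff a k v.
Proof. by rewrite aff_push actK. Qed.

Lemma hyp_push w a k : act w @` (hyp a k) = hyp (pushl w a) (pushk w a k).
Proof.
apply/seteqP; split=> [_ [v vH <-]|v vH]; first by rewrite /hyp /= -/(aff _ _ _) aff_pushK.
by exists (act w^-1%g v); [move: vH; rewrite /hyp /= -/(aff _ _ _) aff_push|rewrite actVK].
Qed.

Lemma hs_push w a k : hs (hyp a k) -> hs (hyp (pushl w a) (pushk w a k)).
Proof. by move=> h; rewrite -hyp_push; exact: act_hs. Qed.

Lemma sH_push w a k : hs (hyp a k) ->
  sH (hyp (pushl w a) (pushk w a k)) = cnj w (sH (hyp a k)).
Proof. by move=> h; rewrite -hyp_push; exact: sH_conj. Qed.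

(** What is known is an affine involution with fixed set [H]. The vector su + u is fixed by its
    linear part, so adding it to a point of [H] stays in [H], and [a] vanishes on it. *)
Lemma sH_lform a k u : hs (hyp a k) ->
  lform a ((rho (sH (hyp a k))).1 *m u) = - lform a u.
Proof.
move=> h; have [inv fix_] := sH_refl h; set s := sH _ in inv fix_ *.
have [v vH] := hyp_exists k (hs_neq0 hsH h).
have sv : act s v = v by move: vH; rewrite -fix_.
have MM u' : (rho s).1 *m ((rho s).1 *m u') = u'.
  have := inv (v + u'); rewrite actD sv actD sv => /addrI; exact.
have : hyp a k (v + ((rho s).1 *m u + u)).
  by rewrite -fix_ /= actD sv mulmxDr MM [u + _]addrC.
by move: vH; rewrite /hyp /= !lformD => ? ?; lra.
Qed.

Lemma sH_aff a k v : hs (hyp a k) -> aff a k (act (sH (hyp a k)) v) = - aff a k v.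
Proof.
move=> h; have [inv fix_] := sH_refl h.
have [v0 vH] := hyp_exists k (hs_neq0 hsH h).
have sv : act (sH (hyp a k)) v0 = v0 by move: vH; rewrite -{1}fix_.
rewrite -{1}[v](subrKC v0) actD sv affDr sH_lform//.
by move: vH; rewrite /hyp /aff /= lformB => ?; lra.
Qed.

Lemma sH_inj H H' : hs H -> hs H' -> sH H = sH H' -> H = H'.
Proof.
move=> /sH_refl[_ E1] /sH_refl[_ E2] E.
by rewrite -[LHS]E1 -[RHS]E2 E.
Qed.

Lemma regular_c0 : regular hs c0.
Proof. by have [] := chamberP hsH hC0 C0c0. Qed.

Lemma C0P q : C0 q <-> same_side hs c0 q.
Proof. by have [_] := chamberP hsH hC0 C0c0. Qed.

Lemma regular_act w p : regular hs p -> regular hs (act w p).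
Proof.
move=> rp a k h; have := rp _ _ (hs_push w^-1%g h).
by rewrite aff_push invgK.
Qed.

Lemma same_side_act w p q : same_side hs p q -> same_side hs (act w p) (act w q).
Proof.
move=> pq a k h; have := pq _ _ (hs_push w^-1%g h).
by rewrite !aff_push invgK.
Qed.

Definition sepg t w : bool := `[< exists a k,
  [/\ hs (hyp a k), t = sH (hyp a k) & aff a k c0 * aff a k (act w c0) < 0] >].

Lemma sepgE a k w : hs (hyp a k) ->
  sepg (sH (hyp a k)) w = (aff a k c0 * aff a k (act w c0) < 0).
Proof.
move=> h; apply/asboolP/idP => [[a' [k' [h' E lt0]]]|]; last by exists a, k.
have [c cN cE] := hyp_rep hsH h' (esym (sH_inj h h' E)).
by rewrite !cE mulrACA -expr2 pmulr_rlt0// exprn_even_gt0.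
Qed.

Lemma sepg_refl t w : sepg t w -> exists a k, hs (hyp a k) /\ t = sH (hyp a k).
Proof. by move=> /asboolP[a [k [h E _]]]; exists a, k. Qed.

Lemma reflP t : (exists a k, hs (hyp a k) /\ t = sH (hyp a k)) \/
  (forall g w, sepg (cnj g t) w = false).
Proof.
have [?|N] := pselect (exists a k, hs (hyp a k) /\ t = sH (hyp a k)); [by left|right].
move=> g w; apply/negbTE/negP => /sepg_refl[a [k [h E]]]; apply: N.
exists (pushl g^-1%g a), (pushk g^-1%g a k); split; first exact: hs_push.
by rewrite sH_push// -E cnjK.
Qed.

Lemma sepgJ g t w : sepg (cnj g t) (g * w)%g = sepg t w (+) sepg (cnj g t) g.
Proof.
have [[a [k [h ->]]]|N] := reflP t; last first.
  by rewrite !N; have := N 1%g w; rewrite cnj1 => ->.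
rewrite -sH_push// !sepgE//; try exact: hs_push.
rewrite actM !aff_pushK addbC; apply: opp_signs.
- by apply: regular_c0; exact: hs_push.
- exact: regular_c0.
- exact: (regular_act w regular_c0 h).
Qed.

Lemma wall_system_geometric : wall_system S sepg.
Proof.
split.
- exact: sepgJ.
- move=> s t [H Hw <-]; have [hH _] := Hw; have [a [k E]] := hs_form hsH hH.
  rewrite {H}E in Hw hH *; apply/idP/eqP => [|->]; last first.
    rewrite sepgE// sH_aff// mulrN oppr_lt0 -expr2 exprn_even_gt0//=.
    exact: regular_c0.
  move=> st; have [a' [k' [h' E]]] := sepg_refl st; rewrite E.
  apply: contrapT => N; have N' : hyp a' k' <> hyp a k by move=> E'; apply: N; rewrite E'.
  (* A point of the wall off the other hyperplane is fixed by [s], so it lies in the closures of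
     both C_0 and sC_0; the other hyperplane therefore cannot separate them. *)
  have [r [r0 Cr r'0]] := wall_generic_point hsH Hw h' N'.
  have pos := closure_side hsH hsF hC0 C0c0 Cr.
  have x := pos _ _ h' r'0.
  set s0 := sH (hyp a k) in st *.
  have sr : act s0 r = r.
    have [_ fix_] := sH_refl hH; have : hyp a k r by exact: r0.
    by rewrite -[hyp a k]fix_.
  have := pos _ _ (hs_push s0^-1%g h'); rewrite !aff_push invgK sr => /(_ r'0) y.
  move: st; rewrite E sepgE// => z.
  have := mulr_gt0 x y; rewrite mulrACA -expr2 pmulr_lgt0 ?exprn_even_gt0//.
  by rewrite ltNge ltW.
- move=> w; have := finite_image sH (finite_separating hsF c0 (act w c0)).
  apply: sub_finite_set.
  move=> t /= /asboolP[a [k [h E lt0]]]; exists (hyp a k) => //; split=> //.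
  by exists a, k.
- move=> w t /asboolP[a [k [h _ lt0]]].
  have rw := regular_act w regular_c0.
  (* The first hyperplane met on a generic path into wC_0 is a wall of C_0, and it separates since
     the path does not meet it again. *)
  have [|q [a' [k' [x [qq' h' /andP[x0 x1] r0 other]]]]] := first_crossing hsH hsF regular_c0 rw.
    by move=> /(_ _ _ h); rewrite ltNge ltW.
  exists (sH (hyp a' k')).
    by exists (hyp a' k') => //; apply: (first_wall hsH hsF hC0 C0c0 h' r0 other).
  rewrite sepgE//; have := qq' _ _ h'; move: r0; rewrite aff_line.
  have := regular_c0 h'; move: (aff a' k' c0) (aff a' k' q) (aff a' k' (act w c0)) => y z y' y0 E yz.
  have zz : 0 < z ^+ 2.
    by rewrite exprn_even_gt0//=; apply: contraTneq yz => ->; rewrite mulr0 ltxx.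
  have E2 : x * z = - ((1 - x) * y) by apply/eqP; rewrite -subr_eq0 -[X in _ == X]E; apply/eqP; ring.
  rewrite -(pmulr_rlt0 _ x0) -(pmulr_rlt0 _ zz).
  rewrite (_ : z ^+ 2 * _ = (y' * z) * (y * (x * z))); last by ring.
  rewrite pmulr_rlt0// E2 mulrN oppr_lt0 mulrCA -expr2 mulr_gt0 ?subr_gt0//.
  by rewrite exprn_even_gt0.
- move=> s [H Hw <-]; have [hH _] := Hw; have [inv _] := sH_refl hH.
  (* The instance of ACVII with both walls equal and m = 1 lifts the involutivity from the affine
     maps to the group. *)
  case: acx => _ [_ [_ [_ [_ [_ [_ [_ [_ [_ [VII _]]]]]]]]]].
  have := VII H H 1%N Hw Hw; rewrite expg1; apply; split=> //; split.
    by move=> v /=; rewrite actM inv.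
  by case.
Qed.

Let ws := wall_system_geometric.

Lemma sep_sameP w : nosep sepg w <-> same_side hs c0 (act w c0).
Proof.
split=> [N a k h|ss t].
  rewrite lt_def mulf_neq0 /=; first last.
  - exact: (regular_act w regular_c0 h).
  - exact: regular_c0.
  by rewrite leNgt -sepgE// N.
have [[a [k [h ->]]]|N] := reflP t; last by rewrite -(cnj1 t) N.
by rewrite sepgE//; apply/negbTE; rewrite -leNgt ltW// ss.
Qed.

Lemma OmegaP w : Omega rho C0 w <-> nosep sepg w.
Proof.
split=> [E|N].
  by apply/sep_sameP/C0P; rewrite -[C0]E; exists c0.
have sub g : nosep sepg g -> act g @` C0 `<=` C0.
  move=> /sep_sameP gc q [p /C0P cp <-]; apply/C0P; apply: same_side_trans gc _.
  exact: same_side_act.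
apply/seteqP; split; first exact: sub.
move=> q Cq; exists (act w^-1%g q); last by rewrite actVK.
by apply: (sub w^-1%g); [exact: (nosepV ws)|exists q].
Qed.

End CoxeterGeometry.

(** * Spherical orientations *)

Section SphericalGeometry.
Variables (K : realType) (n : nat) (W : groupType) (rho : W -> 'M[K]_n * 'cV[K]_n).
Variables (hs : set (set 'cV[K]_n)) (C0 : set 'cV[K]_n) (sH : set 'cV[K]_n -> W).
Local Notation V := 'cV[K]_n.
Hypothesis acx : affine_ext_coxeter rho hs C0 sH.
Variable c0 : V.
Hypothesis C0c0 : C0 c0.
Implicit Types (a : 'rV[K]_n) (k : K) (p q u v d : V) (w g t s x : W).
Local Notation act := (act rho).
Local Notation S := (Sgen hs C0 sH).
Local Notation X := (Xtr rho).
Local Notation sepg := (sepg rho hs sH c0).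
Local Notation tv x := (rho x).2.

Let hsH : forall H, hs H -> is_hyperplane H.
Proof. by case: acx => _ []. Qed.

Let hsF : locally_finite hs.
Proof. by case: acx => _ [_ []]. Qed.

Let hC0 : is_chamber hs C0.
Proof. by case: acx => _ [_ [_ []]]. Qed.

Let ws := wall_system_geometric acx C0c0.
Let sepE := sepgE acx c0.
Let rc0 := regular_c0 acx C0c0.

Lemma hs_lin a k : hs (hyp a k) -> hs (hyp a 0).
Proof.
move=> h; case: acx => _ [_ [_ [_ [_ [_ [_ [IV _]]]]]]].
have [H' [hH' [t Et] H'0]] := IV _ h; suff <- : H' = hyp a 0 by [].
have at_k : lform a t = k.
  move: H'0; rewrite Et => -[v vH vt]; have := congr1 (lform a) vt.
  by move: vH; rewrite /hyp /= lformD lform0 => ? ?; lra.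
rewrite Et; apply/seteqP; split=> [_ [v vH <-]|v vH].
  by move: vH; rewrite /hyp /= lformD at_k addr0.
by exists (v - t); [move: vH; rewrite /hyp /= lformB at_k => ?; lra|rewrite subrK].
Qed.

(** ACV in terms of the forms: by ACIV they all vanish on the intersection of the hyperplanes
    through 0, so the remainder is invisible to them. *)
Lemma span_translations v : exists (m : nat) (c : 'I_m -> K) (t : 'I_m -> W),
  (forall i, X (t i)) /\ forall a k, hs (hyp a k) ->
    lform a v = \sum_(i < m) c i * lform a (tv (t i)).
Proof.
case: acx => _ [_ [_ [_ [_ [_ [_ [_ [V_ _]]]]]]]].
have [m [c [t [Xt vH]]]] := V_ v; exists m, c, t; split=> // a k h.
have : hyp a 0 (v - \sum_(i < m) c i *: tv (t i)).
  by apply: vH; split; [exact: hs_lin h|rewrite /hyp /= lform0 addr0].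
rewrite /hyp /= addr0 lformB lform_sum => /eqP; rewrite subr_eq0 => /eqP ->.
by apply: eq_bigr => i _; rewrite lformZ.
Qed.

Lemma actX x v : X x -> act x v = v + tv x.
Proof. by move=> Xx; rewrite /Defs.act /aff_app Xx mul1mx. Qed.

Lemma X1m : X 1%g.
Proof. by rewrite /Xtr /= (rho1 acx). Qed.

Lemma tv1 : tv 1%g = 0.
Proof. by rewrite (rho1 acx). Qed.

Lemma XM x y : X x -> X y -> X (x * y)%g.
Proof. by rewrite /Xtr /= (linM acx) => -> ->; rewrite mulmx1. Qed.

Lemma tvM x y : X x -> X y -> tv (x * y)%g = tv x + tv y.
Proof. by move=> Xx Xy; rewrite (rhoM acx) /= Xx mul1mx addrC. Qed.

Lemma XV x : X x -> X x^-1%g.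
Proof. by move=> Xx; have := linV acx x; rewrite Xx mul1mx. Qed.

Lemma tvV x : X x -> tv x^-1%g = - tv x.
Proof.
move=> Xx; have := tvM Xx (XV Xx); rewrite mulgV tv1 => /esym/eqP.
by rewrite addrC addr_eq0 => /eqP.
Qed.

Lemma XX x m : X x -> X (x ^+ m)%g /\ tv (x ^+ m)%g = m%:R *: tv x.
Proof.
move=> Xx; elim: m => [|m [IH1 IH2]].
  by rewrite expg0 tv1 scale0r; split=> //; exact: X1m.
rewrite expgS tvM// IH2 -natr1 scalerDl scale1r addrC; split=> //.
exact: XM.
Qed.

Lemma X_cnj g x : X x -> X (cnj g x).
Proof. by rewrite /Xtr /= /cnj !(linM acx) => ->; rewrite mulmx1 (linV acx). Qed.

Lemma int_translations (m : nat) (t : 'I_m -> W) (z : 'I_m -> int) :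
  (forall i, X (t i)) ->
  exists2 x, X x & tv x = \sum_(i < m) (z i)%:~R *: tv (t i).
Proof.
move=> Xt; pose P u := exists2 x, X x & tv x = u.
suff : P (\sum_(i < m) (z i)%:~R *: tv (t i)) by [].
apply: big_ind => [|u v [x Xx <-] [y Xy <-]|i _].
- by exists 1%g; [exact: X1m|exact: tv1].
- by exists (x * y)%g; [exact: XM|rewrite tvM].
case: (z i) => m'; have [Xm tm] := XX m' (Xt i).
  by exists (t i ^+ m')%g.
have [Xm1 tm1] := XX m'.+1 (Xt i).
exists (t i ^+ m'.+1)^-1%g; first exact: XV.
by rewrite tvV// tm1 NegzE mulrNz scaleNr.
Qed.

(** Write N v in terms of translations and round its coefficients down. Each rounding error is below
    1, so the bound does not grow with N. *)
Lemma approx_translation v : exists B : 'rV[K]_n -> K, forall N : nat,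
  exists2 x, X x & forall a k, hs (hyp a k) ->
    `|lform a (tv x) - N%:R * lform a v| <= B a.
Proof.
have [m [c [t [Xt vE]]]] := span_translations v.
exists (fun a => \sum_(i < m) `|lform a (tv (t i))|) => N.
have [x Xx xE] := int_translations (fun i => Num.floor (N%:R * c i)) Xt.
exists x => // a k h; rewrite xE lform_sum (vE a k h) mulr_sumr -sumrB.
apply: le_trans (ler_norm_sum _ _ _) _; apply: ler_sum => i _.
rewrite lformZ mulrA -mulrBl normrM ler_piMl//.
have /andP[f1 f2] := Num.Theory.floor_itv (N%:R * c i).
by rewrite ler_norml; apply/andP; split; move: f1 f2; rewrite intrD; lra.
Qed.

Lemma approx_sign (L : seq ('rV[K]_n * K)) (C : K) v :
  (forall f, f \in L -> hs (hyp f.1 f.2)) ->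
  exists2 x, X x & forall f, f \in L -> lform f.1 v != 0 ->
    C < Num.sg (lform f.1 v) * lform f.1 (tv x).
Proof.
have [B BP] := approx_translation v => hL.
have [N NP] : exists N : nat, forall f, f \in L -> lform f.1 v != 0 ->
    C + B f.1 < N%:R * `|lform f.1 v|.
  elim: L {hL} => [|f L [N IH]]; first by exists 0%N.
  have [M MP] : exists M : nat, lform f.1 v != 0 -> C + B f.1 < M%:R * `|lform f.1 v|.
    have [v0|v0] := eqVneq (lform f.1 v) 0; first by exists 0%N.
    have v1 : 0 < `|lform f.1 v| by rewrite normr_gt0.
    exists (Num.bound `|(C + B f.1) / `|lform f.1 v| |) => _.
    rewrite -ltr_pdivrMr//; apply: le_lt_trans (ler_norm _) _.
    exact: (archi_boundP (normr_ge0 _)).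
  exists (maxn N M) => g; rewrite inE => /orP[/eqP -> g0|gL g0].
    by apply: lt_le_trans (MP g0) _; rewrite ler_wpM2r// ler_nat leq_maxr.
  by apply: lt_le_trans (IH _ gL g0) _; rewrite ler_wpM2r// ler_nat leq_maxl.
have [x Xx xP] := BP N; exists x => // f fL f0.
have := xP _ _ (hL _ fL); have := NP _ fL f0.
have [v0|v0|v0] := ltgtP (lform f.1 v) 0; last by rewrite v0 eqxx in f0.
  by rewrite ltr0_norm// ltr0_sg// ler_norml => ? /andP[? ?]; lra.
by rewrite gtr0_norm// gtr0_sg// ler_norml => ? /andP[? ?]; lra.
Qed.

Lemma refl_rep (A : set W) : finite_set A ->
  (forall t, A t -> exists a k, hs (hyp a k) /\ t = sH (hyp a k)) ->
  exists L : seq ('rV[K]_n * K), (forall f, f \in L -> hs (hyp f.1 f.2)) /\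
    forall t, A t -> exists2 f, f \in L & t = sH (hyp f.1 f.2).
Proof.
move=> finA AP.
have /choice[r rP] (t : W) : exists f : 'rV[K]_n * K, A t -> hs (hyp f.1 f.2) /\ t = sH (hyp f.1 f.2).
  have [/AP[a [k ak]]|NA] := pselect (A t); last by exists (0, 0).
  by exists (a, k).
exists [seq r t | t <- fset_set A]; split=> [f /mapP[t]|t At].
  by rewrite in_fset_set// inE => /rP[? _] ->.
by exists (r t); [apply/map_f; rewrite in_fset_set// inE|have [] := rP t At].
Qed.

Definition regular0 d := forall a k, hs (hyp a k) -> lform a d != 0.

(** With [a] signed to be positive at [d], the condition says that the form is negative on C_0, so
    that leaving the side of C_0 increases it. *)
Definition eg d t : bool := `[< exists a k,
  [/\ hs (hyp a k), t = sH (hyp a k) & lform a d * aff a k c0 < 0] >].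

Lemma egE d a k : hs (hyp a k) -> eg d (sH (hyp a k)) = (lform a d * aff a k c0 < 0).
Proof.
move=> h; apply/asboolP/idP => [[a' [k' [h' E lt0]]]|]; last by exists a, k.
have E' := sH_inj acx h h' E.
have [|c cN [-> ->]] := hyp_sub (hs_neq0 hsH h') (hs_neq0 hsH h) (k:=k') (k':=k).
  by rewrite E'.
by rewrite affZ lformZl mulrACA -expr2 pmulr_rlt0// exprn_even_gt0.
Qed.

Lemma refl_dec t : (exists a k, hs (hyp a k) /\ t = sH (hyp a k)) \/
  forall g d w, eg d (cnj g t) = false /\ sepg (cnj g t) w = false.
Proof.
have [?|N] := pselect (exists a k, hs (hyp a k) /\ t = sH (hyp a k)); [by left|right].
move=> g d w; have N' : ~ exists a k, hs (hyp a k) /\ cnj g t = sH (hyp a k).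
  move=> [a [k [h E]]]; apply: N; exists (pushl rho g^-1%g a), (pushk rho g^-1%g a k).
  by rewrite (sH_push acx)// -E cnjK; split=> //; exact: (hs_push acx).
split; apply/asboolP => -[a [k [h E _]]]; apply: N'; by exists a, k.
Qed.

(** The orientation is given by a direction, so pulling it back moves the direction by a linear
    part. The correction term of the twist is absorbed by [opp_signs]. *)
Lemma eg_twist d w : regular0 d -> sep_twist sepg (eg d) w =1 eg ((rho w^-1%g).1 *m d).
Proof.
move=> rd t; have [[a [k [h ->]]]|N] := refl_dec t; last first.
  by rewrite /sep_twist; have [-> ->] := N w d w;
    have [] := N 1%g ((rho w^-1%g).1 *m d) w; rewrite cnj1 => ->.
rewrite /sep_twist -(sH_push acx)//; have h' := hs_push acx w h.
rewrite !egE// sepE// (aff_pushK acx) lformM -/(pushl _ _ _) -opp_signs//.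
- exact: rd h'.
- exact: rc0.
- exact: rc0.
Qed.

Lemma regular0_lin d w : regular0 d -> regular0 ((rho w).1 *m d).
Proof.
move=> rd a k h; have := rd _ _ (hs_push acx w^-1%g h).
by rewrite /pushl invgK lformM.
Qed.

Lemma X_refl_geometric t x : X x -> sepg t (cnj t x^-1%g) = sepg t x.
Proof.
move=> Xx; have [[a [k [h ->]]]|N] := refl_dec t; last first.
  have N1 w : sepg t w = false by have [_] := N 1%g 0 w; rewrite cnj1.
  by rewrite !N1.
rewrite !sepE// (actX _ Xx); set s := sH _.
have sV v : aff a k (act s^-1%g v) = - aff a k v.
  by rewrite -{2}(actVK acx s v) (sH_aff acx)// opprK.
rewrite /cnj !(actM acx) (sH_aff acx)// (actX _ (XV Xx)).
by rewrite (affDr _ _ (act s^-1%g c0)) (affDr _ _ c0) sV tvV// lformN opprD !opprK.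
Qed.

(** The translates of the wall by x and its inverse are hyperplanes too; [closure_side] at a wall
    point puts C_0 between them. Hence the form at c0 is smaller in absolute value than the shift,
    and C_0 crosses the wall in just one of the two directions. *)
Lemma X_simple_geometric s x : S s -> X x -> cnj x s != s -> sepg s x (+) sepg s x^-1%g.
Proof.
move=> [H Hw <-] Xx; have [hH _] := Hw; have [a [k E]] := hs_form hsH hH.
rewrite {H}E in Hw hH * => N.
have ax : lform a (tv x) != 0.
  apply: contra N => /eqP ax; rewrite -(sH_push acx)//; apply/eqP; congr sH.
  by apply/seteqP; split=> v; rewrite /hyp /= -!/(aff _ _ v) aff_push// actX ?affDr ?tvV// ?lformN ?ax ?oppr0 ?addr0//; exact: XV.
have [r r0 Cr] := wall_point Hw.
rewrite !sepE// !actX// ?tvV//; last exact: XV.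
rewrite !affDr lformN; set y := lform a (tv x) in ax *.
have f0 := rc0 hH.
have key (z : W) : X z -> lform a (tv z) != 0 ->
    0 < (aff a k c0 + lform a (tv z)) * lform a (tv z).
  move=> Xz z0; have h := hs_push acx z^-1%g hH.
  have rE v : aff (pushl rho z^-1%g a) (pushk rho z^-1%g a k) v = aff a k v + lform a (tv z).
    by rewrite aff_push// invgK actX// affDr.
  by have := closure_side hsH hsF hC0 C0c0 Cr h; rewrite !rE r0 add0r; apply.
have k1 := key x Xx ax.
have k2 : 0 < (aff a k c0 - y) * - y.
  by rewrite -lformN -tvV//; apply: key; [exact: XV|rewrite tvV// lformN oppr_eq0].
move: k1 k2 f0; rewrite -/y; move: (aff a k c0) => z.
have [y0|y0|y0] := ltgtP y 0; last by rewrite y0 eqxx in ax.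
  have [z0|z0|->] := ltgtP z 0; rewrite ?eqxx//= => k1 k2 _.
    have -> : (z * (z + y) < 0) = false.
      by apply/negbTE; rewrite -leNgt nmulr_rge0//; lra.
    by rewrite addFb nmulr_rlt0//; move: k2; rewrite pmulr_lgt0 ?oppr_gt0.
  have -> : z * (z + y) < 0 by rewrite pmulr_rlt0//; move: k1; rewrite nmulr_lgt0.
  by rewrite addTb -leNgt pmulr_rge0//; lra.
have [z0|z0|->] := ltgtP z 0; rewrite ?eqxx//= => k1 k2 _.
  have -> : z * (z + y) < 0 by rewrite nmulr_rlt0//; move: k1; rewrite pmulr_lgt0.
  by rewrite addTb -leNgt nmulr_rge0//; lra.
have -> : (z * (z + y) < 0) = false.
  by apply/negbTE; rewrite -leNgt pmulr_rge0//; lra.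
by rewrite addFb pmulr_rlt0//; move: k2; rewrite nmulr_lgt0 ?oppr_lt0.
Qed.

(** Take the chamber xC_0 for a translation x far out in the direction -d; the bound [M] makes the
    shift dominate every value at c0. *)
Lemma eg_approx d : regular0 d -> approximable sepg (eg d).
Proof.
move=> rd A finA AP.
have [|L [hL LA]] := refl_rep finA.
  by move=> t /AP[w /sepg_refl].
pose M := \sum_(f <- L) `|aff f.1 f.2 c0|.
have [x Xx xP] := approx_sign M (- d) hL.
exists x => t /LA[f fL ->]; have h := hL _ fL.
have d0 := rd _ _ h; have f0 := rc0 h.
have := xP _ fL; rewrite lformN oppr_eq0 => /(_ d0).
have fM : `|aff f.1 f.2 c0| <= M.
  by rewrite /M (big_rem f)//= lerDl sumr_ge0.
move=> /(le_lt_trans fM); rewrite egE// sepE// actX// affDr sgrN mulNr.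
move: (aff f.1 f.2 c0) (lform f.1 d) (lform f.1 (tv x)) f0 d0 => y z u y0 z0.
have [z1|z1|z1] := ltgtP z 0; last by rewrite z1 eqxx in z0.
  rewrite ltr0_sg// mulN1r opprK ltr_norml nmulr_rlt0// => /andP[u1 u2].
  by rewrite pmulr_llt0 -?leNgt ?le_eqVlt 1?eq_sym ?(negbTE y0)//; lra.
rewrite gtr0_sg// mul1r ltr_norml pmulr_rlt0// => /andP[u1 u2].
by rewrite nmulr_llt0 -?leNgt ?le_eqVlt ?(negbTE y0)//; lra.
Qed.

Lemma sH_lin_fix a k u : hs (hyp a k) -> lform a u = 0 ->
  (rho (sH (hyp a k))).1 *m u = u.
Proof.
move=> h u0; have [_ fix_] := sH_refl acx h; set s := sH _ in fix_ *.
have [v vH] := hyp_exists k (hs_neq0 hsH h).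
have sv : act s v = v by move: vH; rewrite -{1}fix_.
have : hyp a k (v + u) by move: vH; rewrite /hyp /= lformD u0 addr0.
by rewrite -{1}fix_ /= actD sv => /addrI.
Qed.

Lemma linVK w u : (rho w).1 *m u = u -> (rho w^-1%g).1 *m u = u.
Proof.
by move=> wu; rewrite -{1}wu mulmxA -{2}[w]invgK (linV acx) mul1mx.
Qed.

Lemma lin_fix_central w v : (forall a k, hs (hyp a k) -> lform a v = 0) ->
  (rho w).1 *m v = v.
Proof.
move=> v0; case: acx => _ [_ [_ [_ [_ [_ [_ [_ [_ [_ [_ [+ _]]]]]]]]]]].
move=> /(_ w)[w' [[l [g [e [gP ->]]]] ->]].
elim: (enum _) => [|j r IH] /=; first by rewrite (rho1 acx) mul1mx.
rewrite (linM acx) -mulmxA IH.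
have [H hH sHj] := gP j; have [a [k E]] := hs_form hsH hH.
have gv : (rho (g j)).1 *m v = v.
  by rewrite -sHj E; apply: sH_lin_fix; [rewrite -E|apply: (v0 a k); rewrite -E].
by case: (e j) => //; exact: linVK.
Qed.

(** Otherwise the linear part fixes all translation vectors and, by ACVIII, the intersection of the
    linear hyperplanes. By ACV these span V. *)
Lemma moved_translation w : ~ X w -> exists2 x, X x & (rho w).1 *m tv x != tv x.
Proof.
move=> NX; apply: contrapT => N; apply: NX.
have fixX x : X x -> (rho w).1 *m tv x = tv x.
  by move=> Xx; apply/eqP/contraT => ?; exfalso; apply: N; exists x.
suff E v : (rho w).1 *m v = v.
  rewrite /Xtr /=; apply/matrixP => i j; have := E (delta_mx j 0).
  rewrite -colE => /(congr1 (fun M : 'cV[K]_n => M i 0)); rewrite !mxE eqxx andbT => ->.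
  by [].
have [m [c [t [Xt vE]]]] := span_translations v.
rewrite -[v](subrK (\sum_(i < m) c i *: tv (t i))) mulmxDr; congr (_ + _).
  apply: lin_fix_central => a k h; rewrite lformB lform_sum (vE a k h).
  by apply/eqP; rewrite subr_eq0; apply/eqP/eq_bigr => i _; rewrite lformZ.
by rewrite mulmx_sumr; apply: eq_bigr => i _; rewrite -scalemxAr fixX.
Qed.

(** Choose [x] to move towards wC_0 across every separating hyperplane; its inverse then moves away
    from them. The conjugates have translation part tv w + m (tv x - w tv x), which determines m
    once the linear part of [w] moves tv x. *)
Lemma X_deep_geometric w : ~ X w -> exists x, [/\ X x,
  forall m t, sepg t w -> sepg t (x^-1 ^+ m)%g = false &
  forall m m', cnj (x ^+ m)%g w = cnj (x ^+ m')%g w -> m = m'].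
Proof.
move=> NX; have [x1 Xx1 x1N] := moved_translation NX.
have [|L [hL LA]] := refl_rep (sep_finite ws w).
  by move=> t /= /sepg_refl.
pose d := act w c0 - c0.
pose M := \sum_(f <- L) `|lform f.1 (tv x1)|.
have [x0 Xx0 x0P] := approx_sign M d hL.
have M0 : 0 <= M by rewrite sumr_ge0.
have [x [Xx xN xP]] : exists x, [/\ X x, (rho w).1 *m tv x != tv x &
    forall f, f \in L -> lform f.1 d != 0 -> 0 < Num.sg (lform f.1 d) * lform f.1 (tv x)].
  (* If [w] fixes the first candidate, multiply by the moved translation [x1]; the margin [M]
     preserves all the signs. *)
  have [E|N] := eqVneq ((rho w).1 *m tv x0) (tv x0); last first.
    by exists x0; split=> // f fL f0; exact: le_lt_trans M0 (x0P f fL f0).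
  exists (x0 * x1)%g; split; first exact: XM.
    by rewrite tvM// mulmxDr E; apply: contra x1N => /eqP/addrI ->.
  move=> f fL f0; rewrite tvM// lformD mulrDr; have := x0P f fL f0.
  have fM : `|lform f.1 (tv x1)| <= M by rewrite /M (big_rem f)//= lerDl sumr_ge0.
  have : `|Num.sg (lform f.1 d) * lform f.1 (tv x1)| <= M.
    by rewrite normrM normr_sg f0 mul1r.
  by rewrite ler_norml => /andP[? _] ?; lra.
exists x; split=> //.
- move=> m t tw; have [f fL E] := LA t tw; rewrite E in tw *; have h := hL _ fL.
  have [Xm tm] := XX m (XV Xx).
  rewrite sepE// (actX _ Xm) affDr tm lformZ tvV// lformN.
  move: tw; rewrite sepE//; have := xP f fL.
  have -> : lform f.1 d = aff f.1 f.2 (act w c0) - aff f.1 f.2 c0.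
    by rewrite /d lformB /aff; ring.
  move: (aff f.1 f.2 (act w c0)) (aff f.1 f.2 c0) (lform f.1 (tv x)) => y z u uP zy.
  have m0 : 0 <= m%:R :> K by [].
  apply/negbTE; rewrite -leNgt.
  have z0 : z != 0 by apply: contraTneq zy => ->; rewrite mul0r ltxx.
  have [z1|z1|z1] := ltgtP z 0; last by rewrite z1 eqxx in z0.
    have y1 : 0 < y by move: zy; rewrite nmulr_rlt0.
    have yz : 0 < y - z by lra.
    have := uP (lt0r_neq0 yz); rewrite gtr0_sg// mul1r => u0.
    rewrite nmulr_rge0//; have : 0 <= m%:R * u by rewrite mulr_ge0// ltW.
    by lra.
  have y1 : y < 0 by move: zy; rewrite pmulr_rlt0.
  have yz : y - z < 0 by lra.
  have := uP (ltr0_neq0 yz); rewrite ltr0_sg// mulN1r oppr_gt0 => u0.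
  rewrite pmulr_rge0//; have : m%:R * u <= 0 by rewrite mulr_ge0_le0// ltW.
  by lra.
- have cE m : act (cnj (x ^+ m)%g w) 0 = tv w + m%:R *: (tv x - (rho w).1 *m tv x).
    have [Xm tm] := XX m Xx.
    rewrite /cnj !(actM acx) (actX _ (XV Xm)) (actX _ Xm) tvV// tm add0r.
    rewrite /Defs.act /aff_app mulmxN -scalemxAr scalerBr.
    by rewrite [- _ + _]addrC -addrA [- _ + _]addrC.
  move=> m m' E; have := cE m; rewrite E cE => /addrI/eqP.
  rewrite -subr_eq0 -scalerBl scaler_eq0 !subr_eq0 [tv x == _]eq_sym (negbTE xN) orbF.
  by rewrite eqr_nat => /eqP.
Qed.

Definition hs0 : set (set V) := [set H | hs H /\ H 0].

Lemma hs0H H : hs0 H -> is_hyperplane H.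
Proof. by move=> [/hsH]. Qed.

Lemma hs0F : locally_finite hs0.
Proof.
move=> v; have [U Uv finU] := hsF v; exists U => //.
by apply: sub_finite_set finU => H [[hH _] HU].
Qed.

Lemma hs0E a k : hs0 (hyp a k) <-> hs (hyp a k) /\ k = 0.
Proof. by rewrite /hs0 /= {2}/hyp /= lform0 add0r. Qed.

Lemma aff0E a v : aff a 0 v = lform a v.
Proof. exact: addr0. Qed.

Lemma regular0P d : regular hs0 d <-> regular0 d.
Proof.
split=> rd a k h; last by move/hs0E: h => [h k0]; rewrite k0 aff0E; exact: rd h.
rewrite -aff0E; apply: rd; apply/hs0E; split=> //; exact: hs_lin h.
Qed.

Lemma same_side0P d d' : same_side hs0 d d' <->
  forall a k, hs (hyp a k) -> 0 < lform a d * lform a d'.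
Proof.
split=> dd a k h; last by move/hs0E: h => [h k0]; rewrite k0 !aff0E; exact: dd h.
rewrite -!aff0E; apply: dd; apply/hs0E; split=> //; exact: hs_lin h.
Qed.

Lemma eq_eg d d' : same_side hs0 d d' -> eg d =1 eg d'.
Proof.
move=> /same_side0P dd t; have [[a [k [h ->]]]|N] := refl_dec t; last first.
  by rewrite -(cnj1 t); have [-> _] := N 1%g d 1%g; have [-> _] := N 1%g d' 1%g.
rewrite !egE//; have := dd _ _ h; move: (aff a k c0) (lform a d) (lform a d') => y z z'.
have [z0|z0|->] := ltgtP z 0; last by rewrite mul0r ltxx.
  by rewrite nmulr_rgt0// => z1; rewrite !nmulr_rlt0.
by rewrite pmulr_rgt0// => z1; rewrite !pmulr_rlt0.
Qed.

Lemma adjacent_refl d d' : eg d =1 eg d' -> adjacent sepg (eg d) (eg d').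
Proof. by move=> E; exists xpred0. Qed.

(** The set exchanged is that of the reflections in all parallels of [hyp a0 k0]. Their linear parts
    send [d] to the Weyl chamber of d'. *)
Lemma adjacent_cross d d' a0 k0 : regular0 d -> hs (hyp a0 k0) ->
  lform a0 d * lform a0 d' < 0 ->
  (forall a k, hs (hyp a k) -> hyp a 0 <> hyp a0 0 -> 0 < lform a d * lform a d') ->
  adjacent sepg (eg d) (eg d').
Proof.
move=> rd h0 lt0 other; have a00 := hs_neq0 hsH h0.
exists (fun t => `[< exists k, hs (hyp a0 k) /\ t = sH (hyp a0 k) >]); split=> t.
- move=> /asboolP[k [h ->]]; rewrite !egE//; have := rc0 h; move: lt0.
  move: (aff a0 k c0) (lform a0 d) (lform a0 d') => y z z' lt0 y0.
  have [z0|z0|E] := ltgtP z 0; last by rewrite E mul0r ltxx in lt0.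
    rewrite nmulr_rlt0// -leNgt pmulr_rge0; last by move: lt0; rewrite nmulr_rlt0.
    by rewrite lt_def y0.
  rewrite pmulr_rlt0// -leNgt nmulr_rge0; last by move: lt0; rewrite pmulr_rlt0.
  by rewrite lt_neqAle y0.
- move=> /asboolP Nt; have [[a [k [h E]]]|N] := refl_dec t; last first.
    by rewrite -(cnj1 t); have [-> _] := N 1%g d 1%g; have [-> _] := N 1%g d' 1%g.
  rewrite E !egE//; have : 0 < lform a d * lform a d'.
    apply: (other _ _ h) => E0.
    have [|c c0' [Ea _]] := hyp_sub a00 (hs_neq0 hsH h) (k := 0) (k' := 0).
      by rewrite E0.
    apply: Nt; exists (k / c).
    suff Ek : hyp a k = hyp a0 (k / c) by rewrite -Ek.
    apply/seteqP; split=> v; rewrite /hyp /= Ea lformZl.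
      by move=> vE; apply: (mulfI c0'); rewrite mulrDr mulr0 mulrCA divff// mulr1.
    by move=> vE; rewrite -[k](divfK c0') [_ / _ * _]mulrC -mulrDr vE mulr0.
  move: (aff a k c0) (lform a d) (lform a d') => y z z'.
  have [z0|z0|->] := ltgtP z 0; last by rewrite mul0r ltxx.
    by rewrite nmulr_rgt0// => z1; rewrite !nmulr_rlt0.
  by rewrite pmulr_rgt0// => z1; rewrite !pmulr_rlt0.
move=> /asboolP[k [h Et]] t'; rewrite (eg_twist _ rd).
apply: eq_eg; apply/same_side0P => a k' ha.
pose s := sH (hyp a0 k).
have sV u : lform a0 ((rho s^-1%g).1 *m u) = - lform a0 u.
  by rewrite -[in RHS](mul1mx u) -(linV acx s) -mulmxA (sH_lform acx _ h) opprK.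
rewrite Et -/s.
have h' := hs_push acx s ha.
have pE v : lform (pushl rho s a) v = lform a ((rho s^-1%g).1 *m v) by rewrite lformM.
have [E0|N0] := pselect (hyp (pushl rho s a) 0 = hyp a0 0).
  have [|c cN [Ea _]] := hyp_sub a00 (hs_neq0 hsH h') (k := 0) (k' := 0); first by rewrite E0.
  have aE v : lform a v = - (c * lform a0 v).
    have := pE ((rho s).1 *m v); rewrite mulmxA -{1}[s]invgK.
    rewrite -(linM acx) invgK mulVg (rho1 acx) mul1mx => <-.
    by rewrite Ea lformZl (sH_lform acx _ h) mulrN.
  rewrite !aE sV (_ : _ * _ = - (c ^+ 2 * (lform a0 d * lform a0 d'))); last by ring.
  by rewrite oppr_gt0 pmulr_rlt0// exprn_even_gt0.
have [/andP[x0 x1] xE] := segment_zero lt0; set x := _ / _ in x0 x1 xE.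
(* The point of the segment on the crossed hyperplane is fixed by [s]. So [a] at d', [a] at p, its
   transform by [s] at p, and that transform at d all have the same sign. *)
pose p := d + x *: (d' - d).
have p0 : lform a0 p = 0 by rewrite /p lformD lformZ lformB.
have sp : (rho s^-1%g).1 *m p = p by apply: linVK; exact: sH_lin_fix h p0.
have mid b kb : hs (hyp b kb) -> hyp b 0 <> hyp a0 0 -> 0 < lform b d * lform b p /\ 0 < lform b p * lform b d'.
  move=> hb Nb; have := other _ _ hb Nb; rewrite /p lformD lformZ lformB.
  move: (lform b d) (lform b d') => y z yz.
  have y2 : 0 < y ^+ 2.
    by rewrite exprn_even_gt0//=; apply: contraTneq yz => ->; rewrite mul0r ltxx.
  have z2 : 0 < z ^+ 2.
    by rewrite exprn_even_gt0//=; apply: contraTneq yz => ->; rewrite mulr0 ltxx.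
  have -> : y * (y + x * (z - y)) = (1 - x) * y ^+ 2 + x * (y * z) by ring.
  have -> : (y + x * (z - y)) * z = (1 - x) * (y * z) + x * z ^+ 2 by ring.
  by split; apply: addr_gt0; apply: mulr_gt0 => //; rewrite subr_gt0.
have Na : hyp a 0 <> hyp a0 0.
  move=> E0; apply: N0; have [|c cN [Ea _]] := hyp_sub a00 (hs_neq0 hsH ha) (k := 0) (k' := 0).
    by rewrite E0.
  apply/seteqP; split=> v; rewrite /hyp /= !addr0 pE Ea lformZl sV mulrN.
    by move=> /eqP; rewrite oppr_eq0 mulf_eq0 (negbTE cN) => /eqP.
  by move=> ->; rewrite mulr0 oppr0.
have [m1 _] := mid _ _ h' N0; have [_ m2] := mid _ _ ha Na.
move: m1; rewrite !pE sp => m1.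
have a2 : 0 < lform a p ^+ 2.
  by rewrite exprn_even_gt0//=; apply: contraTneq m2 => ->; rewrite mul0r ltxx.
by rewrite -(pmulr_rgt0 _ a2); have := mulr_gt0 m1 m2; congr (0 < _); ring.
Qed.

Definition sphere_index := {d : V | regular0 d}.

(** Induction on the number of linear hyperplanes separating the two directions: a generic path
    crosses them singly, and each crossing is an adjacency. *)
Lemma eg_chain (D D' : sphere_index) :
  chain (fun d d' : sphere_index => adjacent sepg (eg (sval d)) (eg (sval d'))) D D'.
Proof.
have fs := finite_separating hs0F.
pose N (d d' : V) := #|` fset_set
  [set H | hs0 H /\ exists a k, H = hyp a k /\ aff a k d * aff a k d' < 0]|.
move: {2}(N (sval D) (sval D')).+1 (leqnn (N (sval D) (sval D')).+1) => m.
elim: m D => // m IH D; rewrite ltnS => Nm.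
have [ss|NS] := pselect (same_side hs0 (sval D) (sval D')).
  by apply: chain_step (chain_refl _ _); apply/adjacent_refl/eq_eg.
have r := (regular0P _).2 (svalP D); have r' := (regular0P _).2 (svalP D').
have [q [a [k [x [qq' h /andP[x0 x1] pz other]]]]] := first_crossing hs0H hs0F r r' NS.
set d := sval D in r pz other *; set d' := sval D' in r' qq' *.
set p := d + x *: (q - d) in pz other.
have [ha k0] := (hs0E a k).1 h.
have [e e0 eP] := locally_same hs0H hs0F p.
have N1 : 0 < `|q - d| + 1 by rewrite ltr_wpDl.
pose y := e / (`|q - d| + 1) / 2.
have y0 : 0 < y by rewrite !divr_gt0.
(* A point just beyond the first crossing, near enough to meet no other hyperplane. *)
pose d1 := p + y *: (q - d).
have d1p : `|d1 - p| < e.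
  rewrite /d1 addrAC subrr add0r normrZ gtr0_norm//.
  apply: (@le_lt_trans _ _ (e / 2)); last by rewrite ltr_pdivrMr// mulr_natr mulr2n ltrDl.
  rewrite /y mulrAC ler_pM2r ?invr_gt0// mulrAC ler_pdivrMr// ler_pM2l//.
  by rewrite lerDl.
have oth b kb : hs0 (hyp b kb) -> hyp b kb <> hyp a k -> 0 < aff b kb d * aff b kb d1.
  move=> hb Nb; have z1 := other _ _ hb Nb.
  have bp : aff b kb p != 0 by apply: contraTneq z1 => ->; rewrite mulr0 ltxx.
  have z2 := eP _ d1p _ _ hb bp.
  have b2 : 0 < aff b kb p ^+ 2 by rewrite exprn_even_gt0.
  by rewrite -(pmulr_rgt0 _ b2); have := mulr_gt0 z1 z2; congr (0 < _); ring.
have dE : x * aff a k q = - ((1 - x) * aff a k d).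
  by apply/eqP; rewrite -subr_eq0 -[X in _ == X]pz aff_line; apply/eqP; ring.
have ad1 : x * aff a k d1 = - (y * aff a k d).
  rewrite /d1 affDr pz add0r lformZ.
  have -> : lform a (q - d) = aff a k q - aff a k d by rewrite lformB /aff; ring.
  by rewrite mulrCA mulrBr dE; ring.
have ad0 := r _ _ h.
have ad2 : 0 < aff a k d ^+ 2 by rewrite exprn_even_gt0.
have cross : aff a k d * aff a k d1 < 0.
  rewrite -(pmulr_rlt0 _ x0) mulrCA ad1 mulrN oppr_lt0 mulrCA -expr2.
  by rewrite mulr_gt0.
have r1 : regular hs0 d1.
  move=> b kb hb; have [E|Nb] := pselect (hyp b kb = hyp a k); last first.
    by apply: contraTneq (oth _ _ hb Nb) => ->; rewrite mulr0 ltxx.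
  have [c cN cE] := hyp_rep hs0H h (esym E).
  by rewrite cE mulf_neq0//; apply: contraTneq cross => ->; rewrite mulr0 ltxx.
have r1' : regular0 d1 by exact/regular0P.
apply: (@chain_step _ _ _ (exist _ d1 r1' : sphere_index)) => /=.
  apply: (adjacent_cross (svalP D) ha); first by move: cross; rewrite k0 !aff0E.
  move=> b kb hb Nb; have hb0 : hs0 (hyp b 0) by apply/hs0E; split=> //; exact: hs_lin hb.
  by have := oth _ _ hb0; rewrite k0 !aff0E; apply.
apply: IH => /=; apply: leq_trans Nm; rewrite /N -/d -/d'.
have ss := qq' _ _ h.
have q2 : 0 < aff a k q ^+ 2.
  by rewrite exprn_even_gt0//=; apply: contraTneq ss => ->; rewrite mulr0 ltxx.
have pos1 : 0 <= aff a k d1 * aff a k d'.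
  rewrite -(pmulr_rge0 _ q2) -(pmulr_rge0 _ x0) -(pmulr_rge0 _ x0).
  have -> : x * (x * (aff a k q ^+ 2 * (aff a k d1 * aff a k d'))) =
    (x * aff a k d1) * (x * aff a k q) * (aff a k d' * aff a k q) by ring.
  rewrite ad1 dE mulrNN pmulr_lge0//.
  have -> : y * aff a k d * ((1 - x) * aff a k d) = y * (1 - x) * aff a k d ^+ 2 by ring.
  by apply/ltW/mulr_gt0 => //; apply: mulr_gt0 => //; rewrite subr_gt0.
have neg : aff a k d * aff a k d' < 0.
  rewrite -(pmulr_rlt0 _ q2) -(pmulr_rlt0 _ x0).
  have -> : x * (aff a k q ^+ 2 * (aff a k d * aff a k d')) =
    aff a k d * (x * aff a k q) * (aff a k d' * aff a k q) by ring.
  by rewrite dE mulrN mulNr oppr_lt0 mulr_gt0// mulrCA -expr2 mulr_gt0// subr_gt0.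
have notin b kb : hs0 (hyp b kb) -> hyp b kb = hyp a k -> aff b kb d1 * aff b kb d' < 0 -> False.
  move=> hb E; have [c cN cE] := hyp_rep hs0H h (esym E).
  by rewrite !cE mulrACA -expr2 pmulr_rlt0 ?exprn_even_gt0// ltNge pos1.
apply: fproper_ltn_card; rewrite fproperE; apply/andP; split; last first.
  apply/negP => /fsubsetP/(_ (hyp a k)); rewrite !in_fset_set// !inE => H.
  have [|_ [b [kb [E lt]]]] := H; first by split=> //; exists a, k.
  by apply: (notin b kb _ (esym E) lt); rewrite -E.
apply/fsubsetP => H; rewrite !in_fset_set// !inE => -[hH [b [kb [E lt]]]].
split=> //; exists b, kb; split=> //.
have hb : hs0 (hyp b kb) by rewrite -E.
have [E'|Nb] := pselect (hyp b kb = hyp a k); first by exfalso; exact: notin hb E' lt.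
have z := oth _ _ hb Nb; have b2 : 0 < aff b kb d1 ^+ 2.
  by rewrite exprn_even_gt0//=; apply: contraTneq z => ->; rewrite mulr0 ltxx.
rewrite -(pmulr_rlt0 _ b2).
have -> : aff b kb d1 ^+ 2 * (aff b kb d * aff b kb d') =
  aff b kb d * aff b kb d1 * (aff b kb d1 * aff b kb d') by ring.
by rewrite pmulr_rlt0.
Qed.

Lemma spherical_geometric : spherical_datum S sepg X (fun D : sphere_index => eg (sval D)).
Proof.
split=> /=.
- exact: X_cnj.
- exact: X_refl_geometric.
- exact: X_simple_geometric.
- exact: X_deep_geometric.
- move=> [d rd] x Xx t /=; rewrite (eg_twist _ rd).
  by have := XV Xx; rewrite /Xtr /= => ->; rewrite mul1mx.
- move=> [d rd] w; exists (exist _ _ (regular0_lin w^-1%g rd)) => t /=.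
  by rewrite (eg_twist _ rd).
- by move=> [d rd]; exact: eg_approx.
- exact: eg_chain.
Qed.

(** * Word length and the number of separating hyperplanes *)

Lemma word_len_len w : word_len rho hs C0 sH w (len sepg w).
Proof.
suff [l [lw lS [g [Og wE]]]] : exists l : seq W, [/\ size l = len sepg w,
    forall s, s \in l -> S s & exists g, Omega rho C0 g /\ w = (gprod l * g)%g].
  exists (fun i => nth 1%g l i), g; split; last split=> //.
    by move=> i; apply/lS/mem_nth; rewrite lw.
  rewrite [LHS]wE; congr (gprod _ * _)%g.
  by rewrite (map_comp (nth 1%g l) val) val_enum_ord map_nth_iota0 ?lw// -lw take_size.
move: w; apply: (simple_ind ws) => [g gO|s w Ss sw [l [lw lS [g [Og wE]]]]].
  exists [::]; split=> //; first by rewrite /len nosep_wlen.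
  by exists g; rewrite mul1g; split=> //; apply/(OmegaP acx C0c0).
exists (s :: l); split=> [|t|].
- by rewrite /= lw (lensM_up ws Ss sw).
- by rewrite inE => /orP[/eqP ->//|]; exact: lS.
- by exists g; split=> //; rewrite wE /= mulgA.
Qed.

Lemma word_len_ge w r : word_len rho hs C0 sH w r -> (len sepg w <= r)%N.
Proof.
move=> [ss [u [ssS [/(OmegaP acx C0c0) uO ->]]]].
rewrite (lenMu ws _ uO) -[X in (_ <= X)%N](size_enum_ord r) -(size_map ss).
have : forall s, s \in [seq ss i | i <- enum 'I_r] -> S s.
  by move=> s /mapP[i _ ->].
elim: [seq _ | _ <- _] => [|s l IH] lS /=.
  by rewrite /len (nosep_wlen _ (nosep1 ws)).
apply: leq_trans (lensM_le ws _ _) _; first by apply: lS; rewrite inE eqxx.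
by rewrite ltnS; apply: IH => t tl; apply: lS; rewrite inE tl orbT.
Qed.

Lemma ellE w : ell rho hs C0 sH w = len sepg w.
Proof.
have Pw : word_len rho hs C0 sH w (len sepg w) /\
    forall r', word_len rho hs C0 sH w r' -> (len sepg w <= r')%N.
  by split; [exact: word_len_len|move=> r' /word_len_ge].
rewrite /ell; case: xgetP => [r _ /= [rw rmin]|/(_ (len sepg w))]; last by [].
by apply/eqP; rewrite eqn_leq rmin//=; [exact: word_len_ge|exact: word_len_len].
Qed.

Lemma hyp_scale c a k : c != 0 -> hyp (c *: a) (c * k) = hyp a k.
Proof.
move=> cN; apply/seteqP; split=> v; rewrite /hyp /= lformZl -mulrDr.
  by move=> /eqP; rewrite mulf_eq0 (negbTE cN) => /eqP.
by move=> ->; rewrite mulr0.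
Qed.

(** * Levels in a parallelism class and the roots *)

Section Levels.
Variable a : 'rV[K]_n.
Hypothesis ha0 : hs (hyp a 0).
Let A : set K := [set k | hs (hyp a k)].
Let a0 := hs_neq0 hsH ha0.

Lemma level_refl k k' : A k -> A k' -> A (2 * k' - k).
Proof.
move=> hk hk'; suff E : act (sH (hyp a k')) @` (hyp a k) = hyp a (2 * k' - k).
  by rewrite /A /= -E; exact: (act_hs acx).
have inv := (sH_refl acx hk').1; have E v := sH_aff acx v hk'.
apply/seteqP; split=> [_ [v vH <-]|v vH].
  by have := E v; move: vH; rewrite /hyp /aff /= => ? ?; lra.
exists (act (sH (hyp a k')) v); last exact: inv.
by have := E v; move: vH; rewrite /hyp /aff /= => ? ?; lra.
Qed.

Lemma level_opp k : A k -> A (- k).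
Proof. by move=> hk; have := level_refl hk ha0; rewrite mulr0 sub0r. Qed.

Lemma level_pos : exists2 k, 0 < k & A k.
Proof.
have [v v0] := lform_neq0 a0.
have [m [c [t [Xt vE]]]] := span_translations v.
have [i ti] : exists i, lform a (tv (t i)) != 0.
  apply: contrapT => N; move: v0; rewrite (vE _ _ ha0) big1 ?eqxx// => i _.
  have [->|ti] := eqVneq (lform a (tv (t i))) 0; first by rewrite mulr0.
  by exfalso; apply: N; exists i.
have At : A (lform a (tv (t i))).
  suff E : act (t i)^-1%g @` (hyp a 0) = hyp a (lform a (tv (t i))).
    by rewrite /A /= -E; exact: (act_hs acx).
  apply/seteqP; split=> [_ [u uH <-]|u uH].
    rewrite /hyp /= (actX _ (XV (Xt i))) tvV// lformB; move: uH; rewrite /hyp /=.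
    by move=> ?; lra.
  exists (act (t i) u); last by rewrite (actK acx).
  by rewrite /hyp /= actX// lformD addr0; move: uH; rewrite /hyp /=.
have [t0|t0|E] := ltgtP (lform a (tv (t i))) 0; last by rewrite E eqxx in ti.
  by exists (- lform a (tv (t i))); [rewrite oppr_gt0|exact: level_opp].
by exists (lform a (tv (t i))).
Qed.

Lemma level_finite (M : K) : finite_set [set k | A k /\ 0 <= k <= M].
Proof.
have [v v1] : exists v, lform a v = - M.
  have [u u0] := lform_neq0 a0; exists ((- M / lform a u) *: u).
  by rewrite lformZ divfK.
have [M0|M0] := ltP M 0.
  apply: (@sub_finite_set _ _ set0) => // k /= [_ /andP[k0 kM]].
  by move: (le_trans k0 kM); rewrite leNgt M0.
have inj : injective (hyp a).
  move=> k k' E; have [w w0] := hyp_exists k a0.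
  have : hyp a k' w by rewrite -E.
  by move: w0; rewrite /hyp /= => ? ?; lra.
apply: (@sub_finite_set _ _ (hyp a @^-1` [set H | hs H /\
    exists2 t : K, 0 <= t <= 1 & H (0 + t *: (v - 0))])); last first.
  by apply: finite_preimage (finite_segment hsF 0 v) => k k' _ _; exact: inj.
move=> k /= [hk /andP[k0 kM]]; split=> //; exists (k / M).
  by rewrite divr_ge0//= ; have [->|N] := eqVneq M 0; [rewrite invr0 mulr0|
    rewrite ler_pdivrMr ?mul1r// lt_def N].
rewrite /hyp /= add0r subr0 lformZ v1; have [E|N] := eqVneq M 0.
  by rewrite E in kM *; lra.
by field.
Qed.

(* The levels form a discrete set that contains 0 and is stable under the
   reflections at its points, hence they are the multiples of the least one. *)
Lemma levels : exists2 k1, 0 < k1 & forall k, A k <-> k / k1 \is a Num.int.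
Proof.
have [M M0 AM] := level_pos.
pose B := fset_set [set k | (A k /\ 0 <= k <= M) /\ 0 < k].
have BE k : k \in B <-> (A k /\ 0 <= k <= M) /\ 0 < k.
  rewrite in_fset_set ?inE//; apply: sub_finite_set (level_finite M).
  by move=> ? [].
have MB : M \in B by apply/BE; split=> //; split=> //; rewrite ltW//=.
have [k1 /BE[[Ak1 /andP[_ k1M]] k10] k1min] := seq_argmin id MB.
have least k : A k -> 0 < k -> k1 <= k.
  move=> Ak k0; have [kM|Mk] := leP k M; last exact: le_trans k1M (ltW Mk).
  by apply: k1min; apply/BE; split=> //; split=> //; rewrite ltW.
have shift k : A k -> A (k + 2 * k1).
  move=> Ak; have := level_refl (level_opp Ak) Ak1.
  by rewrite opprK addrC.
have shiftN k (m : nat) : A k -> A (k + m%:R * (2 * k1)).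
  move=> Ak; elim: m => [|m IH]; first by rewrite mul0r addr0.
  by have := shift _ IH; rewrite -natr1; congr (A _); ring.
have shiftZ k (z : int) : A k -> A (k + z%:~R * (2 * k1)).
  move=> Ak; case: z => m; first exact: shiftN.
  have := level_opp (shiftN _ m.+1 (level_opp Ak)).
  by congr (A _); rewrite NegzE mulrNz; ring.
exists k1 => // k; split=> [Ak|/intrP[z E]]; last first.
  have -> : k = z%:~R * k1 by rewrite -E divfK// gt_eqF.
  have [q [e ->]] : exists (q : int) (e : bool), z = q * 2 + e%:Z.
    by exists (z %/ 2)%Z, ((z %% 2)%Z == 1); lia.
  rewrite intrD intrM; case: e.
    by have := shiftZ _ q Ak1; congr (A _); rewrite /=; ring.
  by have := shiftZ _ q ha0; congr (A _); rewrite /=; ring.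
pose z := Num.floor (k / k1).
have /andP[z1 z2] := Num.Theory.floor_itv (k / k1).
rewrite -/z in z1 z2; move: z2; rewrite intrD => z2.
pose r := k - z%:~R * k1.
have r0 : 0 <= r by rewrite subr_ge0 -ler_pdivlMr.
have r1 : r < k1.
  by move: z2; rewrite ltr_pdivrMr// mulrDl (_ : 1%:~R = 1)// mul1r /r ltrBlDr addrC.
suff r00 : r = 0.
  apply/intrP; exists z; apply: (mulIf (lt0r_neq0 k10)); rewrite divfK ?gt_eqF//.
  by apply/eqP; rewrite -subr_eq0; apply/eqP.
have [q [e zE]] : exists (q : int) (e : bool), z = q * 2 + e%:Z.
  by exists (z %/ 2)%Z, ((z %% 2)%Z == 1); lia.
(* Subtracting multiples of 2 k1 leaves r or r + k1 as a level; the second yields the level k1 - r.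
   Minimality of k1 forces r = 0 in both cases. *)
have Aq := shiftZ _ (- q) Ak.
have qE : k + (- q)%:~R * (2 * k1) = r + (e : nat)%:R * k1.
  by rewrite /r zE intrD intrM mulrNz /=; case: (e) => /=; ring.
rewrite qE in Aq; move: Aq; case: (e) => /=; last first.
  rewrite mul0r addr0 => Ar; apply/eqP; rewrite eq_le r0 andbT leNgt; apply/negP => rp.
  by have := least _ Ar rp; rewrite leNgt r1.
rewrite mul1r => Ar; have := shiftZ _ (- 1) Ar.
have -> : r + k1 + (- 1)%:~R * (2 * k1) = r - k1 by rewrite mulrNz /=; ring.
move/level_opp; rewrite opprB => /least H.
by apply/eqP; rewrite eq_le r0 andbT; have := H; rewrite subr_gt0 => /(_ r1); lra.
Qed.

End Levels.

(** Dividing by the least positive level makes the levels the integers, so every hyperplane of the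
    arrangement comes from a root. *)
Lemma Phi_form a k : hs (hyp a k) -> exists2 c : K, 0 < c & Phi hs (c *: a).
Proof.
move=> h; have ha := hs_lin h; have [k1 k10 lev] := levels ha.
have k1N : k1^-1 != 0 by rewrite invr_eq0 gt_eqF.
exists k1^-1; first by rewrite invr_gt0.
move=> k' /=.
have -> : hyp (k1^-1 *: a) k' = hyp a (k1 * k').
  by rewrite -(hyp_scale a (k1 * k') k1N) mulKf ?gt_eqF.
by have := lev (k1 * k'); rewrite [k1 * _]mulrC mulfK ?gt_eqF.
Qed.

Lemma Phi_opp a : Phi hs a -> Phi hs (- a).
Proof.
move=> Pa k; have -> : hyp (- a) k = hyp a (- k).
  by rewrite -scaleN1r -[k in LHS]opprK -[- - k]mulN1r hyp_scale// oppr_eq0 oner_eq0.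
by rewrite Pa rpredN.
Qed.

Lemma Phi_hs a : Phi hs a -> hs (hyp a 0).
Proof. by move=> Pa; apply/Pa; exact: rpred0. Qed.

Lemma weyl_chamberE D : is_weyl_chamber hs D <-> is_chamber hs0 D.
Proof.
rewrite /is_weyl_chamber /is_chamber.
suff -> : \bigcup_(a in Phi hs) [set v | lform a v = 0] = \bigcup_(H in hs0) H by [].
apply/seteqP; split=> v [] /=.
  move=> a Pa va; exists (hyp a 0); first by apply/hs0E; split=> //; exact: Phi_hs.
  by rewrite /hyp /= va addr0.
move=> H h Hv; have [a [k E]] := hs_form hs0H h; rewrite E in h Hv.
have [ha k0] := (hs0E a k).1 h; have [c c_gt0 Pc] := Phi_form ha.
exists (c *: a) => //=; rewrite lformZl; move: Hv; rewrite /hyp /= k0 addr0 => ->.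
by rewrite mulr0.
Qed.

Lemma weyl_chamber_point D : is_weyl_chamber hs D -> exists2 d, D d &
  regular0 d /\ forall q, D q <-> forall a k, hs (hyp a k) -> 0 < lform a d * lform a q.
Proof.
move=> /weyl_chamberE hD; have [d Dd] := chamber_nonempty hD; exists d => //.
have [rd DP] := chamberP hs0H hD Dd; split; first exact/regular0P.
by move=> q; rewrite DP; exact: same_side0P.
Qed.

Lemma chamber_image w p a k : hs (hyp a k) -> (act w @` C0) p ->
  0 < aff a k (act w c0) * aff a k p.
Proof.
move=> h [q /(C0P acx C0c0) cq <-]; exact: (same_side_act acx w cq h).
Qed.

(** Only the hyperplane of t = w s w^-1 separates wC_0 from wsC_0. Once its form is scaled to a root
    positive on [D], both sides say that it is negative on wC_0. *)
Lemma orient_posE (W1 : groupType) (pi : W1 -> W) D d (w : W1) s :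
  is_weyl_chamber hs D -> D d -> S s ->
  orient_pos rho hs C0 pi D w s <-> osign sepg (eg d) (pi w) s.
Proof.
move=> hD Dd Ss; have [d' Dd' [rd' DP]] := weyl_chamber_point hD.
have rd : regular0 d.
  by move=> a k h; have := (DP d).1 Dd _ _ h; apply: contraTneq => ->; rewrite mulr0 ltxx.
have Dpos a k q : hs (hyp a k) -> D q -> 0 < lform a d * lform a q.
  move=> h Dq; have x := (DP q).1 Dq _ _ h; have y := (DP d).1 Dd _ _ h.
  have z2 : 0 < lform a d' ^+ 2.
    by rewrite exprn_even_gt0//=; apply: contraTneq x => ->; rewrite mul0r ltxx.
  by rewrite -(pmulr_rgt0 _ z2); have := mulr_gt0 x y; congr (0 < _); ring.
set t := cnj (pi w) s.
have tE a k : hs (hyp a k) -> (aff a k (act (pi w) c0) * aff a k (act (pi w * s)%g c0) < 0) =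
    (sH (hyp a k) == t).
  move=> h; have rw := regular_act acx (pi w) rc0 h.
  have rws := regular_act acx (pi w * s)%g rc0 h.
  rewrite (opp_signs rw (rc0 h) rws) [aff a k (act (pi w) c0) * _]mulrC -!sepE//.
  by rewrite (sepMs ws)//; case: (sepg _ _); case: (_ == _).
have [Hs Hw sE] := Ss; have [hHs _] := Hw.
have [as_ [ks_ Es]] := hs_form hsH hHs.
have ht : hs (hyp (pushl rho (pi w) as_) (pushk rho (pi w) as_ ks_)).
  by apply: (hs_push acx); rewrite -Es.
have Et : t = sH (hyp (pushl rho (pi w) as_) (pushk rho (pi w) as_ ks_)).
  by rewrite (sH_push acx) -Es// sE.
have main a k : hs (hyp a k) -> t = sH (hyp a k) -> 0 < lform a d ->
    osign sepg (eg d) (pi w) s = (aff a k (act (pi w) c0) < 0).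
  move=> h E ad; rewrite /osign -/t E egE// sepE// pmulr_rlt0//.
  have := rc0 h; have := regular_act acx (pi w) rc0 h.
  move: (aff a k c0) (aff a k (act (pi w) c0)) => y z.
  case: (ltgtP z 0) => // z0 _; case: (ltgtP y 0) => // y0 _ /=.
  - by rewrite -leNgt nmulr_rge0// ltW.
  - by rewrite pmulr_rlt0.
  - by rewrite nmulr_rlt0// z0.
  - by apply/negbTE; rewrite -leNgt pmulr_rge0// ltW.
split.
  move=> [a [k [Pa aD h neg pos]]].
  have n1 : aff a k (act (pi w) c0) < 0 by apply: neg; exists c0.
  have p1 : 0 < aff a k (act (pi w * s)%g c0) by apply: pos; exists c0.
  have E : t = sH (hyp a k).
    by apply/esym/eqP; rewrite -tE// nmulr_rlt0.
  by rewrite (main _ _ h E (aD _ Dd)).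
have [c c_gt0 Pc] := Phi_form ht.
move: ht Et Pc; move: (pushl _ _ _) (pushk _ _ _ _) => a k h E Pc os.
have [e [eN ed Pe]] : exists e, [/\ e != 0, 0 < lform (e *: a) d & Phi hs (e *: a)].
  have [d0|d0|d0] := ltgtP (lform a d) 0; last by have := rd _ _ h; rewrite d0 eqxx.
    exists (- c); split; first by rewrite oppr_eq0 gt_eqF.
      by rewrite lformZl mulNr oppr_gt0 pmulr_rlt0.
    by rewrite scaleNr; exact: Phi_opp.
  by exists c; split=> //; [rewrite gt_eqF|rewrite lformZl mulr_gt0].
have h' : hs (hyp (e *: a) (e * k)) by rewrite hyp_scale.
have E' : t = sH (hyp (e *: a) (e * k)) by rewrite hyp_scale.
have n1 : aff (e *: a) (e * k) (act (pi w) c0) < 0 by rewrite -(main _ _ h' E' ed).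
have p1 : 0 < aff (e *: a) (e * k) (act (pi w * s)%g c0).
  by have := tE _ _ h'; rewrite -E' eqxx nmulr_rlt0.
exists (e *: a), (e * k); split=> //.
- by move=> q /(Dpos _ _ _ h'); rewrite pmulr_rgt0.
- by move=> q /(chamber_image h'); rewrite nmulr_rgt0.
- by move=> q /(chamber_image h'); rewrite pmulr_rgt0.
Qed.

End SphericalGeometry.

(** * The affine pro-p Hecke algebra *)

Lemma gprod_cat (G : groupType) (l l' : seq G) : gprod (l ++ l') = (gprod l * gprod l')%g.
Proof. by elim: l => [|x l IH] /=; rewrite ?mul1g// IH mulgA. Qed.

Lemma take_enum_ord r i : (i <= r)%N -> [seq j <- enum 'I_r | (val j < i)%N] = take i (enum 'I_r).
Proof.
move=> ir; apply: (inj_map val_inj).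
rewrite map_take val_enum_ord take_iota (minn_idPl ir).
rewrite -(filter_map val (fun j => (j < i)%N)) val_enum_ord.
rewrite -{1}(subnKC ir) iotaD filter_cat add0n.
rewrite (@eq_in_filter _ _ xpredT) ?filter_predT; last by move=> j; rewrite mem_iota.
rewrite (@eq_in_filter _ _ xpred0) ?filter_pred0 ?cats0// => j.
by rewrite mem_iota => /andP[ij _]; rewrite ltnNge ij.
Qed.

Section GeometricHecke.
Variables (K : realType) (n : nat).
Variables (W : groupType) (rho : W -> 'M[K]_n * 'cV[K]_n).
Variables (hs : set (set 'cV[K]_n)) (C0 : set 'cV[K]_n) (sH : set 'cV[K]_n -> W).
Variables (W1 : groupType) (pi : W1 -> W) (nl : W -> W1).
Variables (R : comNzRingType) (HA : algType R) (T : W1 -> HA).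
Variables (a : W -> R) (b : W -> W1 -> R).
Hypothesis acx : affine_ext_coxeter rho hs C0 sH.
Hypothesis ppc : pro_p_coxeter hs C0 sH pi nl.
Hypothesis gh : generic_hecke rho hs C0 sH pi nl T a b.
Variable c0 : 'cV[K]_n.
Hypothesis C0c0 : C0 c0.
Local Notation S := (Sgen hs C0 sH).
Local Notation sepg := (sepg rho hs sH c0).
Local Notation eg := (eg hs sH c0).
Local Notation theta := (theta rho hs C0 sH pi nl T b).
Local Notation bernstein := (bernstein S sepg pi nl T a b).
Let ws := wall_system_geometric acx C0c0.

Lemma hecke_datum_geometric : hecke_datum S sepg pi nl T a b.
Proof.
case: ppc => pM ps _ pn _; case: gh => [bRT [ab [span [free [mult sq]]]]].
split=> //.
- by move=> s /bRT[].
- by move=> s t /bRT[_ bT] /bT.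
- move=> s t w Ss St E; have [w1 Ew] := ps w.
  by have [|//] := ab s t w1 Ss St; rewrite Ew.
- by move=> s t w Ss St E; have [_] := ab s t w Ss St E.
- by move=> w w' E; apply: mult; rewrite !(ellE acx C0c0).
Qed.

Let hd := hecke_datum_geometric.

(** In a reduced word every prefix step lengthens, so [berns] contributes no factor a_s and unwinds
    into the product of letters. *)
Lemma bernstein_word e F (l : seq W) (u : W1) : bernstein e F ->
  (forall s, s \in l -> S s) -> nosep sepg (pi u) ->
  len sepg (pi (gprod (map nl l) * u)%g) = size l ->
  F (gprod (map nl l) * u)%g =
  \prod_(0 <= i < size l) bern_letter sepg pi nl T b e (pi (gprod (take i (map nl l)))) (nth 1%g l i) * T u.
Proof.
move=> bF lS uO; rewrite (piM hd) (lenMu ws)// => lenl.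
rewrite (bernu bF)//; congr (_ * _).
pose pre i := gprod (take i (map nl l)).
have preS i : (i < size l)%N -> pre i.+1 = (pre i * nl (nth 1%g l i))%g.
  move=> il; rewrite /pre (take_nth 1%g) ?size_map// -cats1 gprod_cat /= mulg1.
  by rewrite (nth_map 1%g).
have Sn i : (i < size l)%N -> S (nth 1%g l i) by move=> il; apply/lS/mem_nth.
have piS i : (i < size l)%N -> pi (pre i.+1) = (pi (pre i) * nth 1%g l i)%g.
  by move=> il; rewrite preS// (piM hd) (pi_nl hd) //; exact: Sn.
have lenS i : (i < size l)%N -> (len sepg (pi (pre i.+1)) <= (len sepg (pi (pre i))).+1)%N.
  move=> il; rewrite piS//; case sw: (sepg (cnj (pi (pre i)) (nth 1%g l i)) (pi (pre i))).
    by rewrite (lenMs_down ws (Sn _ il) sw); apply: leqW; exact: leqnSn.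
  by rewrite (lenMs_up ws (Sn _ il) sw).
(* Going backwards from the full word, each dropped letter costs at most one unit of length.
   Together with [len_bot], this fixes the length of every prefix. *)
have len_top j : (j <= size l)%N -> (size l <= len sepg (pi (pre (size l - j))) + j)%N.
  elim: j => [|j IH] jl.
    by rewrite subn0 addn0 /pre -{2}(size_map nl l) take_size lenl.
  apply: leq_trans (IH (ltnW jl)) _; have lt : (size l - j.+1 < size l)%N by lia.
  have := lenS _ lt; have -> : (size l - j.+1).+1 = (size l - j)%N by lia.
  by move=> ?; lia.
have len_bot i : (i <= size l)%N -> (len sepg (pi (pre i)) <= i)%N.
  elim: i => [|i IH] il; first by rewrite /pre take0 /= (pi1 hd) /len (nosep_wlen _ (nosep1 ws)).
  by apply: leq_trans (lenS _ il) _; rewrite ltnS IH// ltnW.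
have len_pre i : (i <= size l)%N -> len sepg (pi (pre i)) = i.
  move=> il; apply/eqP; rewrite eqn_leq len_bot//=.
  by have := len_top (size l - i)%N (leq_subr _ _); rewrite subKn//; lia.
have main i : (i <= size l)%N -> F (pre i) =
    \prod_(0 <= j < i) bern_letter sepg pi nl T b e (pi (pre j)) (nth 1%g l j).
  elim: i => [|i IH] il.
    by rewrite big_nil /pre take0 /= (bern1 bF).
  have il' := ltnW il; rewrite big_nat_recr//= -(IH il') (berns bF); last exact: Sn.
  case sw: (sepg _ _); last by rewrite expr0 scale1r preS.
  have := lenMs_down ws (Sn _ il) sw; rewrite -piS// (len_pre _ il) (len_pre _ il').
  by move=> ?; lia.
have := main _ (leqnn _); rewrite {1}/pre -{1}(size_map nl l) take_size => ->.
by [].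
Qed.

(** Every value allowed by [bernstein_rel] equals [F w], and a reduced word exists, so the choice in
    [theta] is forced and its default 0 is never taken. *)
Lemma bernstein_thetaE D d F : is_weyl_chamber hs D -> D d -> bernstein (eg d) F ->
  theta D =1 F.
Proof.
move=> hD Dd bF w; rewrite /theta.
have uniq h : bernstein_rel rho hs C0 sH pi nl T b D w h -> h = F w.
  move=> [r [ss [u [rE ssS uO wE ->]]]].
  pose l := [seq ss i | i <- enum 'I_r].
  have sl : size l = r by rewrite size_map size_enum_ord.
  have wE' : w = (gprod (map nl l) * u)%g by rewrite /l -map_comp; exact: wE.
  have lS s : s \in l -> S s by move=> /mapP[i _ ->].
  rewrite wE' (bernstein_word bF) ?sl//; last 2 first.
  - exact/(OmegaP acx C0c0).
  - by rewrite -wE' -(ellE acx C0c0) -rE.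
  congr (_ * _); rewrite big_mkord; apply: eq_bigr => i _.
  have nE : nth 1%g l i = ss i.
    by rewrite (nth_map i) ?size_enum_ord// nth_ord_enum.
  rewrite nE take_enum_ord; last exact: (ltnW (ltn_ord i)).
  rewrite /l -map_comp -map_take.
  rewrite /bern_letter; set pre := gprod _.
  have <- : `[< orient_pos rho hs C0 pi D pre (ss i) >] = osign sepg (eg d) (pi pre) (ss i).
    apply/asboolP/idP; first by move=> /(orient_posE acx C0c0 pi pre hD Dd (ssS i)).
    by move=> ?; exact/(orient_posE acx C0c0 pi pre hD Dd (ssS i)).
  by case: ifP.
have [h hrel] : exists h, bernstein_rel rho hs C0 sH pi nl T b D w h.
  have [ss [u0 [ssS [uO wE]]]] := word_len_len acx C0c0 (pi w).
  rewrite -(ellE acx C0c0) in ss ssS wE.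
  eexists; exists (ell rho hs C0 sH (pi w)), ss, ((gprod [seq nl (ss i) | i <- enum 'I_(ell rho hs C0 sH (pi w))])^-1 * w)%g.
  split=> //; last by rewrite mulVKg.
  rewrite /Omega1 /= (piM hd) (piV hd).
  have -> : pi (gprod [seq nl (ss i) | i <- enum 'I_(ell rho hs C0 sH (pi w))]) =
      gprod [seq ss i | i <- enum 'I_(ell rho hs C0 sH (pi w))].
    elim: (enum _) => [|i s IH] /=; first exact: (pi1 hd).
    by rewrite (piM hd) (pi_nl hd)// IH.
  by move: wE; move: (gprod _) => g ->; rewrite mulKg.
by case: xgetP => [h' -> /uniq//|/(_ h)]; case.
Qed.

End GeometricHecke.
Theorem theorem3p6p3
  (K : realType) (n : nat)
  (W : groupType) (rho : W -> 'M[K]_n * 'cV[K]_n)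
  (hs : set (set 'cV[K]_n)) (C0 : set 'cV[K]_n) (sH : set 'cV[K]_n -> W)
  (W1 : groupType) (pi : W1 -> W) (nl : W -> W1)
  (R : comNzRingType) (HA : algType R) (T : W1 -> HA)
  (a : W -> R) (b : W -> W1 -> R) :
  affine_ext_coxeter rho hs C0 sH ->
  pro_p_coxeter hs C0 sH pi nl ->
  generic_hecke rho hs C0 sH pi nl T a b ->
  (* Z(H) = (A_o)^{W1} for every spherical orientation o = o_D *)
  (forall D, is_weyl_chamber hs D ->
     (@hecke_center R HA) = A_invariants rho hs C0 sH pi nl T b D) /\
  (* z_gamma does not depend on the spherical orientation *)
  (forall D D' x, is_weyl_chamber hs D -> is_weyl_chamber hs D' ->
     finite_orbit_rep rho pi x ->
     z_orbit rho hs C0 sH pi nl T b D x = z_orbit rho hs C0 sH pi nl T b D' x) /\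
  (* {z_gamma}, gamma finite orbit in X1, is an R-basis of Z(H) *)
  (forall D, is_weyl_chamber hs D ->
     (forall x, finite_orbit_rep rho pi x ->
        (@hecke_center R HA) (z_orbit rho hs C0 sH pi nl T b D x)) /\
     (forall z, (@hecke_center R HA) z ->
        exists (m : nat) (xs : 'I_m -> W1) (c : 'I_m -> R),
          (forall i, finite_orbit_rep rho pi (xs i)) /\
          z = \sum_(i < m) c i *: z_orbit rho hs C0 sH pi nl T b D (xs i)) /\
     (forall (m : nat) (xs : 'I_m -> W1) (c : 'I_m -> R),
        (forall i, finite_orbit_rep rho pi (xs i)) ->
        (forall i j, i != j -> conj_orbit (xs i) <> conj_orbit (xs j)) ->
        \sum_(i < m) c i *: z_orbit rho hs C0 sH pi nl T b D (xs i) = 0 ->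
        forall i, c i = 0)).
Proof.
move=> acx ppc gh.
have [c0 C0c0] : exists c, C0 c.
  by have [_ [hH [_ [C0P _]]]] := acx; exact: chamber_nonempty C0P.
have hd := hecke_datum_geometric acx ppc gh C0c0.
have sd := spherical_geometric acx C0c0.
have [th thP] : exists th : sphere_index hs -> W1 -> HA, forall d,
    bernstein (Sgen hs C0 sH) (sepg rho hs sH c0) pi nl T a b (eg hs sH c0 (sval d)) (th d).
  by exists (fun d => sval (cid (approx_bernstein hd (eD_approx sd d)))) => d; case: cid.
(* A point of each Weyl chamber identifies its integral Bernstein map with one of the maps built by
   approximation. *)
have thE D : is_weyl_chamber hs D -> exists d, theta rho hs C0 sH pi nl T b D = th d.
  move=> hD; have [d Dd [rd _]] := weyl_chamber_point acx hD.
  exists (exist _ d rd : sphere_index hs).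
  by apply/funext; exact: (bernstein_thetaE acx ppc gh C0c0 hD Dd (thP (exist _ d rd))).
have zE D d x : theta rho hs C0 sH pi nl T b D = th d ->
    z_orbit rho hs C0 sH pi nl T b D x = Zsum (th d) (orbit_indic R x).
  by move=> E; rewrite /z_orbit E Zsum_orbit.
have xcl x : finite_orbit_rep rho pi x -> class_function pi (Xtr rho) (orbit_indic R x).
  by move=> [Xx fx]; exact: (orbit_indic_class hd sd Xx fx).
split; [|split].
- move=> D /thE[d E]; apply/seteqP; split=> z.
    by move=> /(center_Zsum hd sd thP d)/(invariantsP hd (Xtr rho) _ (thP d)); rewrite /A_invariants /= E.
  rewrite /A_invariants /= E => /(invariantsP hd (Xtr rho) _ (thP d))[c cc ->] h.
  exact: (Zsum_central hd sd thP).
- move=> D D' x /thE[d E] /thE[d' E'] /xcl cx.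
  by rewrite (zE _ _ _ E) (zE _ _ _ E'); exact: (Zsum_indep hd sd thP).
move=> D /thE[d E]; split; [|split].
- move=> x /xcl cx h; rewrite (zE _ _ _ E).
  exact: (Zsum_central hd sd thP).
- move=> z /(center_Zsum hd sd thP d)[c cc ->].
  have [L [LP ->]] := class_function_span hd sd (th d) cc.
  exists (size L), (fun i => (nth (1%g, 0) L i).1), (fun i => (nth (1%g, 0) L i).2); split.
    by move=> i; exact/LP/mem_nth.
  by rewrite (big_nth (1%g, 0)) big_mkord /z_orbit E.
- move=> m xs c xf dx; rewrite /z_orbit E => E0.
  by apply: (orbit_sums_free hd (thP d) _ dx E0) => i; have [] := xf i.
Qed.
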